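(* Let $J(\cdot)$ be a driftless subordinator with Lévy measure $\nu$ such that $\mathbb{E}J(1)<1$, let $X(t)=J(t)-t$ with Lévy exponent $\varphi(\alpha)=\log\mathbb{E}e^{-\alpha X(1)}$, let $V(\cdot)$ be the associated workload process with an arbitrary distribution for $V(0)$, and let $\hat\varphi_n^\Delta(\alpha)$ be the estimator defined in the context from the sampling rate $\xi$ and the grid width $\Delta$. Then for all $\xi>0$, $\Delta>0$ and $\alpha\ge 0$, $$\lim_{n\to\infty}\hat\varphi_n^\Delta(\alpha)=\varphi(\alpha)\quad\text{almost surely.}$$
   Context: Model. $J(\cdot)=\{J(t)\}_{t\ge 0}$ is a subordinator (an almost surely nondecreasing Lévy process: stationary independent increments, càdlàg paths, $J(0)=0$) without drift. The net input is $X(t)=J(t)-t$, and the stability condition $\mathbb{E}X(1)<0$ (i.e. $\mathbb{E}J(1)<1$) is assumed. The Lévy exponent $\varphi:[0,\infty)\to\mathbb{R}$ is $$\varphi(\alpha)=\log\mathbb{E}e^{-\alpha X(1)}=\alpha-\int_{(0,\infty)}(1-e^{-\alpha x})\,\nu(\mathrm{d}x),$$ where $\nu$ is the Lévy measure of $J$, a measure on $(0,\infty)$ with $\int_{(0,\infty)}\min\{1,x\}\,\nu(\mathrm{d}x)<\infty$. The workload process is $$V(t)=X(t)+\max\Big\{V(0),\,-\inf_{0\le s\le t}X(s)\Big\},\qquad t\ge 0,$$ where the initial workload $V(0)\ge 0$ is independent of $J(\cdot)$. Sampling. Let $T_1,T_2,\dots$ be i.i.d. exponential random variables with rate $\xi>0$,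 independent of the workload process. Put $S_0=0$ and $S_i=\sum_{j=1}^i T_j$. For $\Delta>0$ let $S_i^\Delta=\Delta\lfloor S_i/\Delta\rceil$, where $\lfloor\cdot\rceil$ denotes rounding to the nearest integer (ties occur with probability zero for $i\ge1$), so $S_i^\Delta$ is the integer multiple of $\Delta$ closest to $S_i$. Let $V_i^\Delta=V(S_i^\Delta)$ for $i\ge 0$; in particular $V_0^\Delta=V(0)$. Estimator. For $\alpha\ge 0$ and $n\ge 1$, $$\hat\varphi_n^\Delta(\alpha)=\frac{n^{-1}\xi\,(e^{-\alpha V_n^\Delta}-e^{-\alpha V_0^\Delta})+\alpha\, n^{-1}\sum_{i=1}^n\mathbf{1}\{V_i^\Delta=0\}}{n^{-1}\sum_{i=1}^n e^{-\alpha V_i^\Delta}}.$$ *)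

(* Defs.v *)
From HB Require Import structures.
From mathcomp Require Import all_boot all_order all_algebra.
From mathcomp Require Import all_classical all_reals all_analysis.

Set Implicit Arguments.
Unset Strict Implicit.
Unset Printing Implicit Defensive.

Import Order.TTheory GRing.Theory Num.Theory.
Import numFieldNormedType.Exports.

Local Open Scope classical_set_scope.
Local Open Scope ring_scope.

Section independence.
Context (d : measure_display) (Omega : measurableType d) (R : realType).
Variable P : probability Omega R.

Definition process_sigma_algebra (I : Type) (D : set I) (X : I -> Omega -> R) :
    set (set Omega) :=
  <<s \bigcup_(t in D)
        preimage_set_system [set: Omega] (X t) (@measurable _ R) >>.

Definition independent_classes (F G : set (set Omega)) : Prop :=
  forall A B, F A -> G B -> P (A `&` B) = (P A * P B)%E.

Definition mutually_independent (I : eqType) (X : I -> Omega -> R) : Prop :=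
  forall (s : seq I) (B : I -> set R), uniq s ->
    (forall i, i \in s -> measurable (B i)) ->
    P (\big[setI/setT]_(i <- s) (X i @^-1` B i))
      = (\prod_(i <- s) P (X i @^-1` B i))%E.

End independence.

Definition cadlag (R : realType) (f : R -> R) : Prop :=
  (forall t : R, 0 <= t -> f x @[x --> t^'+] --> f t) /\
  (forall t : R, 0 < t -> exists l : R, f x @[x --> t^'-] --> l).

Section model.
Context (d : measure_display) (Omega : measurableType d) (R : realType).
Variable P : probability Omega R.

(* Processes in continuous time are indexed by the whole of [R]; only the
   indices [t >= 0] are ever constrained. *)
Record subordinator (J : R -> {RV P >-> R}) : Prop := Subordinator {
  subordinator_start : {ae P, forall w, J 0 w = 0} ;
  subordinator_cadlag : {ae P, forall w, cadlag (fun t => J t w)} ;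
  subordinator_nondecreasing :
    {ae P, forall w, forall s t : R, 0 <= s -> s <= t -> J s w <= J t w} ;
  subordinator_independent_increments :
    forall t : nat -> R, 0 <= t 0%N ->
      {homo t : m n / (m <= n)%N >-> m <= n} ->
      mutually_independent P (fun (i : nat) w => J (t i.+1) w - J (t i) w) ;
  subordinator_stationary_increments :
    forall s t : R, 0 <= s -> s <= t -> forall B : set R, measurable B ->
      P ((fun w => J t w - J s w) @^-1` B) = P (J (t - s) @^-1` B)
}.

Definition levy_measure (nu : {measure set (measurableTypeR R) -> \bar R}) :
    Prop :=
  nu `]-oo, 0]%classic = 0%E /\
  (\int[nu]_(x in `]0%R, +oo[) (Num.min 1 x)%:E < +oo)%E.

(* The absence of a linear term in [alpha] in the Levy-Khintchine formula is
   what makes the subordinator driftless. *)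
Definition driftless_subordinator (J : R -> {RV P >-> R})
    (nu : {measure set (measurableTypeR R) -> \bar R}) : Prop :=
  [/\ subordinator J, levy_measure nu
    & forall alpha : R, 0 <= alpha ->
        ('E_P[fun w => expR (- alpha * J 1 w)%R])%E
        = (expR (- \int[nu]_(x in `]0, +oo[) (1 - expR (- alpha * x))))%:E].

Definition net_input (J : R -> {RV P >-> R}) (t : R) (w : Omega) : R :=
  J t w - t.

Definition levy_exponent (J : R -> {RV P >-> R}) (alpha : R) : R :=
  ln (fine ('E_P[fun w => expR (- alpha * net_input J 1 w)%R])%E).

(* [V 0] is the freely chosen initial workload: at [t = 0] the equation below
   reads [V 0 w = Num.max (V 0 w) 0], since [J 0 w = 0] almost surely. *)
Definition workload (J V : R -> {RV P >-> R}) : Prop :=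
  [/\ {ae P, forall w, 0 <= V 0 w},
      independent_classes P
        (process_sigma_algebra [set 0] V)
        (process_sigma_algebra [set t : R | 0 <= t] J)
    & {ae P, forall w, forall t : R, 0 <= t ->
        V t w = net_input J t w +
          Num.max (V 0 w) (- inf [set net_input J s w | s in `[0, t]])}].

(* [T j] is the inter-sampling time with (one-based) index [j.+1]. *)
Definition poisson_sampling (xi : R) (V : R -> {RV P >-> R})
    (T : nat -> {RV P >-> R}) : Prop :=
  [/\ forall j (B : set R), measurable B ->
        distribution P (T j) B = exponential_prob xi B,
      mutually_independent P T
    & independent_classes P
        (process_sigma_algebra [set: nat] T)
        (process_sigma_algebra [set t : R | 0 <= t] V)].

Definition sampling_time (T : nat -> {RV P >-> R}) (i : nat) (w : Omega) : R :=
  \sum_(j < i) T j w.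

(* Nearest integer, ties rounded up. *)
Definition round_nearest (x : R) : int := Num.floor (x + 2^-1).

Definition grid_sampling_time (Delta : R) (T : nat -> {RV P >-> R})
    (i : nat) (w : Omega) : R :=
  Delta * (round_nearest (sampling_time T i w / Delta))%:~R.

Definition sampled_workload (V : R -> {RV P >-> R}) (Delta : R)
    (T : nat -> {RV P >-> R}) (i : nat) (w : Omega) : R :=
  V (grid_sampling_time Delta T i w) w.

Definition estimator (V : R -> {RV P >-> R}) (xi Delta : R)
    (T : nat -> {RV P >-> R}) (n : nat) (alpha : R) (w : Omega) : R :=
  let VD i := sampled_workload V Delta T i w in
  (n%:R^-1 * xi * (expR (- alpha * VD n) - expR (- alpha * VD 0%N))
   + alpha * (n%:R^-1 * \sum_(1 <= i < n.+1) (VD i == 0)%:R))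
  / (n%:R^-1 * \sum_(1 <= i < n.+1) expR (- alpha * VD i)).

End model.

(* Main.v *)
(* Freezing the path of V (it is independent of the sampling
   times), a renewal argument shows that averages of f(V) over the rounded
   sampling times have the same limit as averages of f(V(k Delta)) over the
   grid. For nonincreasing left-continuous f with values in [0, 1] these grid
   averages converge: V((k + m) Delta) is the maximum of the workload [window]
   of a queue started empty at time k Delta and of a term that is positive only
   if V(k Delta) is large or the increments over m steps are, and the windows
   are stationary and m-dependent. Tightness of V(k Delta) comes from the drift
   of the Lyapunov function x + exp(- theta x) / theta.
   Let s(f) be the limit. For the queue observed on a mesh of width h and
   started empty, one step of the Lindley recursion gives, with W its
   equilibrium workload and phi the Levy exponent,
     alpha P(W = 0) E(h - J(h))^+ <= (exp(h phi) - 1) E exp(- alpha W)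
                                  <= (exp(alpha h) - 1) P(W <= h),
   and h -> 0 along Delta / 2^q yields phi s(exp(- alpha .)) = alpha s(1_{. <= 0}),
   which is the ratio estimated. *)
Require Import Defs.
From HB Require Import structures.
From mathcomp Require Import all_boot all_order all_algebra.
From mathcomp Require Import all_classical all_reals all_analysis.
From mathcomp Require Import measurable_realfun zify ring lra.

Set Implicit Arguments.
Unset Strict Implicit.
Unset Printing Implicit Defensive.

Import Order.TTheory GRing.Theory Num.Theory.
Import numFieldNormedType.Exports.

Local Open Scope classical_set_scope.
Local Open Scope ring_scope.

(** * Expectations and independence *)

(** Since [V 0] is arbitrary, the workload need not be stationary; it is only compared with windows,
    which bound it from below and, up to a tail, from above. Rounding can put several sampling times
    into one cell, so the sampled values have no simple transition kernel; instead [g (S i)] is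
    compensated by [xi] times the integral of [g], which works for every measurable [g] with values
    in [0, 1]. Two obstacles shape the rest. Only the mean of [J 1] is finite, so second-moment laws
    are applied to truncated increments, and the excess is handled by a one-sided bound with the
    lossy factor 3, harmless because the mean of the excess can be made arbitrarily small. And the
    idle indicator is discontinuous: nonincreasing left-continuous tests contain both it and the
    exponentials, and pass to increasing limits of mesh workloads. The two bounds of the one-step
    inequality involve [W = 0] and [W <= h]; they meet because [s(1_{. <= y})] is right-continuous
    at [y = 0] and because, without drift, [E (h - J h)^+ / h] tends to 1. *)

Section real_expectation.
Context d (Omega : measurableType d) (R : realType) (P : probability Omega R).
Local Notation E := (Rintegral P setT).
Implicit Types f g : Omega -> R.

Definition intg (f : Omega -> R) := P.-integrable setT (EFin \o f).

Lemma intg_measurable f : intg f -> measurable_fun setT f.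
Proof. by move=> /integrableP[/measurable_EFinP]. Qed.

Lemma intg_bounded f C : measurable_fun setT f -> (forall w, `|f w| <= C) ->
  intg f.
Proof.
move=> mf fC; apply: measurable_bounded_integrable => //.
  by rewrite (le_lt_trans (probability_le1 _ _)) ?ltry.
by exists C; split => [|M CM w _ /=]; rewrite ?num_real// (le_trans (fC w))// ltW.
Qed.

Lemma intg_cst r : intg (fun=> r).
Proof. exact: finite_measure_integrable_cst. Qed.

Lemma intgD f g : intg f -> intg g -> intg (fun w => f w + g w).
Proof. exact: (@integrableD _ _ _ P setT measurableT (EFin \o f) (EFin \o g)). Qed.

Lemma intgZ r f : intg f -> intg (fun w => r * f w).
Proof. exact: (@integrableZl _ _ _ P setT measurableT r (EFin \o f)). Qed.

Lemma intgN f : intg f -> intg (fun w => - f w).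
Proof.
by move=> /(intgZ (-1)); under [X in intg X -> _]eq_fun do rewrite mulN1r.
Qed.

Lemma intgB f g : intg f -> intg g -> intg (fun w => f w - g w).
Proof. by move=> If /intgN; exact: intgD. Qed.

Lemma intg_sum (I : Type) (s : seq I) (Q : pred I) (f : I -> Omega -> R) :
  (forall i, intg (f i)) -> intg (fun w => \sum_(i <- s | Q i) f i w).
Proof.
move=> If; rewrite (_ : (fun w => _) = (\sum_(i <- s | Q i) f i)); last first.
  by apply/funext => w; rewrite fct_sumE.
elim/big_rec : _ => [|i g _ Ig]; first exact: intg_cst.
exact: intgD.
Qed.

Lemma intg_le f g : measurable_fun setT f -> (forall w, `|f w| <= g w) ->
  intg g -> intg f.
Proof.
move=> mf fg Ig; apply: le_integrable Ig => //; first exact/measurable_EFinP.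
by move=> w _ /=; rewrite lee_fin (le_trans (fg w))// ler_norm.
Qed.

Lemma E_cst r : E (fun=> r) = r.
Proof. by rewrite Rintegral_cst//= probability_setT/= mulr1. Qed.

Lemma E_D f g : intg f -> intg g -> E (fun w => f w + g w) = E f + E g.
Proof. by move=> *; rewrite RintegralD. Qed.

Lemma E_B f g : intg f -> intg g -> E (fun w => f w - g w) = E f - E g.
Proof. by move=> *; rewrite RintegralB. Qed.

Lemma E_Z r f : intg f -> E (fun w => r * f w) = r * E f.
Proof. by move=> *; rewrite RintegralZl. Qed.

Lemma E_sum (I : Type) (s : seq I) (Q : pred I) (f : I -> Omega -> R) :
  (forall i, intg (f i)) ->
  E (fun w => \sum_(i <- s | Q i) f i w) = \sum_(i <- s | Q i) E (f i).
Proof.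
move=> If; elim: s => [|i s IH].
  by under eq_Rintegral do rewrite big_nil; rewrite E_cst big_nil.
rewrite big_cons -IH.
under eq_Rintegral do rewrite big_cons.
by case: ifPn => // Qi; rewrite E_D//; exact: intg_sum.
Qed.

Lemma E_le f g : intg f -> intg g -> (forall w, f w <= g w) -> E f <= E g.
Proof. by move=> *; exact: le_Rintegral. Qed.

Lemma E_ge0 f : (forall w, 0 <= f w) -> 0 <= E f.
Proof. by move=> *; exact: Rintegral_ge0. Qed.

Lemma E_norm f : intg f -> `|E f| <= E (fun w => `|f w|).
Proof. by move=> *; exact: le_normr_Rintegral. Qed.

Lemma E_bounded f C : measurable_fun setT f -> (forall w, `|f w| <= C) ->
  `|E f| <= C.
Proof.
move=> mf fC; have If := intg_bounded mf fC.
apply: (le_trans (E_norm If)); rewrite -[leRHS]E_cst; apply: E_le => //.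
  apply: (@intg_bounded _ C) => [|w]; last by rewrite normr_id.
  exact/measurableT_comp.
exact: intg_cst.
Qed.

Lemma E_EFin f : intg f -> (\int[P]_w (f w)%:E)%E = (E f)%:E.
Proof. by move=> If; rewrite fineK//; exact: integrable_fin_num. Qed.

Lemma E_ae f g : measurable_fun setT f -> measurable_fun setT g ->
  {ae P, forall w, f w = g w} -> E f = E g.
Proof.
move=> mf mg fg; congr fine; apply: ae_eq_integral => //;
  [exact/measurable_EFinP..|].
by apply: filterS fg => w /= -> .
Qed.

Lemma E_dominated (f_ : nat -> Omega -> R) f g :
  (forall n, measurable_fun setT (f_ n)) -> measurable_fun setT f -> intg g ->
  {ae P, forall w, f_ n w @[n --> \oo] --> f w} ->
  {ae P, forall w n, `|f_ n w| <= g w} ->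
  E (f_ n) @[n --> \oo] --> E f.
Proof.
move=> mf_ mf Ig fcv fg.
have mE (h : Omega -> R) : measurable_fun setT h -> measurable_fun setT (EFin \o h).
  by move=> mh; exact/measurable_EFinP.
have [|||] := @dominated_convergence _ _ _ P setT measurableT
  (fun n w => (f_ n w)%:E) (EFin \o f) (EFin \o g) (fun n => mE _ (mf_ n)) (mE _ mf).
- by apply: filterS fcv => w fw _; apply: cvg_EFin => //; exact: nearW.
- exact: Ig.
- by apply: filterS fg => w fw n _; rewrite /= lee_fin.
move=> If _ cv; apply: fine_cvg; rewrite -E_EFin//.
Qed.

Lemma E_bounded_cvg (f_ : nat -> Omega -> R) f C :
  (forall n, measurable_fun setT (f_ n)) -> measurable_fun setT f ->
  (forall n w, `|f_ n w| <= C) ->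
  {ae P, forall w, f_ n w @[n --> \oo] --> f w} ->
  E (f_ n) @[n --> \oo] --> E f.
Proof.
move=> mf_ mf fC fcv.
apply: (@E_dominated _ _ (fun=> C)) => //; first exact: intg_cst.
by apply: aeW => w n.
Qed.

End real_expectation.

Section independent_maps.
Context d (Omega : measurableType d) (R : realType) (P : probability Omega R).
Context d1 d2 (S1 : measurableType d1) (S2 : measurableType d2).
Local Notation E := (Rintegral P setT).
Variables (X : Omega -> S1) (Y : Omega -> S2).
Hypotheses (mX : measurable_fun setT X) (mY : measurable_fun setT Y).

Definition independent_maps := forall A B, measurable A -> measurable B ->
  P (X @^-1` A `&` Y @^-1` B) = (P (X @^-1` A) * P (Y @^-1` B))%E.

Hypothesis XY : independent_maps.

Let Xm : {mfun Omega >-> S1} :=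
  MeasurableFun.Pack (MeasurableFun.Class (isMeasurableFun.Build _ _ _ _ _ mX)).
Let Ym : {mfun Omega >-> S2} :=
  MeasurableFun.Pack (MeasurableFun.Class (isMeasurableFun.Build _ _ _ _ _ mY)).
Let mXY : measurable_fun setT (fun w => (X w, Y w)).
Proof. exact: measurable_fun_pair. Qed.
Let XYm : {mfun Omega >-> (S1 * S2)%type} :=
  MeasurableFun.Pack (MeasurableFun.Class (isMeasurableFun.Build _ _ _ _ _ mXY)).

Let joint_distribution A : measurable A ->
  (distribution P Xm \x distribution P Ym)%E A = distribution P XYm A.
Proof.
apply: product_measure_unique => A1 A2 mA1 mA2.
exact: XY.
Qed.

(** The law of the pair is the product of the marginal laws, as both agree on rectangles.
    Integrability is asked of every section, so that the inner [fine] is harmless at each [w1]. *)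
Lemma independent_fubini (h : S1 * S2 -> R) :
  measurable_fun setT h -> intg P (fun w => h (X w, Y w)) ->
  (forall w1, intg P (fun w2 => h (X w1, Y w2))) ->
  E (fun w => h (X w, Y w)) = E (fun w1 => E (fun w2 => h (X w1, Y w2))).
Proof.
move=> mh Ih Ih2.
have mh' : measurable_fun setT (EFin \o h) by exact/measurable_EFinP.
have Ihd : (distribution P Xm \x distribution P Ym)%E.-integrable setT (EFin \o h).
  apply/integrableP; split => //.
  rewrite (eq_measure_integral (distribution P XYm)); last first.
    by move=> A mA _; exact: joint_distribution.
  rewrite (ge0_integral_distribution XYm)//; last exact: measurableT_comp.
  by case/integrableP: Ih.
rewrite /Rintegral; congr fine.
rewrite -(integral_distribution (X := XYm) mh' Ih).
rewrite (eq_measure_integral (distribution P Xm \x distribution P Ym)%E);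
  last by move=> A mA _; exact/esym/joint_distribution.
rewrite -integral12_prod_meas1//.
have /integrableP[mF IF] : (distribution P Xm).-integrable setT
    (fubini_F (distribution P Ym) (EFin \o h)).
  exact: (integrable_fubini_F Ihd).
rewrite (integral_distribution (X := Xm)) //; last first.
  apply/integrableP; split; first exact: measurableT_comp.
  rewrite (ge0_integral_distribution Xm) in IF => //.
  exact: measurableT_comp.
apply: eq_integral => w _ /=; rewrite /fubini_F (integral_distribution (X := Ym))//.
- by rewrite fineK//; apply: integrable_fin_num => //; exact: Ih2.
- exact: measurableT_comp mh' (measurable_pair1 (X w)).
- exact: Ih2.
Qed.

(** Fubini for null sets: if almost every section of the exceptional set is null, the set is null
    under the joint law. This is what freezes the workload path later. *)
Lemma independent_ae (Q : S1 * S2 -> Prop) : measurable [set z | Q z] ->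
  {ae P, forall w1, {ae P, forall w2, Q (X w1, Y w2)}} ->
  {ae P, forall w, Q (X w, Y w)}.
Proof.
move=> mQ QXY; pose N := ~` [set z | Q z].
have mN : measurable N by exact: measurableC.
exists (XYm @^-1` N); split.
- by rewrite -[X in measurable X]setTI; exact: measurable_funP.
- rewrite -[LHS]/(distribution P XYm N) -joint_distribution//.
  rewrite /product_measure1 /= (ge0_integral_distribution Xm)//; last first.
    exact: measurable_fun_xsection.
  rewrite -[RHS](integral0 P setT).
  have mF : measurable_fun setT
      ((fun x => distribution P Ym (xsection N x)) \o X).
    by apply: measurableT_comp mX; exact: measurable_fun_xsection.
  apply: ae_eq_integral => //.
  suff : {ae P, forall w, distribution P Ym (xsection N (X w)) = 0%E}.
    by apply: filterS => w /= ->.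
  apply: filterS QXY => w [M [mM M0 QM]].
  apply: (subset_measure0 (mu := P) (B := M)) => //.
    by rewrite -[X in measurable X]setTI; apply: mY => //; exact: measurable_xsection.
  by move=> w2 /=; rewrite /xsection/= inE => Nw2; exact: QM.
- by move=> w /= nQ.
Qed.

End independent_maps.

Section independent_real.
Context d (Omega : measurableType d) (R : realType) (P : probability Omega R).
Local Notation E := (Rintegral P setT).

Lemma independent_expectation (X Y : Omega -> R) (f g : R -> R) C :
  measurable_fun setT X -> measurable_fun setT Y -> independent_maps P X Y ->
  measurable_fun setT f -> measurable_fun setT g ->
  (forall x, `|f x| <= C) -> (forall x, `|g x| <= C) ->
  E (fun w => f (X w) * g (Y w)) = E (f \o X) * E (g \o Y).
Proof.
move=> mX mY XY mf mg fC gC.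
have mfX : measurable_fun setT (f \o X) by exact: measurableT_comp.
have mgY : measurable_fun setT (g \o Y) by exact: measurableT_comp.
have IfX : intg P (f \o X) := intg_bounded P mfX (fun w => fC (X w)).
have IgY : intg P (g \o Y) := intg_bounded P mgY (fun w => gC (Y w)).
rewrite (@independent_fubini _ _ _ _ _ _ _ _ X Y mX mY XY
  (fun z => f z.1 * g z.2)).
- under eq_Rintegral do rewrite /= (E_Z _ IgY) mulrC.
  by rewrite E_Z// mulrC.
- by apply: measurable_funM; exact: measurableT_comp.
- apply: (@intg_bounded _ _ _ _ _ (C * C)) => [|w]; first exact: measurable_funM.
  by rewrite normrM ler_pM.
- by move=> w /=; exact: intgZ.
Qed.

End independent_real.

(** * Generated sigma-algebras and adaptedness *)

Section pi_systems.
Context d (Omega : measurableType d) (R : realType) (P : probability Omega R).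

Lemma g_sigma_measurable (G : set (set Omega)) : G `<=` measurable ->
  <<s G >> `<=` measurable.
Proof. by move=> GM; apply: smallest_sub => //; exact: sigma_algebra_measurable. Qed.

(** The events independent of a fixed [C] form a Dynkin class. Applied once in each argument, this
    gives [independent_g_sigma]. *)
Let independent_extend (F : set (set Omega)) (C : set Omega) :
  F `<=` measurable -> setI_closed F -> measurable C ->
  (forall A, F A -> P (A `&` C) = (P A * P C)%E) ->
  forall A, <<s F >> A -> P (A `&` C) = (P A * P C)%E.
Proof.
move=> FM FI mC FC.
apply: (@dynkin_induction _ (g_sigma_algebraType F)) => //.
- by rewrite setTI probability_setT mul1e.
- move=> S /(g_sigma_measurable FM) mS SC.
  have -> : P (~` S `&` C) = (P C - P (S `&` C))%E.
    rewrite setIC -setDE measureD//= ?[(C `&` S)%classic]setIC//.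
    by rewrite (le_lt_trans (probability_le1 _ _)) ?ltry.
  rewrite probability_setC// SC muleBl ?mul1e ?fin_num_measure//.
- move=> B mB tB BC; rewrite setI_bigcupl.
  have mB' n : d.-measurable (B n : set Omega) := g_sigma_measurable FM (mB n).
  rewrite measure_bigcup//; last 2 first.
  + by move=> n _; exact: measurableI.
  + by apply: trivIset_setIr.
  rewrite muleC measure_bigcup//= -[P C]fineK ?fin_num_measure// -nneseriesZl//.
  apply: eq_eseriesr => n _; rewrite fineK ?fin_num_measure// muleC; exact: BC.
Qed.

Lemma independent_g_sigma (F G : set (set Omega)) :
  F `<=` measurable -> G `<=` measurable -> setI_closed F -> setI_closed G ->
  independent_classes P F G -> independent_classes P <<s F >> <<s G >>.
Proof.
move=> FM GM FI GI FG A C sA sC.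
apply: independent_extend sA => //; first exact: (g_sigma_measurable GM).
move=> B FB; rewrite setIC muleC; apply: independent_extend sC => //.
  exact: FM.
by move=> D GD; rewrite setIC muleC; exact: FG.
Qed.

End pi_systems.

Section sub_sigma_algebras.
Context d (Omega : measurableType d) (R : realType) (P : probability Omega R).
Context (I : eqType) (X : I -> Omega -> R).
Hypothesis mX : forall i, measurable_fun setT (X i).
Implicit Types D : set I.

Definition process_events D : set (set Omega) :=
  \bigcup_(t in D) preimage_set_system [set: Omega] (X t) (@measurable _ R).

(** The generated sigma-algebra is put on the domain itself, so that adaptedness is ordinary
    measurability and its closure lemmas apply. *)
Definition adapted d' (S : measurableType d') D (f : Omega -> S) :=
  @measurable_fun _ _ (g_sigma_algebraType (process_events D)) S setT f.

Lemma process_events_measurable D : process_events D `<=` measurable.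
Proof. by move=> A [i _ [B mB <-]]; exact: mX. Qed.

Lemma adapted_measurable d' (S : measurableType d') D (f : Omega -> S) :
  adapted D f -> measurable_fun setT f.
Proof.
move=> mf _ B mB; apply: (g_sigma_measurable (@process_events_measurable D)).
exact: mf.
Qed.

Lemma adapted_process D i : D i -> adapted D (X i).
Proof.
by move=> Di _ B mB; apply: sub_sigma_algebra; exists i => //; exists B.
Qed.

Lemma adapted_sub d' (S : measurableType d') D D' (f : Omega -> S) :
  D `<=` D' -> adapted D f -> adapted D' f.
Proof.
move=> DD' mf _ B mB; have := mf measurableT B mB.
by apply: sub_sigma_algebra2 => A [i Di Ai]; exists i => //; exact: DD'.
Qed.

Let cylinders D := [set A | exists s (B : I -> set R),
  [/\ uniq s, {in s, forall i, D i}, (forall i, measurable (B i)) &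
   A = \big[setI/setT]_(i <- s) (X i @^-1` B i)]].

Let cylinder_measurable D : cylinders D `<=` measurable.
Proof.
move=> A [s [B [_ _ mB ->]]]; apply: bigsetI_measurable => i _.
by rewrite -[X in measurable X]setTI; exact: mX.
Qed.

(** Padding with the full set brings two cylinders to a common index list, where their intersection
    is visibly a cylinder. *)
Let cylinder_widen (s s' : seq I) (B : I -> set R) : uniq s -> uniq s' ->
  {subset s <= s'} ->
  \big[setI/setT]_(i <- s) (X i @^-1` B i) =
  \big[setI/setT]_(i <- s') (X i @^-1` (if i \in s then B i else setT)).
Proof.
move=> us us' ss'.
transitivity (\big[setI/setT]_(i <- [seq i <- s' | i \in s]) (X i @^-1` B i)).
  apply: perm_big; apply: uniq_perm; rewrite ?filter_uniq// => i.
  by rewrite mem_filter; have [/ss' ->|] := boolP (i \in s).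
rewrite [RHS](bigID (fun i => i \in s))/= [X in _ `&` X]big1 ?setIT; last first.
  by move=> i /negbTE ->; rewrite preimage_setT.
by rewrite big_filter; apply: eq_bigr => i ->.
Qed.

Let cylinder_setI D : setI_closed (cylinders D).
Proof.
move=> A A' [s [B [us sD mB ->]]] [s' [B' [us' sD' mB' ->]]].
pose t := undup (s ++ s'); have ut : uniq t by exact: undup_uniq.
rewrite (cylinder_widen B us ut); last by move=> i; rewrite mem_undup mem_cat => ->.
rewrite (cylinder_widen B' us' ut); last first.
  by move=> i; rewrite mem_undup mem_cat orbC => ->.
exists t, (fun i => (if i \in s then B i else setT) `&`
                    (if i \in s' then B' i else setT)); split => //.
- by move=> i; rewrite mem_undup mem_cat => /orP[/sD|/sD'].
- by move=> i; apply: measurableI; case: ifP.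
- by rewrite -big_split.
Qed.

Let cylinders_generate D : <<s process_events D >> `<=` <<s cylinders D >>.
Proof.
apply: smallest_sub; first exact: smallest_sigma_algebra.
move=> A [i Di [B mB <-]]; apply: sub_sigma_algebra.
exists [:: i], (fun=> B); split => //.
- by move=> j; rewrite inE => /eqP ->.
- by rewrite big_seq1 setTI.
Qed.

Hypothesis indX : mutually_independent P X.

(** For two cylinders the index lists are disjoint, so their concatenation is duplicate-free and
    mutual independence factors the probability; cylinders are a pi-system generating the
    sigma-algebras. *)
Lemma mutually_independent_disjoint D D' : D `&` D' = set0 ->
  independent_classes P <<s process_events D >> <<s process_events D' >>.
Proof.
move=> DD' A A' /cylinders_generate cA /cylinders_generate cA'.
apply: (@independent_g_sigma _ _ _ _ (cylinders D) (cylinders D')) => //.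
move=> {cA cA'}{}A {}A' [s [B [us sD mB ->]]] [s' [B' [us' sD' mB' ->]]].
have ss' i : i \in s -> i \notin s'.
  move=> /sD Di; apply/negP => /sD' D'i.
  by have : (D `&` D') i by []; rewrite DD'.
pose C i := if i \in s then B i else B' i.
have CB : \big[setI/setT]_(i <- s) (X i @^-1` B i) =
    \big[setI/setT]_(i <- s) (X i @^-1` C i).
  by apply: eq_big_seq => i si; rewrite /C si.
have CB' : \big[setI/setT]_(i <- s') (X i @^-1` B' i) =
    \big[setI/setT]_(i <- s') (X i @^-1` C i).
  by apply: eq_big_seq => i; rewrite /C; case: ifPn => // /ss' /negP.
have mC i : measurable (C i) by rewrite /C; case: ifP.
rewrite CB CB' -big_cat !indX ?big_cat//.
rewrite cat_uniq us us' andbT/=; apply/hasPn => i; apply/contraL.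
exact: ss'.
Qed.

Lemma adapted_independent d1 d2 (S1 : measurableType d1)
    (S2 : measurableType d2) D D' (f : Omega -> S1) (g : Omega -> S2) :
  D `&` D' = set0 ->
  adapted D f -> adapted D' g -> independent_maps P f g.
Proof.
move=> DD' mf mg A B mA mB; apply: (mutually_independent_disjoint DD').
- by rewrite -[X in <<s _ >> X]setTI; exact: mf.
- by rewrite -[X in <<s _ >> X]setTI; exact: mg.
Qed.

End sub_sigma_algebras.

(** * A strong law for weakly correlated sequences *)

Section squares.
Context (R : realType).

Lemma nat_sqrt_bracket n : exists k : nat, (k ^ 2 <= n < k.+1 ^ 2)%N.
Proof.
elim: n => [|n [k /andP[k1 k2]]]; first by exists 0%N.
have [le|gt] := ltnP n.+1 (k.+1 ^ 2)%N; first by exists k; rewrite ltnW ?le.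
exists k.+1; rewrite gt/=; move: k2 gt; rewrite !expnS !expn0; nia.
Qed.

(* The squares are dense enough for this: consecutive ones below [n] are at
   distance [O(sqrt n)]. *)
Lemma cvg_along_squares (B : nat -> R) C :
  (forall n, `|B n.+1 - B n| <= C) ->
  (n.+1 ^ 2)%:R^-1 * B (n.+1 ^ 2)%N @[n --> \oo] --> 0 ->
  n%:R^-1 * B n @[n --> \oo] --> 0.
Proof.
move=> BC B0.
have C0 : 0 <= C := le_trans (normr_ge0 _) (BC 0%N).
have Bij i j : `|B (i + j)%N - B i| <= j%:R * C.
  elim: j => [|j IH]; first by rewrite addn0 subrr normr0 mul0r.
  rewrite addnS (_ : B _ - _ = (B (i + j).+1 - B (i + j)%N) + (B (i + j)%N - B i));
    last by rewrite addrA subrK.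
  by rewrite (le_trans (ler_normD _ _))// -natr1 mulrDl mul1r addrC lerD.
apply/cvgrPdist_le => e e0.
have e20 : 0 < e / 2 by rewrite divr_gt0.
have [N _ BN] := (cvgrPdist_le _ _).1 B0 _ e20.
(* Once the root [k] of the preceding square exceeds [4 C / e], the at most [2 k] steps from that
   square to [n] cost at most half of [k ^ 2 * e]. *)
pose M := maxn N (Num.truncn (4 * C / e)).+1.
exists (M.+1 ^ 2)%N => // n /= Mn.
have [k /andP[kn nk]] := nat_sqrt_bracket n.
have Mk : (M < k)%N.
  rewrite ltnNge; apply/negP => kM.
  have := leq_trans nk (leq_trans _ Mn); rewrite ltnn => /(_ _)/negP[] //.
  by rewrite leq_sqr ltnS.
case: k => // k in kn nk Mk *.
have Nk : (N <= k)%N by rewrite (leq_trans (leq_maxl _ _) (ltnSE Mk)).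
have k0 : 0 < (k.+1 ^ 2)%:R :> R by rewrite ltr0n expn_gt0.
have n0 : 0 < n%:R :> R by rewrite ltr0n (leq_trans _ kn)// expn_gt0.
rewrite sub0r normrN normrM gtr0_norm ?invr_gt0// ler_pdivrMl//.
have := BN _ Nk; rewrite sub0r normrN normrM gtr0_norm ?invr_gt0// ler_pdivrMl// => Bk.
have Bn : `|B n - B (k.+1 ^ 2)%N| <= (2 * k.+1)%:R * C.
  rewrite -{1}(subnKC kn) (le_trans (Bij _ _))// ler_wpM2r// ler_nat.
  by move: nk; rewrite !expnS !expn0; nia.
have kC : 4 * C <= e * k.+1%:R.
  rewrite -ler_pdivrMl// mulrC (le_trans (ltW (truncnS_gt _)))// ler_nat.
  by rewrite (leq_trans (leq_maxr N _))// ltnW// ltnW.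
have kn' : (k.+1 ^ 2)%:R <= n%:R :> R by rewrite ler_nat.
rewrite -(subrK (B (k.+1 ^ 2)%N) (B n)) (le_trans (ler_normD _ _))//.
rewrite (le_trans (lerD Bn Bk))//.
have {}kC : (2 * k.+1)%:R * C <= (k.+1 ^ 2)%:R * (e / 2).
  rewrite natrM natrX expr2 -mulrA (_ : 2%:R * _ = k.+1%:R * (4 * C) / 2); last by field.
  rewrite -(mulrA k.+1%:R) -[leRHS]mulrA ler_wpM2l//; nra.
rewrite (le_trans (lerD kC (lexx _)))//.
by rewrite -mulrDr -splitr ler_wpM2r// ltW.
Qed.

(** Telescoping: [(n + 2)^-2 <= (n + 1)^-1 - (n + 2)^-1]; the subtracted term is what the induction
    consumes. *)
Lemma sum_inv_squares n :
  \sum_(i < n.+1) (i.+1 ^ 2)%:R^-1 <= 2 - n.+1%:R^-1 :> R.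
Proof.
elim: n => [|n IH]; first by rewrite big_ord1/= invr1; lra.
rewrite big_ord_recr/= (le_trans (lerD IH (lexx _)))//.
rewrite -lerBrDl.
have n1 : 0 < n.+1%:R :> R by rewrite ltr0n.
have n2 : 0 < n.+2%:R :> R by rewrite ltr0n.
rewrite (_ : _ - _ = (n.+1%:R * n.+2%:R)^-1); last first.
  have e : n.+2%:R = n.+1%:R + 1 :> R by rewrite natr1.
  rewrite e in n2 *; move: n1 n2 {e}; move: (n.+1%:R : R) => x n1 n2.
  by field; rewrite !gt_eqF.
rewrite lef_pV2 ?posrE ?mulr_gt0 ?ltr0n ?expn_gt0//.
by rewrite -natrM ler_nat !expnS expn0; nia.
Qed.

End squares.

Section second_moments.
Context d (Omega : measurableType d) (R : realType) (P : probability Omega R).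
Local Notation E := (Rintegral P setT).

(** The total sum has finite mean, so it is finite almost everywhere and its terms vanish. This
    takes the place of a Borel-Cantelli argument. *)
Lemma ae_cvg_of_summable (F : nat -> Omega -> R) C :
  (forall n, intg P (F n)) -> (forall n w, 0 <= F n w) ->
  (forall n, \sum_(i < n) E (F i) <= C) ->
  {ae P, forall w, F n w @[n --> \oo] --> 0}.
Proof.
move=> IF F0 FC.
have mF n : measurable_fun setT (fun w => (F n w)%:E).
  exact/measurable_EFinP/intg_measurable/IF.
have F0' n w : (0 <= (F n w)%:E)%E by rewrite lee_fin.
pose S w := (\sum_(0 <= n <oo) (F n w)%:E)%E.
have mS : measurable_fun setT S by exact: ge0_emeasurable_sum.
have IS : P.-integrable setT S.
  apply/integrableP; split => //.
  under eq_integral do rewrite gee0_abs ?nneseries_ge0//.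
  rewrite integral_nneseries//.
  apply: (@le_lt_trans _ _ C%:E); last exact: ltry.
  apply: lime_le; first by apply: is_cvg_nneseries => n _ _; rewrite integral_ge0.
  apply: nearW => n; rewrite big_mkord.
  under eq_bigr do rewrite E_EFin//.
  by rewrite sumEFin lee_fin.
apply: filterS (integrable_ae measurableT IS) => w /(_ I) finS.
apply: cvg_series_cvg_0; rewrite seriesEnat.
apply: nondecreasing_is_cvgn; first by apply: nondecreasing_series => n _ _.
exists (fine (S w)) => _ [n _ <-] /=.
rewrite -lee_fin fineK// -sumEFin.
exact: nneseries_lim_ge.
Qed.

Lemma ae_cvg_of_square_sums (Y : nat -> Omega -> R) C :
  (forall n, intg P (fun w => Y n w ^+ 2)) ->
  (forall n, E (fun w => Y n w ^+ 2) <= C * (n.+1 ^ 2)%:R^-1) ->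
  {ae P, forall w, Y n w @[n --> \oo] --> 0}.
Proof.
move=> IY YC.
have C0 : 0 <= C.
  have /(le_trans _) := YC 0%N; rewrite exp1n invr1 mulr1; apply.
  by apply: E_ge0 => w; exact: sqr_ge0.
apply: filterS (@ae_cvg_of_summable (fun n w => Y n w ^+ 2) (C * 2) IY _ _) => [w Y2|n w|n].
- apply/norm_cvg0P; rewrite (_ : (fun n => _) = (fun n => Num.sqrt (Y n w ^+ 2))).
    by rewrite -(sqrtr0 R); apply: continuous_cvg Y2; exact: sqrt_continuous.
  by apply/funext => n; rewrite sqrtr_sqr.
- exact: sqr_ge0.
- rewrite (le_trans (ler_sum _ (fun (i : 'I_n) _ => YC i)))//.
  rewrite -mulr_sumr ler_wpM2l//.
  case: n => [|n]; first by rewrite big_ord0.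
  by rewrite (le_trans (sum_inv_squares _ n))// gerBl.
Qed.

(** Adding [Z n] to the partial sum creates a cross term to which at most [m] earlier indices
    contribute, each at most [2 K]; doubled, this is [4 m K], and the square of [Z n] adds [K]. *)
Lemma weak_orthogonal_moment (Z : nat -> Omega -> R) K m :
  (forall n, measurable_fun setT (Z n)) ->
  (forall n, intg P (fun w => Z n w ^+ 2)) ->
  (forall n, E (fun w => Z n w ^+ 2) <= K) ->
  (forall i n, (i + m <= n)%N -> E (fun w => Z i w * Z n w) = 0) ->
  forall n, intg P (fun w => (\sum_(i < n) Z i w) ^+ 2) /\
    E (fun w => (\sum_(i < n) Z i w) ^+ 2) <= n%:R * ((4 * m%:R + 1) * K).
Proof.
move=> mZ IZ ZK Z0.
have K0 : 0 <= K.
  by rewrite (le_trans _ (ZK 0%N))//; apply: E_ge0 => w; exact: sqr_ge0.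
have Zij i j w : `|Z i w * Z j w| <= Z i w ^+ 2 + Z j w ^+ 2.
  rewrite ler_norml; have := sqr_ge0 (Z i w - Z j w).
  have := sqr_ge0 (Z i w + Z j w).
  have := sqr_ge0 (Z i w); have := sqr_ge0 (Z j w); rewrite !expr2; nra.
have IZij i j : intg P (fun w => Z i w * Z j w).
  apply: intg_le (Zij i j) _; last exact: intgD.
  exact: measurable_funM.
have EZij i j : `|E (fun w => Z i w * Z j w)| <= 2 * K.
  rewrite (le_trans (E_norm (IZij i j)))// mulr2n mulrDl mul1r.
  rewrite (le_trans _ (lerD (ZK i) (ZK j)))// -E_D//.
  apply: E_le => [||w]; [|exact: intgD|exact: Zij].
  apply: (intg_le _ _ (intgD (IZ i) (IZ j))) => [|w]; last by rewrite normr_id.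
  exact/measurableT_comp/measurable_funM.
pose A n w := \sum_(i < n) Z i w.
have A2 n : A n = fun w => \sum_(i < n) Z i w by [].
have IAZ n : intg P (fun w => A n w * Z n w).
  under eq_fun do rewrite /A mulr_suml.
  exact: intg_sum.
have EAZ n : E (fun w => A n w * Z n w) <= m%:R * (2 * K).
  under eq_Rintegral do rewrite /A mulr_suml.
  rewrite (E_sum (P := P) _ _ (f := fun (i : 'I_n) w => Z i w * Z n w))//.
  rewrite (bigID (fun i : 'I_n => (i + m <= n)%N))/= big1 ?add0r; last first.
    by move=> i; exact: Z0.
  apply: (@le_trans _ _ (\sum_(i < n | ~~ (i + m <= n)%N) 2 * K)).
    by apply: ler_sum => i _; exact: le_trans (ler_norm _) (EZij _ _).
  rewrite sumr_const -[leLHS]mulr_natl ler_wpM2r ?mulr_ge0// ler_nat.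
  rewrite -[leqRHS]card_ord.
  have [m0|m0] := posnP m.
    by rewrite eq_card0// => i; rewrite unfold_in m0 addn0 (ltnW (ltn_ord i)).
  (* An index [i < n] with [n < i + m] is determined by [n - i.+1], which is below [m]; the
     remainder only makes the map total. *)
  pose g (i : 'I_n) : 'I_m := Ordinal (ltn_pmod (n - i.+1) m0).
  rewrite -(@card_in_image _ _ g) ?max_card//.
  move=> i j; rewrite !unfold_in -!ltnNge => im jm /(congr1 val) /=.
  have := ltn_ord i; have := ltn_ord j => jn inn.
  by rewrite !modn_small; [|lia..] => ij; apply: val_inj => /=; lia.
have AS n w : A n.+1 w ^+ 2 = A n w ^+ 2 + 2 * (A n w * Z n w) + Z n w ^+ 2.
  by rewrite /A big_ord_recr/= sqrrD -mulr_natl.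
have IA2 n : intg P (fun w => A n w ^+ 2).
  elim: n => [|n IH].
    rewrite [X in intg _ X](_ : _ = fun=> 0); last by apply/funext => w; rewrite /A big_ord0 expr0n.
    exact: intg_cst.
  under eq_fun do rewrite AS.
  by apply: intgD => //; apply: intgD => //; exact: (intgZ 2 (IAZ n)).
have EA2 n : E (fun w => A n w ^+ 2) <= n%:R * ((4 * m%:R + 1) * K).
  elim: n => [|n IH].
    by under eq_Rintegral do rewrite /A big_ord0 expr0n/=; rewrite E_cst mul0r.
  under eq_Rintegral do rewrite AS.
  rewrite E_D//; last by apply: intgD => //; exact: (intgZ 2 (IAZ n)).
  rewrite E_D//; last exact: (intgZ 2 (IAZ n)).
  rewrite E_Z// -natr1 mulrDl mul1r; have := EAZ n; have := ZK n; nra.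
by move=> n; split; [exact: IA2|exact: EA2].
Qed.

(** A second moment of order [N], divided by [N ^ 2], is of order [(n + 1)^-2] at [N = (n + 1) ^ 2],
    hence summable. *)
Lemma weak_orthogonal_slln_squares (Z : nat -> Omega -> R) K m :
  (forall n, measurable_fun setT (Z n)) ->
  (forall n, intg P (fun w => Z n w ^+ 2)) ->
  (forall n, E (fun w => Z n w ^+ 2) <= K) ->
  (forall i n, (i + m <= n)%N -> E (fun w => Z i w * Z n w) = 0) ->
  {ae P, forall w,
    (n.+1 ^ 2)%:R^-1 * (\sum_(i < n.+1 ^ 2) Z i w) @[n --> \oo] --> 0}.
Proof.
move=> mZ IZ ZK Z0; have IE := weak_orthogonal_moment mZ IZ ZK Z0.
apply: (@ae_cvg_of_square_sums _ ((4 * m%:R + 1) * K)) => n.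
  by under eq_fun do rewrite exprMn; exact: (intgZ _ (IE _).1).
under eq_Rintegral do rewrite exprMn.
rewrite (E_Z _ (IE (n.+1 ^ 2)%N).1).
apply: le_trans (ler_wpM2l (sqr_ge0 _) (IE (n.+1 ^ 2)%N).2) _.
have : (n.+1 ^ 2)%:R != 0 :> R by rewrite pnatr_eq0 -lt0n expn_gt0.
move: ((n.+1 ^ 2)%:R : R) => x x0.
by rewrite le_eqVlt; apply/orP; left; apply/eqP; field.
Qed.

Lemma weak_orthogonal_slln (Z : nat -> Omega -> R) C m :
  (forall n, measurable_fun setT (Z n)) ->
  (forall n w, `|Z n w| <= C) ->
  (forall i n, (i + m <= n)%N -> E (fun w => Z i w * Z n w) = 0) ->
  {ae P, forall w, n%:R^-1 * (\sum_(i < n) Z i w) @[n --> \oo] --> 0}.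
Proof.
move=> mZ ZC Z0.
have Z2 n w : `|Z n w ^+ 2| <= C ^+ 2 by rewrite normrX ler_pXn2r ?nnegrE// (le_trans _ (ZC n w)).
have mZ2 n : measurable_fun setT (fun w => Z n w ^+ 2) by exact: measurable_funX.
apply: filterS (@weak_orthogonal_slln_squares Z (C ^+ 2) m mZ _ _ Z0) => [w|n|n].
- apply: (@cvg_along_squares _ (fun n => \sum_(i < n) Z i w) C) => n.
  by rewrite big_ord_recr/= addrAC subrr add0r.
- exact: intg_bounded (Z2 n).
- exact: le_trans (ler_norm _) (E_bounded P (mZ2 n) (Z2 n)).
Qed.

End second_moments.

(** * Averages at renewal times *)

Section exponential_law.
Context d (Omega : measurableType d) (R : realType) (P : probability Omega R).
Local Notation E := (Rintegral P setT).
Local Notation leb := (@lebesgue_measure R).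
Variables (T : {RV P >-> R}) (xi : R).
Hypothesis xi0 : 0 < xi.
Hypothesis law_T : forall B, measurable B ->
  distribution P T B = exponential_prob xi B.

Let mpdf : measurable_fun setT (exponential_pdf xi).
Proof. exact: measurable_exponential_pdf. Qed.

Let pdf0 x : 0 <= exponential_pdf xi x.
Proof. by rewrite exponential_pdf_ge0// ltW. Qed.

Let mltr d' (S : measurableType d') (f g : S -> R) : measurable_fun setT f ->
  measurable_fun setT g -> measurable [set x | f x < g x].
Proof.
by move=> mf mg; rewrite -[X in measurable X]setTI; exact: measurable_fun_ltr.
Qed.

Let mler d' (S : measurableType d') (f g : S -> R) : measurable_fun setT f ->
  measurable_fun setT g -> measurable [set x | f x <= g x].
Proof.
by move=> mf mg; rewrite -[X in measurable X]setTI; exact: measurable_fun_ler.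
Qed.

(* Layer-cake representation of [f] and Tonelli. *)
Lemma exponential_expectation (f : R -> R) :
  measurable_fun setT f -> (forall x, 0 <= f x) ->
  (\int[P]_w (f (T w))%:E = \int[leb]_x (f x * exponential_pdf xi x)%:E)%E.
Proof.
move=> mf f0.
pose A := [set z : R * R | 0 <= z.2] `&` [set z | z.2 < f z.1].
have mA : measurable A.
  by apply: measurableI; [exact: mler|by apply: mltr => //; exact: measurableT_comp].
have lA x : leb (xsection A x) = (f x)%:E.
  rewrite (_ : xsection A x = `[0, f x[%classic).
    by rewrite lebesgue_measure_itv/= lte_fin; case: ltP (f0 x) => [_ _|f0' f0x];
      rewrite ?oppr0 ?adde0//; congr EFin; apply/eqP; rewrite eq_le f0' f0x.
  apply/seteqP; split => y; rewrite /xsection/= inE in_itv/=.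
    by move=> [/= -> ->].
  by move=> /andP[].
have pA y : distribution P T (ysection A y) =
    (\int[leb]_x (exponential_pdf xi x * \1_A (x, y))%:E)%E.
  rewrite law_T; last exact: measurable_ysection.
  rewrite /exponential_prob integral_mkcond.
  apply: eq_integral => x _; rewrite patchE indicE mem_ysection.
  by case: ifP => xA; rewrite ?mulr1 ?mulr0.
rewrite -(ge0_integral_distribution T (f := EFin \o f))//; last exact/measurable_EFinP.
transitivity (\int[distribution P T]_x leb (xsection A x))%E.
  by apply: eq_integral => x _; rewrite lA.
have ft := @indic_fubini_tonelli _ _ _ _ _ (distribution P T) leb A mA.
rewrite indic_fubini_tonelli_FE// indic_fubini_tonelli_GE// in ft.
rewrite [LHS]ft.
under eq_integral do rewrite /= pA.
have mk : measurable_fun setT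
    (fun z : R * R => (exponential_pdf xi z.1 * \1_A z)%:E).
  apply/measurable_EFinP/measurable_funM; first exact: measurableT_comp.
  exact: measurable_indic.
have := @fubini_tonelli _ _ _ _ _ leb leb _ mk _.
rewrite /fubini_F /fubini_G => <-; last first.
  by move=> z; rewrite lee_fin mulr_ge0.
apply: eq_integral => x _.
transitivity ((exponential_pdf xi x)%:E * \int[leb]_y (\1_A (x, y))%:E)%E.
  rewrite -ge0_integralZl ?lee_fin//.
  apply/measurable_EFinP.
  by apply: (measurableT_comp _ (measurable_pair1 x)); exact: measurable_indic.
rewrite mulrC EFinM -lA; congr *%E.
transitivity (leb (xsection A x `&` setT)); last by rewrite setIT.
rewrite -integral_indic//; last exact: measurable_xsection.
by apply: eq_integral => y _; rewrite !indicE mem_xsection.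
Qed.

Lemma exponential_ge0 : {ae P, forall w, 0 <= T w}.
Proof.
exists (T @^-1` `]-oo, 0[); split.
- by rewrite -[X in measurable X]setTI; exact: measurable_funP.
- rewrite [LHS](law_T (measurable_itv _)) /exponential_prob.
  apply: integral0_eq => x /=; rewrite in_itv/= => x0.
  by rewrite /exponential_pdf patchE ifF//; apply/negbTE; rewrite mem_setE in_itv/= andbT -ltNge.
- by move=> w /= /negP; rewrite in_itv/= ltNge.
Qed.

Lemma exponential_tail u : 0 <= u -> P [set w | u < T w] = (expR (- xi * u))%:E.
Proof.
move=> u0.
have -> : [set w | u < T w] = ~` (T @^-1` `]-oo, u]).
  by apply/seteqP; split => w /=; rewrite in_itv/= ltNge => /negP.
rewrite probability_setC; last first.
  by rewrite -[X in measurable X]setTI; exact: measurable_funP.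
rewrite [P _](law_T (measurable_itv _)) /exponential_prob.
pose A : set R := `]-oo, u]%classic; pose B : set R := `[0, u]%classic.
have -> : (\int[leb]_(x in A) (exponential_pdf xi x)%:E =
           \int[leb]_(x in B) (exponential_pdf xi x)%:E)%E.
  rewrite integral_mkcond [RHS]integral_mkcond; apply: eq_integral => x _.
  rewrite !patchE /A /B !mem_setE !in_itv/= /exponential_pdf patchE mem_setE in_itv/= andbT.
  by case: (leP 0 x) => //= _; case: ifP.
rewrite /B; move: u0; rewrite le_eqVlt => /predU1P[<-|u0].
  by rewrite set_itv1 integral_set1 mulr0 expR0 sube0.
rewrite -[X in (_ - X)%E]/(exponential_prob xi `[0, u]) exponential_prob_itv0c//.
by rewrite -!EFinB opprB addrC subrK.
Qed.

(** Constant hazard rate: on the half-line the density at [u] is [xi] times the tail [P (u < T)],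
    and Tonelli turns the tail into the indicator of [u < T]. *)
Lemma exponential_compensator (theta : R -> R) :
  measurable_fun setT theta -> (forall x, 0 <= theta x) ->
  measurable_fun setT (fun w => \int[leb]_(u in `[0%R, T w[) (theta u)%:E)%E /\
  (\int[P]_w (theta (T w))%:E =
   xi%:E * \int[P]_w \int[leb]_(u in `[0%R, T w[) (theta u)%:E)%E.
Proof.
move=> mt t0.
pose k (z : Omega * R) : \bar R :=
  (theta z.2 * \1_([set z : Omega * R | 0 <= z.2] `&` [set z | z.2 < T z.1]) z)%:E.
have mk : measurable_fun setT k.
  apply/measurable_EFinP/measurable_funM; first exact: measurableT_comp.
  apply/measurable_indic/measurableI; first exact: mler.
  by apply: mltr => //; exact: measurableT_comp.
have kE w u : k (w, u) = (theta u * ((0 <= u) && (u < T w))%:R)%:E.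
  rewrite /k indicE; congr (_ * _%:R)%:E; apply: congr1.
  by apply/idP/andP => [|[u0 uT]]; rewrite inE/=.
have k0 z : (0 <= k z)%E by rewrite lee_fin mulr_ge0.
have FE : fubini_F leb k = fun w => (\int[leb]_(u in `[0%R, T w[) (theta u)%:E)%E.
  apply/funext => w; rewrite /fubini_F [RHS]integral_mkcond.
  apply: eq_integral => u _; rewrite kE patchE mem_setE in_itv/=.
  by case: ifP; rewrite ?mulr1 ?mulr0.
split; first by rewrite -FE; exact: measurable_fun_fubini_tonelli_F.
have := @fubini_tonelli _ _ _ _ _ P leb k mk k0.
have -> : (\int[P]_x fubini_F leb k x =
    \int[P]_w \int[leb]_(u in `[0%R, T w[) (theta u)%:E)%E.
  by apply: eq_integral => w _; exact: (congr1 (fun F => F w) FE).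
move=> ->; rewrite exponential_expectation//.
rewrite -ge0_integralZl//; [|exact: measurable_fun_fubini_tonelli_G|
  by move=> u _; exact: integral_ge0|by rewrite lee_fin ltW].
apply: eq_integral => u _; rewrite /fubini_G.
under eq_integral do rewrite kE.
have [u0|u0] := leP 0 u; last first.
  rewrite /exponential_pdf patchE mem_setE in_itv/= andbT leNgt u0/= mulr0.
  by rewrite integral0_eq ?mule0// => w _; rewrite mulr0.
transitivity (xi%:E * ((theta u)%:E * \int[P]_w (\1_[set w | (u < T w)%R] w)%:E))%E.
  rewrite integral_indic ?setIT//; last exact: mltr.
  rewrite /= exponential_tail//= -!EFinM; congr EFin.
  by rewrite exponential_pdfE// mulrCA.
congr *%E; rewrite -ge0_integralZl ?lee_fin//; last first.
  apply/measurable_EFinP/measurable_indic; exact: mltr.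
by apply: eq_integral => w _; rewrite -EFinM indicE mem_setE.
Qed.

(** The exponential moment of order [xi / 2] is finite, since the weight [expR (xi / 2 * x)] turns
    the density of rate [xi] into twice the density of rate [xi / 2]. It dominates squares through
    [y <= expR y] at [y = xi / 4 * x]. *)
Lemma exponential_square_integrable : intg P (fun w => T w ^+ 2).
Proof.
pose f (x : R) := expR (xi / 2 * `|x|).
have mf : measurable_fun setT f.
  apply: (measurableT_comp (@measurable_expR R)).
  by apply: measurable_funM => //; exact: measurable_normr.
have xi20 : 0 < xi / 2 by rewrite divr_gt0.
have mp2 : measurable_fun setT (fun x => (exponential_pdf (xi / 2) x)%:E).
  by apply/measurable_EFinP; exact: measurable_exponential_pdf.
have p20 x : (0 <= (exponential_pdf (xi / 2) x)%:E)%E.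
  by rewrite lee_fin exponential_pdf_ge0// ltW.
have If : intg P (f \o T).
  apply/integrableP; split; first exact/measurable_EFinP/measurableT_comp.
  under eq_integral do rewrite /= ger0_norm ?expR_ge0//.
  rewrite exponential_expectation//; last by move=> x; exact: expR_ge0.
  apply: (@le_lt_trans _ _ (2%:E * \int[leb]_x (exponential_pdf (xi / 2) x)%:E)%E).
    rewrite -ge0_integralZl//.
    apply: ge0_le_integral => //.
    + by move=> x _; rewrite lee_fin mulr_ge0 ?expR_ge0.
    + exact/measurable_EFinP/measurable_funM.
    + exact: measurable_funeM.
    + move=> x _; rewrite -EFinM lee_fin /f.
      have [x0|x0] := leP 0 x; last first.
        rewrite /exponential_pdf !patchE mem_setE in_itv/= andbT (lt_geF x0).
        by rewrite !mulr0.
      rewrite !exponential_pdfE// ger0_norm// mulrCA -expRD.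
      rewrite mulrA mulrCA divff// mulr1 le_eqVlt; apply/orP; left; apply/eqP.
      by congr (_ * expR _); field.
  by rewrite integral_exponential_pdf// mule1 ltry.
apply: intg_le (intgZ ((4 / xi) ^+ 2) If) => [|w]; first exact: measurable_funX.
rewrite /f /= (_ : xi / 2 * _ = xi / 4 * `|T w| + xi / 4 * `|T w|); last by field.
rewrite expRD -expr2 -exprMn normrX ler_pXn2r ?nnegrE//; last first.
  by rewrite mulr_ge0// ?divr_ge0// ?ltW// expR_gt0.
rewrite mulrC -ler_pdivrMr ?divr_gt0// (le_trans _ (expR_ge1Dx _))//.
rewrite (_ : `|T w| / _ = xi / 4 * `|T w|) ?lerDr//.
by field; rewrite gt_eqF.
Qed.

End exponential_law.

(** * Primitives of bounded functions *)

Section primitive.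
Context (R : realType).
Local Notation leb := (@lebesgue_measure R).

Lemma lebesgue_translation (s : R) (A : set R) : measurable A ->
  leb ((fun u => s + u) @^-1` A) = leb A.
Proof.
move=> mA.
have ms : @measurable_fun _ _ (measurableTypeR R) (measurableTypeR R) setT
    (fun u : R => s + u) by exact: measurable_funD.
pose shift : {mfun measurableTypeR R >-> measurableTypeR R} :=
  MeasurableFun.Pack (MeasurableFun.Class (isMeasurableFun.Build _ _ _ _ _ ms)).
apply/esym; apply: (lebesgue_measure_unique (mu := pushforward leb shift)) => //.
move=> _ [[a b] _ <-]; rewrite /pushforward/=.
transitivity (leb `](a - s), (b - s)]%classic).
  rewrite !lebesgue_measure_itv/= !lte_fin ltrD2r; case: ifP => // _.
  by rewrite -!EFinB opprB addrA subrK.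
congr (leb _); apply/seteqP; split => u /=; rewrite !in_itv/=.
  by rewrite ltrBlDl lerBrDl.
by rewrite ltrBlDl lerBrDl.
Qed.

Lemma lebesgue_integral_translation (s : R) (f : R -> \bar R) :
  measurable_fun setT f -> (forall x, 0 <= f x)%E ->
  (\int[leb]_u f (s + u)%R = \int[leb]_u f u)%E.
Proof.
move=> mf f0.
have ms : @measurable_fun _ _ (measurableTypeR R) (measurableTypeR R) setT
    (fun u : R => s + u) by exact: measurable_funD.
pose shift : {mfun measurableTypeR R >-> measurableTypeR R} :=
  MeasurableFun.Pack (MeasurableFun.Class (isMeasurableFun.Build _ _ _ _ _ ms)).
rewrite -[LHS]/(\int[leb]_(u in shift @^-1` setT) (f \o shift) u)%E.
rewrite -(ge0_integral_pushforward ms)//.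
by apply: eq_measure_integral => A mA _; exact: lebesgue_translation.
Qed.

Variable g : R -> R.
Hypotheses (mg : measurable_fun setT g) (g01 : forall x, 0 <= g x <= 1).

(** For negative [t] the interval is empty and the value is 0, so the primitive is nondecreasing and
    1-Lipschitz on the whole line. *)
Definition primitive (t : R) : R := \int[leb]_(u in `[0, t[) g u.

Let g_integrable (A : set R) : measurable A -> (leb A < +oo)%E ->
  leb.-integrable A (EFin \o g).
Proof.
move=> mA lA; apply: measurable_bounded_integrable => //.
  exact: measurable_funTS.
exists 1; split => // M M1 x _ /=; have /andP[g0 g1] := g01 x.
by rewrite ger0_norm// (le_trans g1)// ltW.
Qed.

Let leb_co (s t : R) : s <= t -> leb `[s, t[%classic = (t - s)%:E.
Proof.
move=> st; rewrite lebesgue_measure_itv/= lte_fin; case: ltP => // ts.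
by have -> : s = t; [apply/eqP; rewrite eq_le st ts|rewrite subrr].
Qed.

Lemma primitive_diff s t : 0 <= s -> s <= t ->
  primitive t - primitive s = \int[leb]_(u in `[s, t[) g u.
Proof.
move=> s0 st; apply/eqP; rewrite subr_eq; apply/eqP; rewrite /primitive.
have -> : `[0, t[%classic = `[s, t[%classic `|` `[0, s[%classic.
  apply/seteqP; split => u /=; rewrite !in_itv/=.
    by move=> /andP[u0 ut]; case: (leP s u) => su; [left|right]; rewrite ?u0 ?ut.
  by move=> [/andP[su ut]|/andP[u0 us]]; rewrite ?(le_trans s0 su) ?ut// u0 (lt_le_trans us).
rewrite Rintegral_setU//.
- apply: g_integrable; first exact: measurableU.
  rewrite (le_lt_trans (measureU2 _ _ _))//= !leb_co// -EFinD ltry//.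
- apply/disj_set2P; apply/seteqP; split => u //= -[]; rewrite !in_itv/=.
  by move=> /andP[su _] /andP[_]; rewrite ltNge su.
Qed.

Lemma primitive_incr s t : 0 <= s -> s <= t ->
  0 <= primitive t - primitive s <= t - s.
Proof.
move=> s0 st; rewrite primitive_diff//.
have fst : (leb `[s, t[%classic < +oo)%E by rewrite leb_co// ltry.
apply/andP; split.
  by apply: Rintegral_ge0 => u _; have /andP[] := g01 u.
rewrite (_ : t - s = \int[leb]_(u in `[s, t[) 1); last first.
  by rewrite Rintegral_cst//= leb_co//= mul1r.
apply: le_Rintegral => //; first exact: g_integrable.
- apply/integrableP; split; first exact: measurable_cst.
  under eq_integral do rewrite /= normr1.
  by rewrite integral_cst//= mul1e.
- by move=> u _; have /andP[] := g01 u.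
Qed.

Lemma primitive_le0 t : t <= 0 -> primitive t = 0.
Proof.
by move=> t0; rewrite /primitive set_itv_ge ?Rintegral_set0// bnd_simp -leNgt.
Qed.

Lemma primitive_lip s t : s <= t -> 0 <= primitive t - primitive s <= t - s.
Proof.
move=> st; have [s0|s0] := leP 0 s; first exact: primitive_incr.
have [t0|t0] := leP t 0; first by rewrite !primitive_le0 ?(ltW s0)// subrr lexx subr_ge0.
have := primitive_incr (lexx 0) (ltW t0); rewrite !(primitive_le0 (ltW s0)) (primitive_le0 (lexx 0)).
by move=> /andP[-> /le_trans]; apply; rewrite lerD2l lerN2 ltW.
Qed.

Lemma primitive_norm s t : `|primitive t - primitive s| <= `|t - s|.
Proof.
have [st|ts] := leP s t.
  have /andP[p0 p1] := primitive_lip st.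
  by rewrite (ger0_norm p0) ger0_norm ?subr_ge0.
have /andP[p0 p1] := primitive_lip (ltW ts).
by rewrite distrC (distrC t) (ger0_norm p0) ger0_norm ?subr_ge0// ltW.
Qed.

Lemma measurable_primitive : measurable_fun setT primitive.
Proof.
apply: nondecreasing_measurable => // s t st.
by have /andP[] := primitive_lip st; rewrite subr_ge0.
Qed.

Lemma primitive_shift s t : 0 <= s -> 0 <= t ->
  (\int[leb]_(u in `[0%R, t[) (g (s + u))%:E = (primitive (s + t) - primitive s)%:E)%E.
Proof.
move=> s0 t0; rewrite primitive_diff ?lerDl// fineK; last first.
  apply: integrable_fin_num => //; apply: g_integrable => //.
  by rewrite leb_co ?lerDl// ltry.
rewrite [LHS]integral_mkcond [RHS]integral_mkcond.
rewrite -[RHS](lebesgue_integral_translation s).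
- apply: eq_integral => u _; rewrite !patchE !mem_setE !in_itv/=.
  by rewrite lerDl ltrD2l.
- apply/(measurable_restrictT _ _).1 => //; exact/measurable_funTS/measurable_EFinP.
- move=> u; rewrite patchE; case: ifP => // _.
  by rewrite lee_fin; have /andP[] := g01 u.
Qed.

End primitive.

Section renewal_compensator.
Context d (Omega : measurableType d) (R : realType) (P : probability Omega R).
Local Notation E := (Rintegral P setT).
Local Notation leb := (@lebesgue_measure R).
Variables (T : nat -> {RV P >-> R}) (xi : R).
Hypothesis xi0 : 0 < xi.
Hypothesis law_T : forall j B, measurable B ->
  distribution P (T j) B = exponential_prob xi B.
Hypothesis indep_T : mutually_independent P T.

Local Notation S := (sampling_time T).

Lemma sampling_timeS i w : S i.+1 w = S i w + T i w.
Proof. by rewrite /sampling_time big_ord_recr. Qed.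

Lemma sampling_time_ge0 : {ae P, forall w i, 0 <= S i w}.
Proof.
have : {ae P, forall w j, 0 <= T j w}.
  by apply: ae_foralln => j; exact: exponential_ge0 (law_T j).
by apply: filterS => w T0 i; exact: sumr_ge0.
Qed.

Let mT j : measurable_fun setT (T j). Proof. exact: measurable_funP. Qed.

Let adapted_S i : adapted T [set k | (k < i)%N] (S i).
Proof.
elim: i => [|i IH].
  rewrite (_ : S 0 = fun=> 0); first exact: measurable_cst.
  by apply/funext => w; rewrite /sampling_time big_ord0.
rewrite (_ : S i.+1 = fun w => S i w + T i w); last first.
  by apply/funext => w; rewrite sampling_timeS.
apply: measurable_funD; last by apply: adapted_process => /=.
by apply: adapted_sub IH => k /= /ltnW.
Qed.

Lemma measurable_sampling_time i : measurable_fun setT (S i).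
Proof. exact (adapted_measurable mT (@adapted_S i)). Qed.

Variable g : R -> R.
Hypotheses (mg : measurable_fun setT g) (g01 : forall x, 0 <= g x <= 1).
Local Notation G := (primitive g).

Let mG : measurable_fun setT G. Proof. exact: measurable_primitive. Qed.

(** At [s = S i] and [t = T i] this is the step of the compensated sum of the [g (S i)]. Its mean
    over the exponential [t] vanishes by [exponential_compensator], so these steps are martingale
    differences. *)
Let D (s t : R) := g (s + t) - xi * (G (s + t) - G s).

Let D_bound s t : `|D s t| <= 1 + xi * `|t|.
Proof.
have /andP[g0 g1] := g01 (s + t).
rewrite (le_trans (ler_normB _ _))//; apply: lerD; first by rewrite ger0_norm.
rewrite normrM gtr0_norm//; apply: ler_wpM2l; first exact: ltW.
by rewrite (le_trans (primitive_norm mg g01 _ _))// addrAC subrr add0r.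
Qed.

Let mD d' (U : measurableType d') (f h : U -> R) : measurable_fun setT f ->
  measurable_fun setT h -> measurable_fun setT (fun u => D (f u) (h u)).
Proof.
move=> mf mh; have mfh := measurable_funD mf mh.
apply: measurable_funB; first exact: measurableT_comp.
apply: measurable_funM => //; apply: measurable_funB; exact: measurableT_comp.
Qed.

Let bound_square j : intg P (fun w => (1 + xi * `|T j w|) ^+ 2).
Proof.
have I2 := exponential_square_integrable xi0 (@law_T j).
have := intgD (intg_cst P 2) (intgZ (2 * xi ^+ 2) I2).
apply: intg_le => [|w].
  apply: measurable_funX; apply: measurable_funD => //.
  by apply: measurable_funM => //; exact: measurableT_comp.
rewrite ger0_norm ?sqr_ge0//.
rewrite -[T j w ^+ 2]real_normK ?num_real//.
by have := sqr_ge0 (1 - xi * `|T j w|); rewrite !expr2; nra.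
Qed.

Let bound_integrable j : intg P (fun w => 1 + xi * `|T j w|).
Proof.
apply: intg_le (bound_square j) => [|w].
  apply: measurable_funD => //.
  by apply: measurable_funM => //; exact: measurableT_comp.
have h : 1 <= 1 + xi * `|T j w| by rewrite lerDl mulr_ge0// ltW.
by rewrite ger0_norm ?(le_trans _ h)// expr2 ler_peMl// (le_trans _ h).
Qed.

Let D_integrable j s : intg P (fun w => D s (T j w)).
Proof. by apply: intg_le (bound_integrable j) => //; exact: mD. Qed.

Let D_centered j s : 0 <= s -> E (fun w => D s (T j w)) = 0.
Proof.
move=> s0.
have mgs : measurable_fun setT (fun u => g (s + u)).
  by apply: measurableT_comp => //; exact: measurable_funD.
have gs0 u : 0 <= g (s + u) by have /andP[] := g01 (s + u).
have msT : measurable_fun setT (fun w => s + T j w) by exact: measurable_funD.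
have mGT : measurable_fun setT (fun w => G (s + T j w) - G s).
  by apply: measurable_funB => //; exact: measurableT_comp.
have IG : intg P (fun w => G (s + T j w) - G s).
  apply: intg_le (intgZ xi^-1 (bound_integrable j)) => // w.
  rewrite (le_trans (primitive_norm mg g01 _ _))// addrAC subrr add0r.
  rewrite mulrDr mulr1 mulrA mulVf ?gt_eqF// mul1r lerDr invr_ge0 ltW//.
have Ig : intg P (fun w => g (s + T j w)).
  apply: (@intg_bounded _ _ _ _ _ 1) => [|w]; first exact: measurableT_comp.
  by have /andP[? ?] := g01 (s + T j w); rewrite ger0_norm.
rewrite E_B//; last exact: (intgZ xi IG).
rewrite E_Z//; apply/eqP; rewrite subr_eq0; apply/eqP.
apply: EFin_inj; rewrite EFinM -!E_EFin//.
have [mI ->] := exponential_compensator xi0 (@law_T j) mgs gs0; congr *%E.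
apply: ae_eq_integral => //; first exact/measurable_EFinP.
apply: filterS (exponential_ge0 (@law_T j)) => w Tw _.
by rewrite primitive_shift.
Qed.

Let delta i w := D (S i w) (T i w).

Let mdelta i : measurable_fun setT (delta i).
Proof. by apply: mD => //; exact: measurable_sampling_time. Qed.

Let delta_square_le i w : delta i w ^+ 2 <= (1 + xi * `|T i w|) ^+ 2.
Proof.
by rewrite -real_normK ?num_real// ler_pXn2r ?nnegrE// (le_trans _ (D_bound (S i w) _)).
Qed.

Let delta_square i : intg P (fun w => delta i w ^+ 2).
Proof.
apply: intg_le (bound_square i) => [|w]; first exact: measurable_funX.
by rewrite ger0_norm ?sqr_ge0.
Qed.

Let delta_orthogonal i j : (i + 1 <= j)%N ->
  E (fun w => delta i w * delta j w) = 0.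
Proof.
rewrite addn1 => ij.
pose X w := (delta i w, S j w).
(* [D_centered] asks for a nonnegative starting time, which [S j] is only almost surely. The
   indicator factor makes the inner expectation vanish at every [w]. *)
pose h (z : (R * R) * R) := z.1.1 * (D z.1.2 z.2 * (0 <= z.1.2)%R%:R).
have mT1 : forall i, measurable_fun setT (T i) by exact: mT.
have aX : adapted T [set k | (k < j)%N] X.
  apply: measurable_fun_pair; last exact: adapted_S.
  apply: mD; last by apply: adapted_process.
  by apply: adapted_sub (@adapted_S i) => k /= /ltn_trans; exact.
have mX := adapted_measurable mT1 aX.
have XT : independent_maps P X (T j).
  apply: (adapted_independent mT1 indep_T _ aX (adapted_process (D := [set j]) _)) => //.
  by apply/seteqP; split => k // -[/= + kj]; rewrite kj ltnn.
have mz : measurable_fun setT (fun z : (R * R) * R => z.1.2).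
  exact: measurableT_comp.
have mh : measurable_fun setT h.
  apply: measurable_funM; first exact: measurableT_comp.
  apply: measurable_funM; first exact: mD.
  rewrite (_ : (fun z => _) = (fun z : (R * R) * R => if 0 <= z.1.2 then 1 else 0)).
    by apply: measurable_fun_ifT => //; exact: measurable_fun_ler.
  by apply/funext => z; case: ifP.
have hX w : `|h (X w, T j w)| <= delta i w ^+ 2 + (1 + xi * `|T j w|) ^+ 2.
  rewrite /h/= !normrM -[delta i w ^+ 2]real_normK ?num_real//.
  have b1 : `|(0 <= S j w)%R%:R : R| <= 1 by case: (0 <= S j w); rewrite ?normr1 ?normr0.
  have := D_bound (S j w) (T j w); move: b1.
  move: (normr_ge0 ((0 <= S j w)%R%:R : R)) (normr_ge0 (delta i w)).
  move: (normr_ge0 (D (S j w) (T j w))).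
  move: `|D _ _| `|delta _ _| `|_%:R| (1 + _) => y x b B x0 b0 y0 b1 xB.
  rewrite mulrA; have xb : x * b <= B by apply: le_trans xB; exact: ler_piMr.
  by rewrite -mulrA; have := sqr_ge0 (y - B); rewrite !expr2; nra.
have inner_intg w : intg P (fun w2 => D (S j w) (T j w2) * (0 <= S j w)%R%:R).
  by under eq_fun do rewrite mulrC; exact: (intgZ _ (D_integrable j (S j w))).
have Ih : intg P (fun w => h (X w, T j w)).
  apply: intg_le (hX) _; last exact: intgD.
  exact: measurableT_comp mh (measurable_fun_pair mX (mT j)).
transitivity (E (fun w => h (X w, T j w))).
  apply: E_ae.
  - exact: measurable_funM.
  - exact: intg_measurable Ih.
  - by apply: filterS sampling_time_ge0 => w S0; rewrite /h/= S0 mulr1.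
rewrite (independent_fubini mX (mT j) XT mh Ih).
- rewrite -[RHS](E_cst P 0); apply: eq_Rintegral => w _; rewrite /h/=.
  rewrite (E_Z _ (inner_intg w)).
  under eq_Rintegral do rewrite mulrC.
  rewrite (E_Z _ (D_integrable j (S j w))).
  by have [S0|S0] := boolP (0 <= S j w); rewrite ?mul0r ?mulr0// D_centered// !mulr0.
- by move=> w; rewrite /h/=; exact: (intgZ _ (inner_intg w)).
Qed.

(** The steps [delta] are orthogonal and square integrable but unbounded, since [T i] is, so the
    gaps between squares cannot be filled at this stage; that happens in [renewal_cesaro], for
    bounded summands. *)
Lemma renewal_compensation : {ae P, forall w,
  (n.+1 ^ 2)%:R^-1 * (\sum_(i < n.+1 ^ 2) g (S i.+1 w) - xi * G (S (n.+1 ^ 2)%N w))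
    @[n --> \oo] --> 0}.
Proof.
pose K := E (fun w => (1 + xi * `|T 0%N w|) ^+ 2).
have EK i : E (fun w => delta i w ^+ 2) <= K.
  rewrite (le_trans (E_le (delta_square i) (bound_square i) (delta_square_le i)))//.
  rewrite le_eqVlt; apply/orP; left; apply/eqP/EFin_inj; rewrite /K -!E_EFin//.
  have mb : measurable_fun setT (fun x : R => (1 + xi * `|x|) ^+ 2).
    apply: measurable_funX; apply: measurable_funD => //.
    by apply: measurable_funM => //; exact: measurable_normr.
  have b0 (x : R) : 0 <= (1 + xi * `|x|) ^+ 2 by exact: sqr_ge0.
  by rewrite !(exponential_expectation xi0 (@law_T _) mb b0).
apply: filterS (weak_orthogonal_slln_squares mdelta delta_square EK delta_orthogonal) => w.
apply: cvg_trans; apply: near_eq_cvg; apply: nearW => n; congr (_ * _).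
have sumE N : \sum_(i < N) delta i w = \sum_(i < N) g (S i.+1 w) - xi * G (S N w).
  elim: N => [|N IH].
    by rewrite !big_ord0 /sampling_time big_ord0 primitive_le0// mulr0 subrr.
  rewrite !big_ord_recr/= IH /delta /D -sampling_timeS; ring.
by rewrite sumE.
Qed.

End renewal_compensator.

(** * Rounding cells *)

Section cells.
Context (R : realType).
Variable Delta : R.
Hypothesis Delta0 : 0 < Delta.

(** The absolute value produces a natural index; at nonnegative times, which sampling times almost
    surely are, it changes nothing ([cellE]). *)
Definition cell (u : R) : nat := `|round_nearest (u / Delta)|%N.

Lemma round_nearest_ge0 (x : R) : 0 <= x -> 0 <= round_nearest x.
Proof. by move=> x0; rewrite /round_nearest floor_ge_int_tmp addr_ge0// invr_ge0. Qed.

Lemma cellE u : 0 <= u -> Delta * (round_nearest (u / Delta))%:~R = Delta * (cell u)%:R :> R.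
Proof.
move=> u0; rewrite /cell; congr (_ * _).
have : 0 <= round_nearest (u / Delta) by rewrite round_nearest_ge0// divr_ge0// ltW.
by case: (round_nearest _).
Qed.

Lemma cell_eq (k : nat) u : 0 <= u ->
  k%:R * Delta - Delta / 2 <= u < k%:R * Delta + Delta / 2 -> cell u = k.
Proof.
move=> u0 /andP[ku uk]; rewrite /cell /round_nearest.
rewrite (_ : Num.floor _ = k%:Z) ?absz_nat//.
apply: floor_def; rewrite intrD -!pmulrn.
have -> : (k%:R : R) = k%:R * Delta / Delta by rewrite mulfK// gt_eqF.
rewrite -lerBlDr -ltrBrDr ler_pdivlMr// ltr_pdivrMr//.
rewrite !mulrDl !mulNr !mulfK ?gt_eqF// mul1r.
by apply/andP; split; lra.
Qed.

Lemma measurable_cell : measurable_fun setT cell.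
Proof.
have mf : measurable_fun setT (fun u : R => (round_nearest (u / Delta))%:~R : R).
  apply: nondecreasing_measurable => // u v uv.
  rewrite ler_int /round_nearest; apply: le_floor.
  by rewrite lerD2r ler_pM2r ?invr_gt0.
move=> _ B _; rewrite setTI.
have -> : cell @^-1` B = \bigcup_(k in B)
    ((fun u : R => (round_nearest (u / Delta))%:~R : R) @^-1` [set k%:R; - k%:R]).
  apply/seteqP; split => u /=.
    move=> Bu; exists (cell u) => //=; rewrite /cell.
    by case: (round_nearest _) => n /=; [left|right]; rewrite ?NegzE ?mulrNz.
  move=> [k Bk /=]; rewrite /cell => -[/eqP|/eqP].
    by rewrite -[k%:R]/(k%:Z%:~R) eqr_int => /eqP ->.
  by rewrite -[k%:R]/(k%:Z%:~R) -mulrNz eqr_int => /eqP ->; rewrite abszN.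
apply: bigcup_measurable => k _; rewrite -[X in measurable X]setTI.
by apply: mf => //; exact: measurableU.
Qed.

Variable G : nat -> R.
Hypothesis G01 : forall k, 0 <= G k <= 1.
Let g u := G (cell u).

Lemma measurable_step : measurable_fun setT g.
Proof. exact: measurableT_comp measurable_cell. Qed.

Let g01 u : 0 <= g u <= 1. Proof. exact: G01. Qed.

Let primitive_step k t : 0 <= t -> k%:R * Delta - Delta / 2 <= t <= k%:R * Delta + Delta / 2 ->
  primitive g (k%:R * Delta + Delta / 2) - primitive g t =
  G k * (k%:R * Delta + Delta / 2 - t).
Proof.
move=> t0 /andP[kt tk]; rewrite primitive_diff//; last exact: measurable_step.
rewrite (eq_Rintegral _ (g := fun=> G k)); last first.
  move=> u; rewrite inE/= in_itv/= => /andP[tu uk]; rewrite /g (@cell_eq k)//.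
    exact: le_trans tu.
  by rewrite (le_trans kt)//.
rewrite Rintegral_cst//= lebesgue_measure_itv/= lte_fin; case: ltP => //= kt'.
have /eqP <- : t == k%:R * Delta + Delta / 2 by rewrite eq_le kt' tk.
by rewrite subrr.
Qed.

(** The difference is exactly [- G 0 * Delta / 2]: only the right half of the cell around 0 is
    covered by nonnegative times. *)
Let primitive_bound k : `|primitive g (k%:R * Delta + Delta / 2) -
  Delta * \sum_(j < k.+1) G j| <= Delta / 2.
Proof.
elim: k => [|k IH].
  have := @primitive_step 0%N 0 (lexx _); rewrite mul0r add0r (primitive_le0 _ (lexx 0)) !subr0.
  move=> ->; last by have D0 := Delta0; apply/andP; split; lra.
  rewrite !add0r.
  rewrite big_ord1 (_ : _ - _ = - (G 0%N * (Delta / 2))); last by field.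
  rewrite normrN normrM ger0_norm; last by have /andP[] := G01 0.
  have D20 : 0 <= Delta / 2 by rewrite divr_ge0// ltW.
  by rewrite (ger0_norm D20); apply: ler_piMl => //; have /andP[] := G01 0.
have := @primitive_step k.+1 (k%:R * Delta + Delta / 2) _ _.
have e : (k.+1%:R : R) = k%:R + 1 by rewrite natr1.
rewrite e => h; rewrite big_ord_recr/=.
rewrite -[primitive _ ((k%:R + 1) * _ + _)](subrK (primitive g (k%:R * Delta + Delta / 2))).
rewrite h; last 2 first.
- by rewrite addr_ge0 ?mulr_ge0 ?divr_ge0// ltW.
- by have D0 := Delta0; apply/andP; split; lra.
rewrite (_ : _ + _ - _ = primitive g (k%:R * Delta + Delta / 2) -
  Delta * \sum_(j < k.+1) G j)//; ring.
Qed.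

(** Three errors, each at most [Delta]: the half cell at 0, the distance from [t] to the right end
    of cell [k], and the one cell that the truncated sum leaves out. *)
Lemma primitive_cells t : 0 <= t -> `|primitive g t -
  Delta * \sum_(j < Num.truncn (t / Delta)) G j| <= 3 * Delta.
Proof.
move=> t0; set k := Num.truncn _.
have tD0 : 0 <= t / Delta by rewrite divr_ge0// ltW.
have /andP[kt tk] := truncn_itv tD0; rewrite -/k in kt tk.
rewrite ler_pdivlMr// in kt; rewrite ltr_pdivrMr// -natr1 in tk.
have tb : `|t - (k%:R * Delta + Delta / 2)| <= Delta.
  by have D0 := Delta0; rewrite ler_norml; apply/andP; split; lra.
have := le_trans (primitive_norm measurable_step g01 (k%:R * Delta + Delta / 2) t) tb.
have := primitive_bound k; rewrite big_ord_recr/= mulrDr.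
have /andP[G0 G1] := G01 k.
have DG0 : 0 <= Delta * G k by rewrite mulr_ge0// ltW.
have DG1 : Delta * G k <= Delta by apply: ler_piMr => //; exact: ltW.
rewrite !ler_norml => /andP[a1 a2] /andP[b1 b2].
by have D0 := Delta0; apply/andP; split; lra.
Qed.

End cells.

Section renewal_cesaro.
Context d (Omega : measurableType d) (R : realType) (P : probability Omega R).
Variables (T : nat -> {RV P >-> R}) (xi : R).
Hypothesis xi0 : 0 < xi.
Hypothesis law_T : forall j B, measurable B ->
  distribution P (T j) B = exponential_prob xi B.
Hypothesis indep_T : mutually_independent P T.
Local Notation S := (sampling_time T).

Lemma cvg_inv_square : ((n.+1 ^ 2)%:R^-1 : R) @[n --> \oo] --> 0.
Proof.
apply: (@squeeze_cvgr _ _ _ _ (fun=> 0) (fun n => n.+1%:R^-1)).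
- apply: nearW => n; rewrite invr_ge0 ler0n/= lef_pV2 ?posrE ?ltr0n ?expn_gt0//.
  by rewrite ler_nat expnS expn1 leq_pmulr.
- exact: cvg_cst.
- exact: cvg_harmonic.
Qed.

Variables (Delta a : R) (G : nat -> R).
Hypothesis Delta0 : 0 < Delta.
Hypothesis G01 : forall k, 0 <= G k <= 1.
Hypothesis G_cesaro : n%:R^-1 * (\sum_(k < n) G k) @[n --> \oo] --> a.

(* [s] stands for the sampling times along the squares. *)
Let cesaro_primitive (s : nat -> R) : (forall n, 0 <= s n) ->
  (n.+1 ^ 2)%:R^-1 * s n @[n --> \oo] --> xi^-1 ->
  (n.+1 ^ 2)%:R^-1 * (xi * primitive (fun u => G (cell Delta u)) (s n))
    @[n --> \oo] --> a.
Proof.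
move=> s0 cs.
pose K n := Num.truncn (s n / Delta).
pose N n : R := (n.+1 ^ 2)%:R.
have N0 n : 0 < N n by rewrite ltr0n expn_gt0.
have Ks n : s n - Delta <= Delta * (K n)%:R <= s n.
  have sD0 : 0 <= s n / Delta by rewrite divr_ge0// ltW.
  have /andP[] := truncn_itv sD0; rewrite -/(K n) ler_pdivlMr// ltr_pdivrMr// -natr1.
  by move=> h1 h2; apply/andP; split; lra.
have cN c : (N n)^-1 * c @[n --> \oo] --> 0.
  by rewrite -(mul0r c); apply: cvgMl; exact: cvg_inv_square.
have cK : (N n)^-1 * (Delta * (K n)%:R) @[n --> \oo] --> xi^-1.
  apply: (@squeeze_cvgr _ _ _ _ (fun n => (N n)^-1 * s n - (N n)^-1 * Delta)
    (fun n => (N n)^-1 * s n)) => //.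
  - apply: nearW => n; have /andP[h1 h2] := Ks n.
    by rewrite -mulrBr !ler_pM2l ?invr_gt0// h1.
  - by rewrite -[X in _ --> X]subr0; exact: cvgB.
have Koo : K n @[n --> \oo] --> \oo.
  apply/cvgnyPge => A.
  have c0 : 0 < xi^-1 / 2 by rewrite divr_gt0// invr_gt0.
  have h1 : \forall n \near \oo, xi^-1 / 2 < (N n)^-1 * (Delta * (K n)%:R).
    by apply: (cvgr_gt _ cK); rewrite ltr_pdivrMr// ltr_pMr ?invr_gt0// ltr1n.
  have h2 : \forall n \near \oo, (N n)^-1 * (Delta * A%:R) < xi^-1 / 2.
    exact: (cvgr_lt _ (cN _)).
  near=> n; rewrite -(ler_nat R) -(ler_pM2l Delta0) -(ler_pM2l (x := (N n)^-1)) ?invr_gt0//.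
  by apply/ltW; apply: lt_trans (near h1 n _); [exact: (near h2 n _)|].
have avg : (K n)%:R^-1 * (\sum_(k < K n) G k) @[n --> \oo] --> a.
  exact: (cvg_comp _ _ Koo G_cesaro).
(* This is [xi], times [Delta * K / N], which tends to [xi^-1], times the average of [G] over the
   first [K] cells. *)
have main : (N n)^-1 * (xi * (Delta * \sum_(k < K n) G k)) @[n --> \oo] --> a.
  have : xi * ((N n)^-1 * (Delta * (K n)%:R)) * ((K n)%:R^-1 * (\sum_(k < K n) G k))
      @[n --> \oo] --> xi * xi^-1 * a.
    by apply: cvgM => //; apply: cvgMr.
  rewrite divff ?gt_eqF// mul1r; apply: cvg_trans; apply: near_eq_cvg.
  near=> n.
  have K0 : (0 < K n)%N by near: n; move/cvgnyPgt : Koo; exact.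
  field; rewrite !gt_eqF// ltr0n//.
apply/cvgrPdist_le => e e0.
have e20 : 0 < e / 2 by rewrite divr_gt0.
have h1 := (cvgrPdist_le _ _).1 main _ e20.
have h2 := cvgr_lt _ (cN (xi * (3 * Delta))) _ e20.
near=> n.
have m1 : `|a - (N n)^-1 * (xi * (Delta * \sum_(k < K n) G k))| <= e / 2.
  by near: n; exact: h1.
have m2 : (N n)^-1 * (xi * (3 * Delta)) < e / 2.
  by near: n; exact: h2.
have := primitive_cells Delta0 G01 (s0 n); rewrite -/(K n) => m3.
rewrite -(subrK ((N n)^-1 * (xi * (Delta * \sum_(k < K n) G k))) a) -addrA.
rewrite (le_trans (ler_normD _ _))// (splitr e) lerD// -!mulrBr.
rewrite 2!normrM gtr0_norm ?invr_gt0// (gtr0_norm xi0) distrC.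
by rewrite (le_trans _ (ltW m2))// !ler_pM2l ?invr_gt0.
Unshelve. all: by end_near. Qed.

Lemma renewal_cesaro : {ae P, forall w,
  n%:R^-1 * (\sum_(i < n) G (cell Delta (S i.+1 w))) @[n --> \oo] --> a}.
Proof.
pose g u := G (cell Delta u).
have mg : measurable_fun setT g := measurable_step Delta0 G.
have g01 u : 0 <= g u <= 1 by exact: G01.
have one01 (u : R) : 0 <= (fun=> 1 : R) u <= 1 by rewrite ler01 lexx.
have h1 := renewal_compensation xi0 law_T indep_T mg g01.
(* Compensating the constant 1 gives the law of large numbers [S N / N --> xi^-1] along the
   squares. *)
have h2 := renewal_compensation xi0 law_T indep_T (measurable_cst _) one01.
have prim1 t : 0 <= t -> primitive (fun=> 1) t = t :> R.
  rewrite le_eqVlt => /predU1P[<-|t0]; first by rewrite primitive_le0.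
  rewrite /primitive Rintegral_cst//= lebesgue_measure_itv/= lte_fin t0/=.
  by rewrite oppr0 addr0 mul1r.
apply: filterS3 h1 h2 (sampling_time_ge0 law_T) => w w1 w2 S0.
pose N n : R := (n.+1 ^ 2)%:R.
have N0 n : 0 < N n by rewrite ltr0n expn_gt0.
have sN : (N n)^-1 * S (n.+1 ^ 2)%N w @[n --> \oo] --> xi^-1.
  have : xi^-1 - xi^-1 * ((N n)^-1 * (\sum_(i < n.+1 ^ 2) 1 -
      xi * primitive (fun=> 1) (S (n.+1 ^ 2)%N w))) @[n --> \oo] --> xi^-1 - xi^-1 * 0.
    by apply: cvgB; [exact: cvg_cst|exact: cvgMr].
  rewrite mulr0 subr0; apply: cvg_trans; apply: near_eq_cvg; apply: nearW => n /=.
  rewrite prim1// sumr_const card_ord -/(N n).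
  by field; rewrite !gt_eqF.
have c1 := cesaro_primitive (fun n => S0 _) sN.
have : n%:R^-1 * (\sum_(i < n) g (S i.+1 w) - n%:R * a) @[n --> \oo] --> 0.
  apply: (@cvg_along_squares _ (fun n => \sum_(i < n) g (S i.+1 w) - n%:R * a) (1 + `|a|)).
    move=> n; rewrite big_ord_recr/= -natr1.
    rewrite (_ : _ - _ - _ = g (S n.+1 w) - a); last by ring.
    rewrite (le_trans (ler_normB _ _))// lerD2r.
    by have /andP[? ?] := g01 (S n.+1 w); rewrite ger0_norm.
  have : (N n)^-1 * (\sum_(i < n.+1 ^ 2) g (S i.+1 w) - xi * primitive g (S (n.+1 ^ 2)%N w)) +
      (N n)^-1 * (xi * primitive g (S (n.+1 ^ 2)%N w)) - a @[n --> \oo] --> 0 + a - a.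
    by apply: cvgB; [exact: cvgD|exact: cvg_cst].
  rewrite add0r subrr; apply: cvg_trans; apply: near_eq_cvg; apply: nearW => n /=.
  rewrite -/(N n).
  by rewrite /g; field; rewrite gt_eqF.
move=> h0.
have : n%:R^-1 * (\sum_(i < n) g (S i.+1 w) - n%:R * a) + a @[n --> \oo] --> 0 + a.
  by apply: cvgD => //; exact: cvg_cst.
rewrite add0r; apply: cvg_trans.
apply: near_eq_cvg; near=> n; rewrite /= mulrBr mulKf ?subrK//.
by rewrite gt_eqF// ltr0n; near: n; exact: nbhs_infty_gt.
Unshelve. all: by end_near. Qed.

End renewal_cesaro.

Section sampling_at_renewals.
Context d (Omega : measurableType d) (R : realType) (P : probability Omega R).

Lemma measurable_cvg_set d' (U : measurableType d') (u : nat -> U -> R) (a : R) :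
  (forall n, measurable_fun setT (u n)) ->
  measurable [set z | u n z @[n --> \oo] --> a].
Proof.
move=> mu.
have -> : [set z | u n z @[n --> \oo] --> a] = \bigcap_p \bigcup_m \bigcap_(n in [set n | (m <= n)%N])
    [set z | `|a - u n z| <= p.+1%:R^-1].
  apply/seteqP; split => z /=.
    move=> /cvgrPdist_le uz p _.
    have [m _ um] := uz p.+1%:R^-1 ltac:(by rewrite invr_gt0).
    by exists m => // n /= mn; exact: um.
  move=> h; apply/cvgrPdist_le => e e0.
  have [p ep] := ltr_add_invr (y := 0) (x := e) e0.
  have [m _ um] := h p I; exists m => // n /= mn.
  by apply: le_trans (um n mn) _; rewrite add0r in ep; exact: ltW.
apply: bigcap_measurable => // p _; apply: bigcup_measurable => m _.
apply: bigcap_measurable => [|n _]; first by exists m => /=.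
rewrite -[X in measurable X]setTI; apply: measurable_fun_ler => //.
by apply: measurableT_comp => //; exact: measurable_funB.
Qed.

Variables (T : nat -> {RV P >-> R}) (V : R -> {RV P >-> R}) (xi Delta a : R).
Hypotheses (xi0 : 0 < xi) (Delta0 : 0 < Delta).
Hypothesis sampling : poisson_sampling xi V T.
Variable f : R -> R.
Hypotheses (mf : measurable_fun setT f) (f01 : forall x, 0 <= f x <= 1).

Lemma sampled_cesaro :
  {ae P, forall w, n%:R^-1 * (\sum_(k < n) f (V (Delta * k%:R) w)) @[n --> \oo] --> a} ->
  {ae P, forall w, n%:R^-1 *
    (\sum_(i < n) f (sampled_workload V Delta T i.+1 w)) @[n --> \oo] --> a}.
Proof.
have [law_T indep_T TV] := sampling.
move=> fV.
have mT j : measurable_fun setT (T j) by exact: measurable_funP.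
have mV t : measurable_fun setT (V t) by exact: measurable_funP.
(* [Omega] is taken twice, with the sigma-algebra of the sampling times and with that of the
   workload. Independence then says that the two identity maps are independent, and freezing a path
   is fixing one coordinate. *)
pose ST := g_sigma_algebraType (process_events T setT).
pose SV := g_sigma_algebraType (process_events V [set t : R | 0 <= t]).
pose X : Omega -> SV := id; pose Y : Omega -> ST := id.
have mX : measurable_fun setT X.
  by move=> _ B mB; rewrite setTI; exact: (g_sigma_measurable (process_events_measurable mV (D := _)) mB).
have mY : measurable_fun setT Y.
  by move=> _ B mB; rewrite setTI; exact: (g_sigma_measurable (process_events_measurable mT (D := _)) mB).
have XY : independent_maps P X Y.
  by move=> A B mA mB; rewrite setIC muleC; exact: TV.
pose u n (z : SV * ST) : R :=
  n%:R^-1 * (\sum_(i < n) f (V (Delta * (cell Delta (sampling_time T i.+1 z.2))%:R) z.1)).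
have aS i : measurable_fun setT (sampling_time T i : ST -> R).
  elim: i => [|i IH].
    rewrite (_ : sampling_time T 0 = fun=> 0); first exact: measurable_cst.
    by apply/funext => w; rewrite /sampling_time big_ord0.
  rewrite (_ : sampling_time T i.+1 = fun w => sampling_time T i w + T i w); last first.
    by apply/funext => w; rewrite sampling_timeS.
  by apply: measurable_funD => //; exact: adapted_process.
have aV k : measurable_fun setT (V (Delta * k%:R) : SV -> R).
  by apply: adapted_process => /=; rewrite mulr_ge0// ltW.
have mu n : measurable_fun setT (u n).
  apply: measurable_funM => //; apply: measurable_sum => i.
  have mc : measurable_fun setT (fun z : SV * ST => cell Delta (sampling_time T i.+1 z.2)).
    apply: measurableT_comp; first exact: measurable_cell.
    by apply: measurableT_comp.
  move=> _ B mB; rewrite setTI.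
  (* The workload is read at a random grid index; slicing by its value [k] reduces joint
     measurability to fixed times. *)
  rewrite (_ : _ @^-1` B = \bigcup_k
    (((fun z : SV * ST => cell Delta (sampling_time T i.+1 z.2)) @^-1` [set k]) `&`
     ((fun z : SV * ST => f (V (Delta * k%:R) z.1)) @^-1` B))); last first.
    apply/seteqP; split => z /=; first by move=> Bz; eexists.
    by move=> [k _ [/= -> ]].
  apply: bigcup_measurable => k _; apply: measurableI.
    by rewrite -[X in measurable X]setTI; exact: mc.
  rewrite -[X in measurable X]setTI; apply: measurableT_comp => //.
  by apply: measurableT_comp => //; exact: measurableT_comp.
have := independent_ae mX mY XY (measurable_cvg_set a mu).
have h1 : {ae P, forall w1, {ae P, forall w2, u n (X w1, Y w2) @[n --> \oo] --> a}}.
  apply: filterS fV => w1 fw1.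
  exact: (@renewal_cesaro _ _ _ _ T xi xi0 law_T indep_T Delta a
    (fun k => f (V (Delta * k%:R) w1)) Delta0 _ fw1).
move=> /(_ h1); apply: filterS2 (sampling_time_ge0 law_T) => w S0.
apply: cvg_trans; apply: near_eq_cvg; apply: nearW => n; congr (_ * _).
apply: eq_bigr => i _; rewrite /sampled_workload /grid_sampling_time.
by rewrite cellE.
Qed.

End sampling_at_renewals.

(** * The workload on a grid *)

Section lindley_recursion.
Context (W : Type) (R : realType) (J : R -> W -> R).
Implicit Types (h : R) (a n m : nat) (w : W).

Definition net (t : R) (w : W) : R := J t w - t.

Definition increment h (i : nat) (w : W) : R := J (i.+1%:R * h) w - J (i%:R * h) w.

(* [lindley h a n] is the workload at time [(a + n) h] of the queue that is
   empty at time [a h] and is observed on the grid [h * nat] only. *)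
Fixpoint lindley h a n (w : W) : R :=
  if n is n'.+1 then Num.max (lindley h a n' w + (increment h (a + n') w - h)) 0
  else 0.

Lemma lindley_ge0 h a n w : 0 <= lindley h a n w.
Proof. by case: n => //= n; rewrite le_max lexx orbT. Qed.

Lemma net_increment h i w :
  net (i.+1%:R * h) w - net (i%:R * h) w = increment h i w - h.
Proof. by rewrite /net /increment -natr1; ring. Qed.

(** Either the workload present at step [a + n] never runs out and the net input is simply added to
    it, or the queue has emptied since and agrees with the one restarted empty at [a + n]. *)
Lemma lindley_add h a n m w : lindley h a (n + m) w =
  Num.max (lindley h a n w +
    (net ((a + n + m)%:R * h) w - net ((a + n)%:R * h) w))
    (lindley h (a + n) m w).
Proof.
elim: m => [|m IH].
  by rewrite !addn0 subrr addr0 (max_idPl _)// lindley_ge0.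
rewrite [in LHS]addnS/= IH addnA addnS.
have := net_increment h (a + n + m) w.
set z := increment _ _ _ - _ => <-.
by rewrite addr_maxl maxA; congr (Num.max (Num.max _ _) _); ring.
Qed.

(** Halving the mesh inserts one more reflection at 0 into each step, which can only raise the
    workload. *)
Lemma lindley_refine h a n w :
  lindley h a n w <= lindley (h / 2) (2 * a) (2 * n) w.
Proof.
elim: n => [//|n IH]; rewrite mulnS/=.
set l := lindley (h / 2) _ _ w in IH *.
have -> : increment h (a + n) w - h =
    (increment (h / 2) (2 * a + 2 * n) w - h / 2) +
    (increment (h / 2) (2 * a + (2 * n).+1) w - h / 2).
  rewrite /increment addnS -!mulnDr.
  have e (i : nat) : ((2 * i)%:R : R) * (h / 2) = i%:R * h by rewrite natrM; field.
  have -> : (2 * (a + n)).+2 = (2 * (a + n).+1)%N by rewrite mulnS.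
  by rewrite !e; field.
rewrite ge_max le_max le_max lexx orbT andbT.
apply/orP; left; rewrite addrA lerD2r le_max lerD2r.
by rewrite IH.
Qed.

Lemma lindley_path_ge h n j w : (j <= n)%N ->
  net (n%:R * h) w - net (j%:R * h) w <= lindley h 0 n w.
Proof.
move=> jn; have := lindley_add h 0 j (n - j) w; rewrite add0n subnKC// => ->.
by rewrite le_max lerDr lindley_ge0.
Qed.

(** Discrete reflection formula: with [lindley_path_ge], the workload is the maximum of the net
    input since step [j]; the witness is the last step at which the queue is empty. *)
Lemma lindley_path_attained h n w : exists2 j, (j <= n)%N &
  lindley h 0 n w = net (n%:R * h) w - net (j%:R * h) w.
Proof.
elim: n => [|n [j jn IH]]; first by exists 0%N => //=; rewrite subrr.
rewrite /= IH add0n -net_increment.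
have [_|_] := leP; first by exists n.+1 => //; rewrite subrr.
by exists j; [exact: leqW|ring].
Qed.

Definition mesh (Delta : R) (q : nat) : R := Delta / 2 ^+ q.

Lemma mesh_grid Delta q k : ((k * 2 ^ q)%:R : R) * mesh Delta q = k%:R * Delta.
Proof.
rewrite /mesh natrM natrX -mulrA; congr (_ * _); rewrite mulrCA mulfV ?mulr1//.
Qed.

Lemma mesh_cvg0 Delta : mesh Delta q @[q --> \oo] --> 0.
Proof.
rewrite -(mulr0 Delta); apply: cvgMr.
have := @cvg_geometric R 1 (2^-1); rewrite /geometric/=.
rewrite ger0_norm ?invr_ge0// invf_lt1 ?ltr1n// => /(_ isT).
by under eq_fun do rewrite mul1r exprVn.
Qed.

Lemma meshS Delta q : mesh Delta q.+1 = mesh Delta q / 2.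
Proof. by rewrite /mesh exprS invfM mulrA mulrAC. Qed.

Definition window_grid Delta q k m w := lindley (mesh Delta q) (k * 2 ^ q) (m * 2 ^ q) w.

Lemma window_grid_nondecreasing Delta k m w :
  nondecreasing_seq (fun q => window_grid Delta q k m w).
Proof.
apply/nondecreasing_seqP => q; rewrite /window_grid meshS.
by rewrite (le_trans (lindley_refine _ _ _ _))// !expnS !(mulnCA 2%N).
Qed.

Lemma window_grid_ge0 Delta q k m w : 0 <= window_grid Delta q k m w.
Proof. exact: lindley_ge0. Qed.

Lemma window_grid_add Delta q k m n w : window_grid Delta q k (m + n) w =
  Num.max (window_grid Delta q k m w +
    (net ((k + m + n)%:R * Delta) w - net ((k + m)%:R * Delta) w))
    (window_grid Delta q (k + m) n w).
Proof. by rewrite /window_grid mulnDl lindley_add -!mulnDl !mesh_grid. Qed.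

(** Taking the supremum over meshes in the extended reals makes measurability in [w] immediate. On a
    regular path it is finite, being bounded by the input received, and is the increasing limit of
    the mesh workloads. *)
Definition window Delta k m w : R :=
  fine (ereal_sup (range (fun q => (window_grid Delta q k m w)%:E))).

Definition regular_path w := J 0 w = 0 /\
  forall s t : R, 0 <= s -> s <= t -> J s w <= J t w.

Section regular.
Variable w : W.
Hypothesis regw : regular_path w.

Lemma increment_ge0 h i : 0 <= h -> 0 <= increment h i w.
Proof.
by move=> h0; rewrite subr_ge0; apply regw.2; rewrite ?mulr_ge0// ler_wpM2r// ler_nat.
Qed.

Lemma lindley_le h a n : 0 <= h ->
  lindley h a n w <= J ((a + n)%:R * h) w - J (a%:R * h) w.
Proof.
move=> h0; elim: n => [|n IH]; first by rewrite addn0 subrr.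
rewrite /= ge_max; apply/andP; split.
  rewrite (le_trans (lerD IH (lexx _)))// /increment addnS.
  by have := h0; lra.
by rewrite subr_ge0; apply regw.2; rewrite ?mulr_ge0// ler_wpM2r// ler_nat leq_addr.
Qed.

Lemma cvg_window Delta k m : 0 <= Delta ->
  window_grid Delta q k m w @[q --> \oo] --> window Delta k m w.
Proof.
move=> D0.
have h0 q : 0 <= mesh Delta q by rewrite divr_ge0// exprn_ge0.
have ub q : window_grid Delta q k m w <= J ((k + m)%:R * Delta) w - J (k%:R * Delta) w.
  by rewrite (le_trans (lindley_le _ _ (h0 q)))// -mulnDl !mesh_grid.
apply: (fine_cvg (f := fun q => (window_grid Delta q k m w)%:E)).
rewrite fineK; first by apply: ereal_nondecreasing_cvgn => q r qr; rewrite lee_fin window_grid_nondecreasing.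
rewrite fin_numE; apply/andP; split.
  rewrite gt_eqF// (@lt_le_trans _ _ 0%E)//.
  apply: (@le_trans _ _ (window_grid Delta 0 k m w)%:E).
    by rewrite lee_fin window_grid_ge0.
  by apply: ereal_sup_ubound; exists 0%N.
rewrite lt_eqF// (@le_lt_trans _ _ (J ((k + m)%:R * Delta) w - J (k%:R * Delta) w)%:E) ?ltry//.
by apply: ge_ereal_sup => _ [q _ <-]; rewrite lee_fin.
Qed.

Lemma window_grid_le Delta q k m : 0 <= Delta ->
  window_grid Delta q k m w <= window Delta k m w.
Proof.
move=> D0; have cv := @cvg_window Delta k m D0.
rewrite -(cvg_lim _ cv)//; apply: nondecreasing_cvgn_le.
  exact: window_grid_nondecreasing.
by apply/cvg_ex; exists (window Delta k m w).
Qed.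

Lemma window_ge0 Delta k m : 0 <= Delta -> 0 <= window Delta k m w.
Proof. by move=> D0; rewrite (le_trans (window_grid_ge0 _ 0 _ _ _) (window_grid_le 0 _ _ D0)). Qed.

Lemma window_add Delta k m n : 0 <= Delta -> window Delta k (m + n) w =
  Num.max (window Delta k m w +
    (net ((k + m + n)%:R * Delta) w - net ((k + m)%:R * Delta) w))
    (window Delta (k + m) n w).
Proof.
move=> D0; rewrite -(cvg_lim _ (@cvg_window Delta k (m + n)%N D0))//.
apply: cvg_lim => //; under eq_fun do rewrite window_grid_add.
have h1 := @cvg_window Delta k m D0; have h2 := @cvg_window Delta (k + m) n D0.
set c := net _ w - net _ w.
have maxE x y : Num.max x y = (x + y + `|x - y|) / 2 :> R by rewrite maxr_absE.
under eq_fun do rewrite maxE; rewrite maxE.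
have h3 : window_grid Delta q k m w + c @[q --> \oo] --> window Delta k m w + c.
  by apply: cvgD => //; exact: cvg_cst.
apply: cvgMl; apply: cvgD; first exact: cvgD.
by apply: cvg_norm; exact: cvgB.
Qed.

Variable V : R -> W -> R.
Hypothesis V0 : 0 <= V 0 w.
Hypothesis workload_path : forall t : R, 0 <= t ->
  V t w = net t w + Num.max (V 0 w) (- inf [set net s w | s in `[0, t]]).

Let net_inf t : 0 <= t ->
  lbound [set net s w | s in `[0, t]] (- t) /\ [set net s w | s in `[0, t]] (net 0 w).
Proof.
move=> t0; split; last by exists 0 => //=; rewrite in_itv/= lexx.
move=> _ [s /= + <-]; rewrite in_itv/= => /andP[s0 st].
by rewrite /net; have := regw.2 0 s (lexx _) s0; rewrite regw.1; lra.
Qed.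

Lemma workload_ge0 t : 0 <= t -> 0 <= V t w.
Proof.
move=> t0; rewrite workload_path//; have [lb _] := net_inf t0.
have h : 0 <= net t w - inf [set net s w | s in `[0, t]].
  rewrite subr_ge0; apply: ge_inf; first by exists (- t).
  by exists t => //=; rewrite in_itv/= t0 lexx.
by apply: le_trans h _; rewrite lerD2l le_max lexx orbT.
Qed.

(** [J] is nondecreasing, so after a grid point the net input falls by at most [h] before the next
    one; its infimum over the interval is within [h] of its minimum over the grid. *)
Let grid_sandwich h n : 0 < h ->
  lindley h 0 n w <= net (n%:R * h) w - inf [set net s w | s in `[0, n%:R * h]]
    <= lindley h 0 n w + h.
Proof.
move=> h0; have t0 : 0 <= n%:R * h by rewrite mulr_ge0// ltW.
have [lb net0] := net_inf t0.
apply/andP; split.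
  have [j jn ->] := lindley_path_attained h n w.
  rewrite lerD2l lerN2; apply: ge_inf; first by exists (- (n%:R * h)).
  exists (j%:R * h) => //=; rewrite in_itv/= mulr_ge0 ?(ltW h0)//=.
  by rewrite ler_pM2r// ler_nat.
rewrite lerBlDr -lerBlDl; apply: lb_le_inf; first by exists (net 0 w).
move=> _ [s /= + <-]; rewrite in_itv/= => /andP[s0 st].
have sh0 : 0 <= s / h by rewrite divr_ge0// ltW.
have /andP[js sj] := truncn_itv sh0; set j := Num.truncn (s / h) in js sj.
rewrite ler_pdivlMr// in js; rewrite ltr_pdivrMr// -natr1 in sj.
have jn : (j <= n)%N.
  by rewrite -(ler_nat R) -(ler_pM2r h0) (le_trans js st).
have := lindley_path_ge h w jn.
have : J (j%:R * h) w <= J s w by apply regw.2 => //; rewrite mulr_ge0// ltW.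
rewrite /net; lra.
Qed.

Lemma workload_le_lindley h n : 0 < h ->
  V (n%:R * h) w <= Num.max (V 0 w + net (n%:R * h) w) (lindley h 0 n w + h).
Proof.
move=> h0; rewrite workload_path ?mulr_ge0 ?(ltW h0)// addr_maxr addrC.
rewrite ge_max !le_max lexx/=; apply/orP; right.
by have /andP[] := grid_sandwich n h0.
Qed.

Lemma workload_window Delta k : 0 < Delta ->
  V (k%:R * Delta) w = Num.max (V 0 w + net (k%:R * Delta) w) (window Delta 0 k w).
Proof.
move=> D0; have t0 : 0 <= k%:R * Delta by rewrite mulr_ge0// ltW.
rewrite workload_path// addr_maxr addrC; congr Num.max.
rewrite -(cvg_lim _ (@cvg_window Delta 0 k (ltW D0)))//; apply/esym/cvg_lim => //.
have h0 q : 0 < mesh Delta q by rewrite divr_gt0// exprn_gt0.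
have mesh0 := @mesh_cvg0 Delta.
pose c := net (k%:R * Delta) w - inf [set net s w | s in `[0, k%:R * Delta]].
have cq q : window_grid Delta q 0 k w <= c <= window_grid Delta q 0 k w + mesh Delta q.
  by have := grid_sandwich (k * 2 ^ q) (h0 q); rewrite mesh_grid /window_grid mul0n.
apply: (@squeeze_cvgr _ _ _ _ (fun q => c - mesh Delta q) (fun=> c)).
- by apply: nearW => q; have /andP[c1 c2] := cq q; rewrite c1 lerBlDr c2.
- by rewrite -[X in _ --> X]subr0; apply: cvgB => //; exact: cvg_cst.
- exact: cvg_cst.
Qed.

Lemma workload_window_step Delta k m : 0 < Delta ->
  V ((k + m)%:R * Delta) w =
  Num.max (V (k%:R * Delta) w + (net ((k + m)%:R * Delta) w - net (k%:R * Delta) w))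
    (window Delta k m w).
Proof.
move=> D0; rewrite !workload_window// window_add ?(ltW D0)// add0n.
by rewrite addr_maxl maxA; congr (Num.max (Num.max _ _) _); ring.
Qed.

End regular.
End lindley_recursion.

Section equal_laws.
Context d (Omega : measurableType d) (R : realType) (P : probability Omega R).
Local Notation E := (Rintegral P setT).
Variables X Y : Omega -> R.
Hypotheses (mX : measurable_fun setT X) (mY : measurable_fun setT Y).
Hypothesis XY : forall B, measurable B -> P (X @^-1` B) = P (Y @^-1` B).

Let Xm : {mfun Omega >-> R} :=
  MeasurableFun.Pack (MeasurableFun.Class (isMeasurableFun.Build _ _ _ _ _ mX)).
Let Ym : {mfun Omega >-> R} :=
  MeasurableFun.Pack (MeasurableFun.Class (isMeasurableFun.Build _ _ _ _ _ mY)).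

Lemma equal_law_ge0_integral (f : R -> \bar R) : measurable_fun setT f ->
  (forall x, 0 <= f x)%E -> (\int[P]_w f (X w) = \int[P]_w f (Y w))%E.
Proof.
move=> mf f0.
rewrite -(ge0_integral_distribution Xm mf f0) -(ge0_integral_distribution Ym mf f0).
by apply: eq_measure_integral => A mA _; exact: XY.
Qed.

Lemma equal_law_integral (f : R -> R) : measurable_fun setT f ->
  (\int[P]_w (f (X w))%:E = \int[P]_w (f (Y w))%:E)%E.
Proof.
move=> mf; have mf' : measurable_fun setT (EFin \o f) by exact/measurable_EFinP.
rewrite integralE [RHS]integralE; congr (_ - _)%E.
  under eq_integral do rewrite funeposE.
  under [RHS]eq_integral do rewrite funeposE.
  apply: (equal_law_ge0_integral (f := fun x => maxe (f x)%:E 0%E)).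
    exact: measurable_maxe.
  by move=> x; rewrite le_max lexx orbT.
under eq_integral do rewrite funenegE.
under [RHS]eq_integral do rewrite funenegE.
apply: (equal_law_ge0_integral (f := fun x => maxe (- (f x)%:E)%E 0%E)).
  by apply: measurable_maxe => //; exact: measurableT_comp.
by move=> x; rewrite le_max lexx orbT.
Qed.

Lemma equal_law_E (f : R -> R) : measurable_fun setT f -> E (f \o X) = E (f \o Y).
Proof. by move=> mf; congr fine; exact: equal_law_integral. Qed.

Lemma equal_law_intg (f : R -> R) : measurable_fun setT f ->
  intg P (f \o X) -> intg P (f \o Y).
Proof.
move=> mf /integrableP[_ fX]; apply/integrableP; split.
  exact/measurable_EFinP/measurableT_comp.
rewrite -(equal_law_ge0_integral (f := fun x => `|(f x)%:E|%E))//.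
exact/measurableT_comp/measurable_EFinP.
Qed.

End equal_laws.

(** * Monotone test functions *)

Section test_functions.
Context (R : realType).

(** Left continuity along nondecreasing sequences is what an increasing limit over meshes respects;
    monotonicity turns comparisons of workloads into comparisons of averages. *)
Record test_function (f : R -> R) : Prop := TestFunction {
  test_measurable : measurable_fun setT f ;
  test_01 : forall x, 0 <= f x <= 1 ;
  test_nonincreasing : forall x y, x <= y -> f y <= f x ;
  test_left_continuous : forall u l, nondecreasing_seq u -> u n @[n --> \oo] --> l ->
    f (u n) @[n --> \oo] --> f l }.

Lemma test_norm f x : test_function f -> `|f x| <= 1.
Proof. by case=> _ /(_ x)/andP[f0 f1] _ _; rewrite ger0_norm. Qed.

Lemma test_indicator (y : R) : test_function (fun x => (x <= y)%R%:R).
Proof.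
split.
- rewrite (_ : (fun x => _) = (fun x => if x <= y then 1 else 0)); last first.
    by apply/funext => x; case: ifP.
  by apply: measurable_fun_ifT => //; exact: measurable_fun_ler.
- by move=> x; case: (x <= y); rewrite ?lexx ?ler01.
- move=> x x' xx'; have [x'y|_] := leP x' y; last by rewrite ler0n.
  by rewrite (le_trans xx' x'y).
- move=> u l ndu ul.
  have ub n : u n <= l.
    by have := nondecreasing_cvgn_le ndu (cvgP _ ul) n; rewrite (cvg_lim _ ul).
  apply: cvg_near_cst; have [ly|yl] := leP l y.
    by apply: nearW => n; rewrite (le_trans (ub n) ly).
  have yu : \forall n \near \oo, y < u n by exact: (cvgr_gt _ ul).
  by apply: filterS yu => n yun; rewrite leNgt yun.
Qed.

(** The cap at 1 acts only on negative arguments, where the exponential would leave [0, 1]. *)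
Lemma test_expR (a : R) : 0 <= a -> test_function (fun x => Num.min 1 (expR (- a * x))).
Proof.
move=> a0.
have ce : continuous (fun x : R => expR (- a * x)).
  move=> x; apply: continuous_comp; last exact: continuous_expR.
  by apply: cvgMr; exact: cvg_id.
split.
- apply: measurable_minr => //; exact: continuous_measurable_fun.
- by move=> x; rewrite le_min ler01 expR_ge0/= ge_min lexx.
- move=> x y xy; rewrite le_min ge_min lexx/= ge_min ler_expR orbC.
  by rewrite !mulNr lerN2 ler_wpM2l.
- move=> u l _ ul.
  have minE (x : R) : Num.min 1 x = (1 + x - `|1 - x|) / 2 by rewrite minr_absE.
  under eq_fun do rewrite minE; rewrite minE.
  have cu : expR (- a * u n) @[n --> \oo] --> expR (- a * l).
    exact: (cvg_comp u (fun x => expR (- a * x)) ul (ce l)).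
  apply: cvgMl; apply: cvgB; first by apply: cvgD => //; exact: cvg_cst.
  by apply: cvg_norm; apply: cvgB => //; exact: cvg_cst.
Qed.

End test_functions.

(** * Independence and stationarity of mesh workloads *)

Section subordinator_structure.
Context d (Omega : measurableType d) (R : realType) (P : probability Omega R).
Local Notation E := (Rintegral P setT).
Variable J : R -> {RV P >-> R}.
Hypothesis subJ : subordinator J.
Local Notation inc := (increment (fun t => J t : Omega -> R)).
Local Notation lind := (lindley (fun t => J t : Omega -> R)).
Local Notation win := (window (fun t => J t : Omega -> R)).
Local Notation wing := (window_grid (fun t => J t : Omega -> R)).

Let mJ t : measurable_fun setT (J t). Proof. exact: measurable_funP. Qed.

Lemma regular_path_ae : {ae P, forall w, regular_path (fun t => J t : Omega -> R) w}.
Proof.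
by apply: filterS2 (subordinator_start subJ) (subordinator_nondecreasing subJ).
Qed.

Lemma measurable_increment h i : measurable_fun setT (inc h i).
Proof. exact: measurable_funB. Qed.

Lemma increment_independent h : 0 <= h -> mutually_independent P (inc h).
Proof.
move=> h0; apply: (subordinator_independent_increments subJ (t := fun i => i%:R * h)).
  by rewrite mul0r.
by move=> m n mn; rewrite ler_wpM2r// ler_nat.
Qed.

Lemma increment_law s t B : 0 <= s -> s <= t -> measurable B ->
  P ((fun w => J t w - J s w) @^-1` B) = P (J (t - s) @^-1` B).
Proof. by move=> s0 st mB; exact: (subordinator_stationary_increments subJ). Qed.

Lemma mesh_increment_law h i B : 0 <= h -> measurable B ->
  P (inc h i @^-1` B) = P (J h @^-1` B).
Proof.
move=> h0 mB; have ih : i.+1%:R * h - i%:R * h = h by rewrite -natr1; ring.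
rewrite -[in RHS]ih; apply: increment_law => //; first exact: mulr_ge0.
by rewrite ler_wpM2r// ler_nat.
Qed.

Lemma adapted_lindley h a n :
  adapted (inc h) [set i | (a <= i < a + n)%N] (lind h a n).
Proof.
elim: n => [|n IH]; first exact: measurable_cst.
apply: measurable_maxr; last exact: measurable_cst.
apply: measurable_funD.
  by apply: adapted_sub IH => i /= /andP[-> /leq_trans]; apply; rewrite addnS.
apply: measurable_funB; last exact: measurable_cst.
by apply: adapted_process => /=; rewrite leq_addr addnS ltnS leqnn.
Qed.

Lemma measurable_lindley h a n : measurable_fun setT (lind h a n).
Proof. exact (adapted_measurable (measurable_increment h) (@adapted_lindley h a n)). Qed.

Lemma measurable_parametric_E (F : R * Omega -> R) : measurable_fun setT F ->
  (forall z, 0 <= F z) -> measurable_fun setT (fun x => E (fun w => F (x, w))).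
Proof.
move=> mF F0.
have mF' : measurable_fun setT (EFin \o F) by exact/measurable_EFinP.
apply: (measurableT_comp (@fine_measurable R setT measurableT)).
have F0' z : (0 <= (EFin \o F) z)%E by rewrite /= lee_fin.
exact: (@measurable_fun_fubini_tonelli_F _ _ _ _ _ P (EFin \o F) mF' F0').
Qed.

(** The induction is over all [f]: integrating out the last increment, whose law does not depend on
    its position, replaces [f] by [g] and shortens the queue by one step. *)
Lemma lindley_stationary (h : R) a n (f : R -> R) : 0 <= h -> measurable_fun setT f ->
  (forall x, 0 <= f x <= 1) -> E (f \o lind h a n) = E (f \o lind h 0 n).
Proof.
move=> h0; elim: n f => [//|n IH] f mf f01.
pose F (z : R * R) := f (Num.max (z.1 + (z.2 - h)) 0).
have mF : measurable_fun setT F.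
  apply: measurableT_comp => //; apply: measurable_maxr => //.
  by apply: measurable_funD => //; exact: measurable_funB.
pose g x := E (fun w => F (x, J h w)).
have mg : measurable_fun setT g.
  apply: (@measurable_parametric_E (fun z => F (z.1, J h z.2))).
    apply: measurableT_comp => //; apply: measurable_fun_pair => //.
    exact: measurableT_comp.
  by move=> z; have /andP[] := f01 (Num.max (z.1 + (J h z.2 - h)) 0).
have Fb z : `|F z| <= 1 by have /andP[? ?] := f01 (Num.max (z.1 + (z.2 - h)) 0); rewrite ger0_norm.
have g01 x : 0 <= g x <= 1.
  have mFx : measurable_fun setT (fun w => F (x, J h w)).
    exact: measurableT_comp mF (measurable_fun_pair _ _).
  rewrite E_ge0/=; last by move=> w; have /andP[] := f01 (Num.max (x + (J h w - h)) 0).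
  by apply: le_trans (ler_norm _) _; exact: E_bounded.
suff step b : E (f \o lind h b n.+1) = E (g \o lind h b n) by rewrite !step IH.
have mlb : measurable_fun setT (lind h b n) by exact: measurable_lindley.
have mib : measurable_fun setT (inc h (b + n)) by exact: measurable_increment.
have ind : independent_maps P (lind h b n) (inc h (b + n)).
  apply: (adapted_independent (measurable_increment h) (increment_independent h0) _
    (@adapted_lindley h b n) (adapted_process (D := [set (b + n)%N]) _)) => //.
  by apply/seteqP; split => i //= -[/andP[_ +] ibn]; rewrite ibn ltnn.
rewrite -[LHS]/(E (fun w => F (lind h b n w, inc h (b + n) w))).
rewrite (independent_fubini mlb mib ind mF).
- apply: eq_Rintegral => w _ /=; rewrite /g.
  apply: (equal_law_E mib (mJ h) (fun B mB => mesh_increment_law _ h0 mB)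
    (f := fun y => F (lind h b n w, y))).
  exact: measurableT_comp mF (measurable_pair1 _).
- apply: (@intg_bounded _ _ _ _ _ 1) => // .
  exact: measurableT_comp mF (measurable_fun_pair _ _).
- move=> w; apply: (@intg_bounded _ _ _ _ _ 1) => //.
  exact: measurableT_comp (measurableT_comp mF (measurable_pair1 _)) mib.
Qed.

Lemma lindley_product (h : R) a n b m (f : R -> R) : 0 <= h -> measurable_fun setT f ->
  (forall x, 0 <= f x <= 1) -> (a + n <= b)%N ->
  E (fun w => f (lind h a n w) * f (lind h b m w)) =
  E (f \o lind h a n) * E (f \o lind h b m).
Proof.
move=> h0 mf f01 anb.
apply: (@independent_expectation _ _ _ _ _ _ f f 1) => //.
- exact: measurable_lindley.
- exact: measurable_lindley.
- apply: (adapted_independent (measurable_increment h) (increment_independent h0) _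
    (@adapted_lindley h a n) (@adapted_lindley h b m)).
  apply/seteqP; split => i // -[/= /andP[_ ian] /andP[bi _]].
  by have := leq_trans ian (leq_trans anb bi); rewrite ltnn.
- by move=> x; have /andP[? ?] := f01 x; rewrite ger0_norm.
- by move=> x; have /andP[? ?] := f01 x; rewrite ger0_norm.
Qed.

Lemma measurable_window_grid Delta q k m : measurable_fun setT (wing Delta q k m).
Proof. exact: measurable_lindley. Qed.

Lemma measurable_window Delta k m : measurable_fun setT (win Delta k m).
Proof.
apply: (measurableT_comp (@fine_measurable R setT measurableT)).
rewrite (_ : (fun w => _) = fun w => esups (fun q => (wing Delta q k m w)%:E) 0%N).
  apply: measurable_fun_esups => q; apply/measurable_EFinP.
  exact: measurable_window_grid.
apply/funext => w; rewrite /esups/=; congr ereal_sup.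
by apply/seteqP; split => _ [q _ <-]; exists q.
Qed.

End subordinator_structure.

(** * Averages of windows *)

Section uncorrelated.
Context d (Omega : measurableType d) (R : realType) (P : probability Omega R).
Local Notation E := (Rintegral P setT).

Lemma uncorrelated_slln (Y : nat -> Omega -> R) (a : R) m :
  (forall k, measurable_fun setT (Y k)) -> (forall k w, 0 <= Y k w <= 1) ->
  (forall k, E (Y k) = a) ->
  (forall i j, (i + m <= j)%N -> E (fun w => Y i w * Y j w) = a * a) ->
  {ae P, forall w, n%:R^-1 * (\sum_(k < n) Y k w) @[n --> \oo] --> a}.
Proof.
move=> mY Y01 EY EYY.
have Yb k w : `|Y k w| <= 1 by have /andP[? ?] := Y01 k w; rewrite ger0_norm.
have IY k : intg P (Y k) := intg_bounded P (mY k) (Yb k).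
have IYY i j : intg P (fun w => Y i w * Y j w).
  apply: (@intg_bounded _ _ _ _ _ 1) => [|w]; first exact: measurable_funM.
  by rewrite normrM -[leRHS]mulr1 ler_pM.
have mZ k : measurable_fun setT (fun w => Y k w - a) by exact: measurable_funB.
have Zb k w : `|Y k w - a| <= 1 + `|a|.
  by rewrite (le_trans (ler_normB _ _))// lerD2r.
have ZZ i j : (i + m <= j)%N -> E (fun w => (Y i w - a) * (Y j w - a)) = 0.
  move=> ij.
  have -> : (fun w => (Y i w - a) * (Y j w - a)) =
      (fun w => Y i w * Y j w - (a * Y i w + (a * Y j w - a * a))).
    by apply/funext => w; ring.
  have I1 := intgB (intgZ a (IY j)) (intg_cst P (a * a)).
  rewrite E_B//; last by apply: intgD => //; exact: intgZ.
  rewrite E_D//; last exact: intgZ.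
  rewrite E_B//; [|exact: intgZ|exact: intg_cst].
  by rewrite (E_Z a (IY i)) (E_Z a (IY j)) (EY i) (EY j) EYY// E_cst; ring.
apply: filterS (weak_orthogonal_slln mZ Zb ZZ) => w h.
have : n%:R^-1 * (\sum_(i < n) (Y i w - a)) + a @[n --> \oo] --> 0 + a.
  by apply: cvgD => //; exact: cvg_cst.
rewrite add0r; apply: cvg_trans; apply: near_eq_cvg; near=> n => /=.
rewrite sumrB sumr_const card_ord mulrBr -[a *+ n]mulr_natl mulKf ?subrK//.
by rewrite gt_eqF// ltr0n; near: n; exact: nbhs_infty_gt.
Unshelve. all: by end_near. Qed.

End uncorrelated.

Section windows.
Context d (Omega : measurableType d) (R : realType) (P : probability Omega R).
Local Notation E := (Rintegral P setT).
Variable J : R -> {RV P >-> R}.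
Hypothesis subJ : subordinator J.
Local Notation inc := (increment (fun t => J t : Omega -> R)).
Local Notation lind := (lindley (fun t => J t : Omega -> R)).
Local Notation win := (window (fun t => J t : Omega -> R)).
Local Notation wing := (window_grid (fun t => J t : Omega -> R)).
Variable Delta : R.
Hypothesis Delta0 : 0 < Delta.

Let mesh0 q : 0 <= mesh Delta q.
Proof. by rewrite divr_ge0 ?exprn_ge0// ltW. Qed.

Section test.
Variable f : R -> R.
Hypothesis tf : test_function f.

Let mf := test_measurable tf.
Let f01 := test_01 tf.

Let mfg q k m : measurable_fun setT (f \o wing Delta q k m).
Proof. exact: measurableT_comp mf (measurable_window_grid J _ _ _ _). Qed.

Let mfw k m : measurable_fun setT (f \o win Delta k m).
Proof. exact: measurableT_comp mf (measurable_window J _ _ _). Qed.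

Let fb x : `|f x| <= 1. Proof. exact: test_norm. Qed.

Let cvg_test k m : {ae P, forall w,
  f (wing Delta q k m w) @[q --> \oo] --> f (win Delta k m w)}.
Proof.
apply: filterS (regular_path_ae subJ) => w rw.
apply: (test_left_continuous tf); first exact: window_grid_nondecreasing.
exact: cvg_window (ltW Delta0).
Qed.

Let cvg_E_test k m :
  E (f \o wing Delta q k m) @[q --> \oo] --> E (f \o win Delta k m).
Proof.
apply: (@E_bounded_cvg _ _ _ _ _ _ 1) => [q||q w|].
- exact: mfg.
- exact: mfw.
- exact: fb.
- exact: cvg_test.
Qed.

Let grid_stationary q k m : E (f \o wing Delta q k m) = E (f \o wing Delta q 0 m).
Proof. by rewrite /window_grid (lindley_stationary subJ)// mul0n. Qed.

Lemma window_stationary k m : E (f \o win Delta k m) = E (f \o win Delta 0 m).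
Proof.
rewrite -(cvg_lim _ (@cvg_E_test k m))//; apply: cvg_lim => //.
by under eq_fun do rewrite grid_stationary; exact: cvg_E_test.
Qed.

(** Windows at distance at least [m] use disjoint increments. Independence is applied on each mesh,
    and the product moments pass to the limit by bounded convergence. *)
Lemma window_slln m : {ae P, forall w,
  n%:R^-1 * (\sum_(k < n) f (win Delta k m w)) @[n --> \oo] --> E (f \o win Delta 0 m)}.
Proof.
apply: (@uncorrelated_slln _ _ _ _ (fun k w => f (win Delta k m w)) _ m).
- by move=> k; exact: mfw.
- by move=> k w; exact: f01.
- by move=> k; exact: window_stationary.
- move=> i j ij.
  have h1 : E (fun w => f (wing Delta q i m w) * f (wing Delta q j m w)) @[q --> \oo] -->
      E (fun w => f (win Delta i m w) * f (win Delta j m w)).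
    apply: (@E_bounded_cvg _ _ _ _ _ _ 1).
    + move=> q; exact: measurable_funM (mfg _ _ _) (mfg _ _ _).
    + exact: measurable_funM (mfw _ _) (mfw _ _).
    + by move=> q w; rewrite normrM -[leRHS]mulr1 ler_pM.
    + by apply: filterS2 (cvg_test i m) (cvg_test j m) => w; exact: cvgM.
  rewrite -(cvg_lim _ h1)//; apply: cvg_lim => //.
  have -> : (fun q => E (fun w => f (wing Delta q i m w) * f (wing Delta q j m w))) =
      (fun q => E (f \o wing Delta q 0 m) * E (f \o wing Delta q 0 m)).
    apply/funext => q; rewrite (lindley_product subJ)//.
      by congr (_ * _); exact: grid_stationary.
    by rewrite -mulnDl leq_mul2r ij orbT.
  by apply: cvgM; exact: cvg_E_test.
Qed.

(** By stationarity the queue of [m] steps may be started at [n - m]; it then ends together with the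
    longer queue, which dominates it pathwise. *)
Lemma lindley_E_nonincreasing h m n : 0 <= h -> (m <= n)%N ->
  E (f \o lind h 0 n) <= E (f \o lind h 0 m).
Proof.
move=> h0 mn.
have mfl a k : measurable_fun setT (f \o lind h a k).
  exact: measurableT_comp mf (measurable_lindley J _ _ _).
rewrite -(lindley_stationary subJ (n - m) m h0 mf f01).
have Ifl a k : intg P (f \o lind h a k) := intg_bounded P (mfl a k) (fun w => fb _).
apply: E_le => // w.
apply: (test_nonincreasing tf).
have := lindley_add (fun t => J t : Omega -> R) h 0 (n - m) m w.
by rewrite add0n subnK// => ->; rewrite le_max lexx orbT.
Qed.

(* The limit of [E f(V t)] as [t] goes to infinity: by monotonicity in the
   horizon [m] and in the refinement [q] of the grid the infimum is a limit. *)
Definition stationary_mean := inf (range (fun p : nat * nat => E (f \o wing Delta p.1 0 p.2))).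

Let EFg0 q k m : 0 <= E (f \o wing Delta q k m).
Proof. by apply: E_ge0 => w; have /andP[] := f01 (wing Delta q k m w). Qed.

Lemma stationary_mean_le q m : stationary_mean <= E (f \o wing Delta q 0 m).
Proof.
apply: ge_inf; last by exists (q, m).
by exists 0 => _ [[q' m'] _ <-]; exact: EFg0.
Qed.

Lemma stationary_mean_approx e : 0 < e -> exists q m,
  E (f \o wing Delta q 0 m) < stationary_mean + e.
Proof.
move=> e0.
have hi : has_inf (range (fun p : nat * nat => E (f \o wing Delta p.1 0 p.2))).
  split; first by exists (E (f \o wing Delta 0 0 0)), (0%N, 0%N).
  by exists 0 => _ [[q m] _ <-]; exact: EFg0.
by have [_ [[q m] _ <-] lt] := inf_adherent e0 hi; exists q, m.
Qed.

Let grid_nonincreasing q q' m m' : (q <= q')%N -> (m <= m')%N ->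
  E (f \o wing Delta q' 0 m') <= E (f \o wing Delta q 0 m).
Proof.
move=> qq' mm'; apply: (@le_trans _ _ (E (f \o wing Delta q 0 m'))).
  have Ifg r k : intg P (f \o wing Delta r k m') := intg_bounded P (mfg r k m') (fun w => fb _).
  apply: E_le => // w.
  by apply: (test_nonincreasing tf); exact: window_grid_nondecreasing.
by apply: lindley_E_nonincreasing => //; rewrite leq_mul2r mm' orbT.
Qed.

Lemma grid_near_stationary e : 0 < e -> exists q m, forall q' m',
  (q <= q')%N -> (m <= m')%N ->
  stationary_mean <= E (f \o wing Delta q' 0 m') < stationary_mean + e.
Proof.
move=> /stationary_mean_approx[q [m qm]]; exists q, m => q' m' qq' mm'.
by rewrite stationary_mean_le/= (le_lt_trans _ qm)// grid_nonincreasing.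
Qed.

Lemma window_E_cvg :
  E (f \o win Delta 0 m) @[m --> \oo] --> stationary_mean.
Proof.
apply/cvgrPdist_le => e /grid_near_stationary[q [M qM]].
exists M => // m /= Mm; rewrite distrC.
have lo : stationary_mean <= E (f \o win Delta 0 m).
  rewrite -(cvg_lim _ (@cvg_E_test 0 m))//; apply: limr_ge.
    by apply/cvg_ex; eexists; exact: cvg_E_test.
  by apply: nearW => q'; exact: stationary_mean_le.
have hi : E (f \o win Delta 0 m) <= stationary_mean + e.
  rewrite -(cvg_lim _ (@cvg_E_test 0 m))//; apply: limr_le.
    by apply/cvg_ex; eexists; exact: cvg_E_test.
  exists q => // q' /= qq'; have /andP[_ /ltW//] := qM q' m qq' Mm.
by rewrite ger0_norm ?subr_ge0// lerBlDl.
Qed.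

End test.

Lemma increment_window_slln (f : R -> R) m : measurable_fun setT f ->
  (forall x, 0 <= f x <= 1) ->
  {ae P, forall w, n%:R^-1 *
     (\sum_(k < n) f (J ((k + m)%:R * Delta) w - J (k%:R * Delta) w))
    @[n --> \oo] --> E (f \o J (m%:R * Delta))}.
Proof.
move=> mf f01.
pose X k w := J ((k + m)%:R * Delta) w - J (k%:R * Delta) w.
have mX k : measurable_fun setT (X k) by exact: measurable_funB.
have kD0 (k : nat) : 0 <= k%:R * Delta by rewrite mulr_ge0// ltW.
have law k B : measurable B -> P (X k @^-1` B) = P (J (m%:R * Delta) @^-1` B).
  move=> mB; have -> : m%:R * Delta = (k + m)%:R * Delta - k%:R * Delta.
    by rewrite natrD; ring.
  by apply: increment_law => //; rewrite ler_pM2r// ler_nat leq_addr.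
have EX k : E (f \o X k) = E (f \o J (m%:R * Delta)).
  exact: equal_law_E (mX k) _ (law k) _ mf.
have aX k : adapted (inc Delta) [set i | (k <= i < k + m)%N] (X k).
  rewrite (_ : X k = fun w => \sum_(i < m) inc Delta (k + i) w).
    apply: measurable_sum => i; apply: adapted_process => /=.
    by rewrite leq_addr ltn_add2l ltn_ord.
  apply/funext => w; rewrite /X; elim: (m) => [|n IH].
    by rewrite big_ord0 addn0 subrr.
  by rewrite big_ord_recr/= -IH /increment addnS; ring.
apply: (@uncorrelated_slln _ _ _ _ (fun k w => f (X k w)) _ m).
- by move=> k; exact: measurableT_comp mf (mX k).
- by move=> k w; exact: f01.
- by move=> k; exact: EX.
- move=> i j ij; transitivity (E (f \o X i) * E (f \o X j)); last by rewrite !EX.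
  apply: (@independent_expectation _ _ _ _ _ _ f f 1) => //.
  + apply: (adapted_independent (measurable_increment J Delta)
      (increment_independent subJ (ltW Delta0)) _ (@aX i) (@aX j)).
    apply/seteqP; split => k // -[/= /andP[_ ki] /andP[jk _]].
    by have := leq_trans ki (leq_trans ij jk); rewrite ltnn.
  + by move=> x; have /andP[? ?] := f01 x; rewrite ger0_norm.
  + by move=> x; have /andP[? ?] := f01 x; rewrite ger0_norm.
Qed.

End windows.

(** * Averages of nonnegative integrable variables *)

Section dyadic_truncation.
Context (R : realType).

(** In mean, the first term controls the squared deviation of the average of the dyadic block
    [2 ^ j .. 2 ^ (j + 1)] truncated at [2 ^ j], the second the number of its terms above that
    level. The sum over [j] is linear in [z], so a finite first moment suffices. *)
Definition truncation_cost (j : nat) (z : R) : R :=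
  (2 ^+ j)^-1 * Num.min z (2 ^+ j) ^+ 2 + 2 ^+ j * (2 ^+ j < z)%R%:R.

Let costS j z : truncation_cost j.+1 z = 2 * truncation_cost j (z / 2).
Proof.
have p0 : 0 < 2 ^+ j :> R by rewrite exprn_gt0.
rewrite /truncation_cost exprS ltr_pdivlMr// (mulrC _ 2).
have -> : Num.min (z / 2) (2 ^+ j) = Num.min z (2 * 2 ^+ j) / 2.
  by rewrite minr_pMl ?invr_ge0// mulrAC mulfV// mul1r.
by field; rewrite gt_eqF.
Qed.

(* The correction [B] makes the induction on [n] work through the scaling
   identity [cost (j + 1) z = 2 * cost j (z / 2)]. *)
Lemma truncation_cost_sum n z : 0 <= z ->
  \sum_(j < n) truncation_cost j z <= 5 * z.
Proof.
move=> z0; pose B (x : R) := if x <= 1 then 5 * x - 2 * x ^+ 2 else 2.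
suff h : \sum_(j < n) truncation_cost j z <= 5 * z - B z.
  apply: le_trans h _; rewrite gerBl /B; case: ifP => // z1.
  by rewrite subr_ge0 expr2; nra.
elim: n z z0 => [|n IH] z z0.
  rewrite big_ord0 /B; case: ifPn; last by rewrite -ltNge; lra.
  by rewrite opprB addrCA subrr addr0 mulr_ge0// sqr_ge0.
rewrite big_ord_recl; under eq_bigr do rewrite lift0 costS.
rewrite -mulr_sumr; have z20 : 0 <= z / 2 by rewrite divr_ge0.
apply: le_trans (lerD (lexx _) (ler_wpM2l (ltW _) (IH _ z20))) _ => //.
rewrite /truncation_cost expr0 invr1 !mul1r /B.
have [z1|z1] := leP z 1.
  have -> : z / 2 <= 1 by lra.
  by rewrite /= addr0 !expr2; nra.
have [z2|z2] := leP (z / 2) 1; last by rewrite /= expr1n; lra.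
by rewrite /= !expr2; nra.
Qed.

(** Up to the next power of two the blocks add up to at most [2 * n * delta], and the part before
    [2 ^ J] is at most [n * delta] for large [n]: hence the factor 3. *)
Lemma dyadic_blocks (z : nat -> R) (delta : R) J :
  (forall k, 0 <= z k) -> 0 < delta ->
  (forall j, (J <= j)%N -> \sum_(k < 2 ^ j) z (2 ^ j + k)%N <= 2 ^+ j * delta) ->
  \forall n \near \oo, n%:R^-1 * (\sum_(k < n) z k) <= 3 * delta.
Proof.
move=> z0 delta0 zJ.
pose S n := \sum_(k < n) z k.
have ndS m n : (m <= n)%N -> S m <= S n.
  move=> mn; rewrite /S -(subnKC mn) big_split_ord/= lerDl.
  by apply: sumr_ge0.
have SJ j : S (2 ^ (J + j))%N <= S (2 ^ J)%N + 2 ^+ (J + j) * delta.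
  elim: j => [|j IH].
    by rewrite addn0 lerDl mulr_ge0 ?exprn_ge0// ltW.
  have := zJ (J + j)%N (leq_addr _ _).
  have -> : S (2 ^ (J + j.+1))%N = S (2 ^ (J + j))%N +
      \sum_(k < 2 ^ (J + j)) z (2 ^ (J + j) + k)%N.
    by rewrite addnS expnS mul2n -addnn /S big_split_ord/=.
  by rewrite addnS exprS; move: IH; set x := S (2 ^ (J + j))%N; set y := 2 ^+ (J + j); lra.
pose C := S (2 ^ J)%N.
pose M := maxn (2 ^ J) (Num.truncn (C / delta)).+1.
exists M => // n /= Mn.
have Jn : (2 ^ J <= n)%N by rewrite (leq_trans _ Mn)// leq_maxl.
have n0 : (0 < n)%N by rewrite (leq_trans _ Jn)// expn_gt0.
have n0' : 0 < n%:R :> R by rewrite ltr0n.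
rewrite ler_pdivrMl//.
have Cn : C <= n%:R * delta.
  rewrite -ler_pdivrMr// (le_trans (ltW (truncnS_gt _)))// ler_nat.
  by rewrite (leq_trans (leq_maxr _ _) Mn).
have /andP[j1 j2] := trunc_log_bounds (isT : (1 < 2)%N) n0.
set j := trunc_log 2 n in j1 j2.
have Jj : (J <= j.+1)%N.
  by have := leq_ltn_trans Jn j2; rewrite ltn_exp2l// => /ltnW.
have := le_trans (ndS _ _ (ltnW j2)) (_ : S (2 ^ j.+1)%N <= C + 2 ^+ j.+1 * delta).
rewrite -/(S n) => /(_ _)/le_trans; apply.
  by have := SJ (j.+1 - J)%N; rewrite subnKC.
have : 2 ^+ j.+1 * delta <= 2 * n%:R * delta.
  rewrite ler_wpM2r ?(ltW delta0)// exprS ler_wpM2l//.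
  by rewrite -natrX ler_nat.
by lra.
Qed.

End dyadic_truncation.

Section l1_upper.
Context d (Omega : measurableType d) (R : realType) (P : probability Omega R).
Local Notation E := (Rintegral P setT).
Variable X : nat -> Omega -> R.
Hypothesis mX : forall k, measurable_fun setT (X k).
Hypothesis indX : forall i j, (i < j)%N -> independent_maps P (X i) (X j).
Hypothesis lawX : forall k B, measurable B -> P (X k @^-1` B) = P (X 0%N @^-1` B).
Variable f : R -> R.
Hypotheses (mf : measurable_fun setT f) (f0 : forall x, 0 <= f x).
Hypothesis If : intg P (f \o X 0%N).

Let p (j : nat) : R := 2 ^+ j.
Let p0 j : 0 < p j. Proof. by rewrite exprn_gt0. Qed.

Let zeta j k w := Num.min (f (X k w)) (p j).

Let mmin j : measurable_fun setT (fun x => Num.min (f x) (p j)).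
Proof. exact: measurable_minr. Qed.

Let mzeta j k : measurable_fun setT (zeta j k).
Proof. exact: measurableT_comp (mmin j) (mX k). Qed.

Let zeta_bound j k w : `|zeta j k w| <= p j.
Proof. by rewrite ger0_norm ?ge_min ?lexx ?orbT// le_min f0 ltW. Qed.

Let Izeta j k : intg P (zeta j k) := intg_bounded P (mzeta j k) (zeta_bound j k).

Let mu j := E (zeta j 0).

Let Ezeta j k : E (zeta j k) = mu j.
Proof. exact: equal_law_E (mX k) (mX 0%N) (lawX k) _ (mmin j). Qed.

Let mu_le j : mu j <= E (f \o X 0%N).
Proof. by apply: E_le => // w; rewrite ge_min lexx. Qed.

Let excess j k w : R := (p j < f (X k w))%R%:R.

Let mexc j : measurable_fun setT (fun x => (p j < f x)%R%:R : R).
Proof.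
rewrite (_ : (fun x => _) = fun x => if p j < f x then 1 else 0).
  by apply: measurable_fun_ifT => //; exact: measurable_fun_ltr.
by apply/funext => x; case: ifP.
Qed.

Let mexcess j k : measurable_fun setT (excess j k).
Proof. exact: measurableT_comp (mexc j) (mX k). Qed.

Let excess_bound j k w : `|excess j k w| <= 1.
Proof. by rewrite /excess; case: (_ < _); rewrite ?normr1 ?normr0. Qed.

Let Iexcess j k : intg P (excess j k) := intg_bounded P (mexcess j k) (excess_bound j k).

Let Eexcess j k : E (excess j k) = E (excess j 0).
Proof. exact: equal_law_E (mX k) (mX 0%N) (lawX k) _ (mexc j). Qed.

Let block j w := \sum_(k < 2 ^ j) (zeta j (2 ^ j + k)%N w - mu j).

Let block_moment j : intg P (fun w => block j w ^+ 2) /\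
  E (fun w => block j w ^+ 2) <= (2 ^ j)%:R * (5 * E (fun w => zeta j 0 w ^+ 2)).
Proof.
have I2 k : intg P (fun w => zeta j k w ^+ 2).
  apply: (@intg_bounded _ _ _ _ _ (p j ^+ 2)) => [|w]; first exact: measurable_funX.
  by rewrite normrX ler_pXn2r ?nnegrE// ltW.
have E2 k : E (fun w => zeta j k w ^+ 2) = E (fun w => zeta j 0 w ^+ 2).
  exact: equal_law_E (mX k) (mX 0%N) (lawX k) _ (measurable_funX 2 (mmin j)).
have mZ k : measurable_fun setT (fun w => zeta j (2 ^ j + k)%N w - mu j).
  exact: measurable_funB.
have ZE k w : (zeta j k w - mu j) ^+ 2 =
    zeta j k w ^+ 2 - (2 * mu j * zeta j k w - mu j ^+ 2) by ring.
have IZ k : intg P (fun w => (zeta j (2 ^ j + k)%N w - mu j) ^+ 2).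
  under eq_fun do rewrite ZE.
  by apply: intgB => //; apply: intgB; [exact: intgZ|exact: intg_cst].
have Z2 k : E (fun w => (zeta j (2 ^ j + k)%N w - mu j) ^+ 2) <= E (fun w => zeta j 0 w ^+ 2).
  under eq_Rintegral do rewrite ZE.
  rewrite E_B//; last by apply: intgB; [exact: intgZ|exact: intg_cst].
  rewrite E_B; [|exact: intgZ|exact: intg_cst].
  rewrite (E_Z _ (Izeta _ _)) Ezeta E_cst E2 gerBl.
  by have := sqr_ge0 (mu j); rewrite expr2; lra.
have ZZ i k : (i + 1 <= k)%N -> E (fun w => (zeta j (2 ^ j + i)%N w - mu j) *
    (zeta j (2 ^ j + k)%N w - mu j)) = 0.
  move=> ik.
  have mm : measurable_fun setT (fun x => Num.min (f x) (p j) - mu j).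
    exact: measurable_funB.
  have mb x : `|Num.min (f x) (p j) - mu j| <= p j + `|mu j|.
    rewrite (le_trans (ler_normB _ _))// lerD2r ger0_norm ?ge_min ?lexx ?orbT//.
    by rewrite le_min f0 ltW.
  have ij : (2 ^ j + i < 2 ^ j + k)%N by rewrite ltn_add2l -addn1.
  have := independent_expectation (mX _) (mX _) (indX ij) mm mm mb mb.
  rewrite -[X in _ = X * _]/(E (fun w => zeta j (2 ^ j + i)%N w - mu j)).
  rewrite E_B//; last exact: intg_cst.
  by rewrite Ezeta E_cst subrr mul0r => <-.
have [IB EB] := weak_orthogonal_moment mZ IZ Z2 ZZ (2 ^ j)%N.
split; first exact: IB.
by rewrite (le_trans EB)// ler_wpM2l//; rewrite (_ : 4 * 1 + 1 = 5)//; ring.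
Qed.

(** Squared block deviation plus the number of terms above the truncation level. The constant 5 in
    [EF] is [4 m + 1] at [m = 1], from [weak_orthogonal_moment]. *)
Let F j w := (p j)^-1 ^+ 2 * block j w ^+ 2 +
  \sum_(k < 2 ^ j) excess j (2 ^ j + k)%N w.

Let IF j : intg P (F j).
Proof.
apply: intgD; first exact: intgZ (block_moment j).1.
by apply: intg_sum => k; exact: Iexcess.
Qed.

Let cost_integrable j : intg P (fun w => truncation_cost j (f (X 0%N w))).
Proof.
apply: intgD; last exact: (intgZ _ (Iexcess j 0)).
apply: intgZ; apply: (@intg_bounded _ _ _ _ _ (p j ^+ 2)) => [|w].
  by apply: measurable_funX; exact: mzeta.
by rewrite normrX ler_pXn2r ?nnegrE ?(ltW (p0 _))//; exact: zeta_bound.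
Qed.

Let EF j : E (F j) <= 5 * E (fun w => truncation_cost j (f (X 0%N w))).
Proof.
have I2 : intg P (fun w => zeta j 0 w ^+ 2).
  apply: (@intg_bounded _ _ _ _ _ (p j ^+ 2)) => [|w]; first exact: measurable_funX.
  by rewrite normrX ler_pXn2r ?nnegrE// ltW.
rewrite E_D; [|exact: intgZ (block_moment j).1|by apply: intg_sum => k; exact: Iexcess].
rewrite (E_Z _ (block_moment j).1).
rewrite (E_sum (P := P) _ _ (f := fun (k : 'I_(2 ^ j)) w => excess j (2 ^ j + k)%N w))//.
under eq_bigr do rewrite Eexcess.
rewrite sumr_const card_ord.
rewrite /truncation_cost E_D; [|exact: (intgZ _ I2)|exact: (intgZ _ (Iexcess j 0))].
rewrite (E_Z _ I2) (E_Z _ (Iexcess j 0)) mulrDr.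
have pE : (2 ^ j)%:R = p j :> R by rewrite natrX.
have ex0 : 0 <= E (excess j 0) by apply: E_ge0 => w; rewrite /excess.
apply: lerD.
  apply: le_trans (ler_wpM2l (sqr_ge0 _) (block_moment j).2) _; rewrite pE -/(p j).
  by rewrite le_eqVlt; apply/orP; left; apply/eqP; field; rewrite gt_eqF.
rewrite -[leLHS]mulr_natl pE -/(p j); apply: ler_peMl; last by rewrite ler1n.
by rewrite mulr_ge0// ltW.
Qed.

(** Pairwise independence and a first moment make the block costs summable. The factor 3 is
    affordable because the bound is applied to an excess of arbitrarily small mean. *)
Lemma l1_averages_bounded delta : E (f \o X 0%N) < delta ->
  {ae P, forall w, \forall n \near \oo,
    n%:R^-1 * (\sum_(k < n) f (X k w)) <= 3 * delta}.
Proof.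
move=> fdelta.
have Ef0 : 0 <= E (f \o X 0%N) by apply: E_ge0 => w /=.
have delta0 : 0 < delta by exact: le_lt_trans fdelta.
have F0 j w : 0 <= F j w.
  apply: addr_ge0; first by apply: mulr_ge0; exact: sqr_ge0.
  by apply: sumr_ge0 => k _; rewrite /excess.
have FC n : \sum_(j < n) E (F j) <= 5 * (5 * E (f \o X 0%N)).
  rewrite (le_trans (ler_sum _ (fun (j : 'I_n) _ => EF j)))// -mulr_sumr ler_wpM2l//.
  rewrite -(E_sum (P := P) _ _ (f := fun (j : 'I_n) w => truncation_cost j (f (X 0%N w))))//.
  rewrite -E_Z//; apply: E_le => [||w].
  - by apply: intg_sum => j; exact: cost_integrable.
  - exact: intgZ.
  - exact: truncation_cost_sum.
apply: filterS (ae_cvg_of_summable IF F0 FC) => w Fw.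
(* Below 1, the integer count of terms above the level is 0; below the square, the block average
   exceeds the truncated mean by less than [delta] minus the full mean. *)
pose e := Num.min 1 ((delta - E (f \o X 0%N)) ^+ 2).
have e0 : 0 < e by rewrite lt_min ltr01 exprn_gt0// subr_gt0.
have [J _ FJ] := cvgr_lt _ Fw _ e0.
apply: (@dyadic_blocks _ (fun k => f (X k w)) delta J) => // j Jj.
have := FJ j Jj; rewrite lt_min => /andP[F1 F2].
have ex0 : 0 <= \sum_(k < 2 ^ j) excess j (2 ^ j + k)%N w.
  by apply: sumr_ge0 => k _; rewrite /excess.
have bl0 : 0 <= (p j)^-1 ^+ 2 * block j w ^+ 2.
  by apply: mulr_ge0; exact: sqr_ge0.
have nex (k : 'I_(2 ^ j)) : f (X (2 ^ j + k)%N w) <= p j.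
  rewrite leNgt; apply/negP => exk.
  have : 1 <= \sum_(k < 2 ^ j) excess j (2 ^ j + k)%N w.
    by rewrite (bigD1 k)//= {1}/excess exk lerDl; apply: sumr_ge0 => i _; rewrite /excess.
  by move: F1; rewrite /F; lra.
have -> : \sum_(k < 2 ^ j) f (X (2 ^ j + k)%N w) = block j w + p j * mu j.
  rewrite /block sumrB sumr_const card_ord -[mu j *+ _]mulr_natl natrX subrK.
  by apply: eq_bigr => k _; rewrite /zeta min_l.
have {}F2 : ((p j)^-1 * block j w) ^+ 2 < (delta - E (f \o X 0%N)) ^+ 2.
  by rewrite exprMn; move: F2; rewrite /F; lra.
have : (p j)^-1 * block j w < delta - E (f \o X 0%N).
  rewrite ltNge; apply/negP => h; move: F2; rewrite ltNge => /negP; apply.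
  by rewrite ler_pXn2r ?nnegrE ?subr_ge0 ?(ltW fdelta)// (le_trans _ h)// subr_ge0 ltW.
rewrite ltr_pdivrMl// -/(p j) => bl.
by have := mu_le j; have := p0 j; nra.
Qed.

End l1_upper.

(** * Mean and Laplace exponent *)

Section additive.
Context (R : realType).

(** Additivity and sign give monotonicity. Comparing [n t] with neighbouring integers bounds [n]
    times the defect [a t - t * a 1] by [a 1], for every [n]. *)
Lemma additive_ge0_linear (a : R -> R) :
  (forall s t, 0 <= s -> 0 <= t -> a (s + t) = a s + a t) ->
  (forall t, 0 <= t -> 0 <= a t) -> forall t, 0 <= t -> a t = t * a 1.
Proof.
move=> aD a0 t t0.
have aM n x : 0 <= x -> a (n%:R * x) = n%:R * a x.
  move=> x0; elim: n => [|n IH].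
    rewrite !mul0r; have := aD 0 0 (lexx _) (lexx _); rewrite addr0.
    by move=> h; apply: (addrI (a 0)); rewrite -h addr0.
  by rewrite -natr1 !mulrDl !mul1r aD ?IH// mulr_ge0.
have amono s u : 0 <= s -> s <= u -> a s <= a u.
  by move=> s0 su; rewrite -(subrK s u) addrC aD ?subr_ge0// lerDl a0// subr_ge0.
have bound n : `|n%:R * (a t - t * a 1)| <= a 1.
  have nt0 : 0 <= n%:R * t by rewrite mulr_ge0.
  have /andP[k1 k2] := truncn_itv nt0; set k := Num.truncn _ in k1 k2.
  have aN (i : nat) : a i%:R = i%:R * a 1 by rewrite -{1}[i%:R]mulr1 aM.
  have h1 : k%:R * a 1 <= n%:R * a t by rewrite -aN -aM// amono.
  have h2 : n%:R * a t <= (k%:R + 1) * a 1 by rewrite natr1 -aN -aM// amono// ltW.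
  have a10 := a0 1 ler01.
  have h3 : n%:R * (t * a 1) <= (k%:R + 1) * a 1.
    by rewrite natr1 mulrA ler_wpM2r// ltW.
  have h4 : k%:R * a 1 <= n%:R * (t * a 1) by rewrite mulrA ler_wpM2r.
  rewrite mulrBr ler_norml; move: h1 h2 h3 h4; rewrite mulrDl mul1r.
  by move=> h1 h2 h3 h4; apply/andP; split; lra.
apply/eqP; rewrite -subr_eq0; apply/eqP/normr0_eq0/eqP.
rewrite eq_le normr_ge0 andbT leNgt; apply/negP => d0.
have := bound (Num.truncn (a 1 / `|a t - t * a 1|)).+1.
rewrite normrM normr_nat -ler_pdivlMr// leNgt => /negP; apply.
exact: truncnS_gt.
Qed.

End additive.

Section mean.
Context d (Omega : measurableType d) (R : realType) (P : probability Omega R).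
Local Notation E := (Rintegral P setT).

Lemma intg_ae_le (f g : Omega -> R) : measurable_fun setT f ->
  {ae P, forall w, `|f w| <= g w} -> intg P g -> intg P f.
Proof.
move=> mf fg Ig; apply/integrableP; split; first exact/measurable_EFinP.
have /integrableP[mg] := Ig; apply: le_lt_trans.
apply: ae_ge0_le_integral => //.
- by apply: measurableT_comp => //; exact/measurable_EFinP.
- exact: measurableT_comp.
- by apply: filterS fg => w fgw _; rewrite /= lee_fin (le_trans fgw)// ler_norm.
Qed.

Lemma intg_norm (f : Omega -> R) : intg P f -> intg P (fun w => `|f w|).
Proof. exact: integrable_abse. Qed.

Lemma E_ae_le (f g : Omega -> R) : intg P f -> intg P g ->
  {ae P, forall w, f w <= g w} -> E f <= E g.
Proof.
move=> If Ig fg; have mf := intg_measurable If; have mg := intg_measurable Ig.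
rewrite (@E_ae _ _ _ _ f (fun w => Num.min (f w) (g w)))//.
- apply: E_le => // [|w]; last by rewrite ge_min lexx orbT.
  apply: (@intg_ae_le _ (fun w => `|f w|)) (intg_norm If); first exact: measurable_minr.
  by apply: filterS fg => w fgw; rewrite min_l.
- exact: measurable_minr.
- by apply: filterS fg => w fgw; rewrite min_l.
Qed.

Variable J : R -> {RV P >-> R}.
Hypothesis subJ : subordinator J.
Hypothesis EJ1 : ('E_P[J 1%R] < 1)%E.
Local Notation inc := (increment (fun t => J t : Omega -> R)).

Let mJ t : measurable_fun setT (J t). Proof. exact: measurable_funP. Qed.

Lemma subordinator_ge0 : {ae P, forall w, forall t : R, 0 <= t -> 0 <= J t w}.
Proof.
apply: filterS (regular_path_ae subJ) => w [J0 Jmono] t t0.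
by rewrite -[leLHS]J0 Jmono.
Qed.

Let ae_ge0 t : 0 <= t -> {ae P, forall w, 0 <= J t w}.
Proof. by move=> t0; apply: filterS subordinator_ge0 => w; exact. Qed.

Let J1_intg : intg P (J 1).
Proof.
apply/integrableP; split; first exact/measurable_EFinP.
apply: (le_lt_trans _ (lt_trans EJ1 (ltry 1))).
rewrite unlock le_eqVlt; apply/orP; left; apply/eqP; apply: ae_eq_integral => //.
- by apply: measurableT_comp => //; exact/measurable_EFinP.
- exact/measurable_EFinP.
- by apply: filterS (ae_ge0 ler01) => w Jw _; rewrite /= ger0_norm.
Qed.

Lemma subordinator_intg t : 0 <= t -> intg P (J t).
Proof.
move=> t0; have Jn n : intg P (J n%:R).
  elim: n => [|n IH].
    apply: (@intg_ae_le _ (fun=> 0)); [by []| |exact: intg_cst].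
    by apply: filterS (subordinator_start subJ) => w ->; rewrite normr0.
  rewrite (_ : (J n.+1%:R : Omega -> R) = fun w => J n%:R w + (J n.+1%:R w - J n%:R w)).
    apply: intgD => //.
    apply: (@equal_law_intg _ _ _ _ (J 1) (fun w => J n.+1%:R w - J n%:R w) _ _ _ idfun) => //.
      exact: measurable_funB.
    move=> B mB; rewrite (increment_law subJ)// ?ler_nat//.
    by rewrite -natr1 addrAC subrr add0r.
    exact: measurable_id.
  by apply/funext => w; rewrite addrC subrK.
have [m tm] : exists m : nat, t <= m%:R.
  by exists (Num.truncn t).+1; rewrite ltW// truncnS_gt.
apply: intg_ae_le (Jn m) => //.
apply: filterS (regular_path_ae subJ) => w rw.
by rewrite ger0_norm ?rw.2// -rw.1 rw.2.
Qed.

Definition rate := E (J 1).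

Lemma rate_lt1 : rate < 1.
Proof.
by move: EJ1; rewrite unlock (_ : (fun w => _) = EFin \o J 1)// (E_EFin J1_intg) lte_fin.
Qed.

Lemma subordinator_mean t : 0 <= t -> E (J t) = t * rate.
Proof.
move=> t0; apply: (@additive_ge0_linear _ (fun t => E (J t))) => // [s u s0 u0|u u0].
  have Is := subordinator_intg s0; have Isu := subordinator_intg (addr_ge0 s0 u0).
  have -> : E (J u) = E (fun w => J (s + u) w - J s w).
    apply: (@equal_law_E _ _ _ _ (J u) (fun w => J (s + u) w - J s w) _ _ _ idfun) => //.
    - exact: measurable_funB.
    - by move=> B mB; rewrite (increment_law subJ)// ?lerDl// addrAC subrr add0r.
    - exact: measurable_id.
  by rewrite E_B// subrKC.
rewrite -(E_cst P 0); apply: E_ae_le (ae_ge0 u0); [exact: intg_cst|exact: subordinator_intg].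
Qed.

End mean.

Section almost_every.
Context d (Omega : measurableType d) (R : realType) (P : probability Omega R).

Lemma invS_lt (e : R) : 0 < e -> exists p : nat, p.+1%:R^-1 < e.
Proof.
move=> e0; exists (Num.truncn e^-1).
by rewrite invf_plt ?posrE// truncnS_gt.
Qed.

(** Monotonicity in [e] reduces uncountably many exceptional sets to those of [e = (p + 1)^-1]. *)
Lemma ae_forall_gt0 (Q : R -> Omega -> Prop) :
  (forall e e' w, e <= e' -> Q e w -> Q e' w) ->
  (forall e, 0 < e -> {ae P, forall w, Q e w}) ->
  {ae P, forall w, forall e, 0 < e -> Q e w}.
Proof.
move=> Qmono Qae.
have : {ae P, forall w, forall p : nat, Q p.+1%:R^-1 w}.
  by apply: ae_foralln => p; apply: Qae; rewrite invr_gt0.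
apply: filterS => w Qw e e0; have [p pe] := invS_lt e0.
by apply: Qmono (Qw p); exact: ltW.
Qed.

End almost_every.

Section gt_indicator.
Context d (Omega : measurableType d) (R : realType).

Lemma measurable_gt_indicator (x : R) (f : Omega -> R) : measurable_fun setT f ->
  measurable_fun setT (fun w => (x < f w)%R%:R : R).
Proof.
move=> mf; rewrite (_ : (fun w => _) = fun w => if x < f w then 1 else 0).
  by apply: measurable_fun_ifT => //; exact: measurable_fun_ltr.
by apply/funext => w; case: ifP.
Qed.

End gt_indicator.

(** * Negative drift of the net input *)

Section drift.
Context d (Omega : measurableType d) (R : realType) (P : probability Omega R).
Local Notation E := (Rintegral P setT).
Variable J : R -> {RV P >-> R}.
Hypothesis subJ : subordinator J.
Hypothesis EJ1 : ('E_P[J 1%R] < 1)%E.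
Local Notation inc := (increment (fun t => J t : Omega -> R)).
Local Notation rho := (rate J).
Variable Delta : R.
Hypothesis Delta0 : 0 < Delta.

Let mJ t : measurable_fun setT (J t). Proof. exact: measurable_funP. Qed.

Let ID : intg P (J Delta). Proof. exact: (subordinator_intg subJ EJ1 (ltW Delta0)). Qed.

Let JD0 : {ae P, forall w, 0 <= J Delta w}.
Proof. by apply: filterS (subordinator_ge0 subJ) => w; apply; exact: ltW. Qed.

Let excess (A x : R) : R := Num.max (x - A) 0.

Let mexcess A : measurable_fun setT (excess A).
Proof. by apply: measurable_maxr => //; exact: measurable_funB. Qed.

Let excess_small e : 0 < e -> exists2 A : R, 0 < A & E (excess A \o J Delta) < e.
Proof.
move=> e0.
have : E (excess n%:R \o J Delta) @[n --> \oo] --> E (fun=> 0).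
  apply: (@E_dominated _ _ _ P _ (fun=> 0) (fun w => `|J Delta w|)) => //.
  - by move=> n; apply: measurableT_comp (mJ _).
  - exact: intg_norm.
  - apply: aeW => w; apply: cvg_near_cst; near=> n.
    apply/max_idPr; rewrite subr_le0; near: n; exact: nbhs_infty_ger.
  - apply: aeW => w n; rewrite /= /excess ger0_norm ?le_max ?lexx ?orbT//.
    rewrite ge_max normr_ge0 andbT (le_trans _ (ler_norm _))//.
    by rewrite lerBlDr lerDl.
rewrite E_cst => /cvgr_lt /(_ _ e0) h.
near \oo => n; exists n%:R; last by near: n; exact: h.
by rewrite ltr0n; near: n; exact: nbhs_infty_gt.
Unshelve. all: by end_near. Qed.

(** The truncated increments obey the bounded law of large numbers with mean at most [Delta * rho],
    and the excess over a high level contributes little. The upper half of the law is all that the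
    negative drift and the Lyapunov sum use. *)
Lemma subordinator_upper_slln : {ae P, forall w, forall e, 0 < e ->
  \forall n \near \oo, J (n%:R * Delta) w <= n%:R * (Delta * rho + e)}.
Proof.
apply: ae_forall_gt0 => [e e' w ee'|e e0].
  by apply: filterS => n /le_trans; apply; rewrite ler_wpM2l// lerD2l.
(* Half of [e] goes to the excess, as [3 * (e / 6)]; the other half goes to the truncated part,
   whose average is taken within [e / (2 * A)] and multiplied by [A]. *)
have e60 : 0 < e / 6 by rewrite divr_gt0.
have [A A0 EA] := excess_small e60.
pose f (x : R) := Num.min (Num.max x 0) A / A.
have f01 x : 0 <= f x <= 1.
  rewrite divr_ge0 ?(ltW A0)//= ?le_min ?le_max ?lexx ?orbT ?(ltW A0)//.
  by rewrite ler_pdivrMr// mul1r ge_min lexx orbT.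
have mf : measurable_fun setT f.
  apply: measurable_funM => //; apply: measurable_minr => //.
  exact: measurable_maxr.
have split_le x : x <= A * f x + excess A x.
  rewrite /f /excess mulrC divfK ?gt_eqF//.
  have [xA|xA] := leP x A.
    rewrite min_l ?ge_max ?xA ?(ltW A0)//; have := le_max x x 0; rewrite lexx /=.
    have : 0 <= Num.max (x - A) 0 by rewrite le_max lexx orbT.
    by move=> h1 h2; rewrite -[leLHS]addr0 lerD.
  rewrite min_r ?le_max ?(ltW xA)// max_l ?subr_ge0 ?(ltW xA)//.
  by rewrite addrC subrK.
have Af : A * E (f \o J Delta) <= Delta * rho.
  rewrite -(subordinator_mean subJ EJ1 (ltW Delta0)) -E_Z; last first.
    apply: (@intg_bounded _ _ _ _ _ 1); first exact: measurableT_comp mf (mJ _).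
    by move=> w; rewrite ger0_norm; have /andP[] := f01 (J Delta w).
  apply: E_ae_le => //.
    apply: intgZ; apply: (@intg_bounded _ _ _ _ _ 1); first exact: measurableT_comp mf (mJ _).
    by move=> w; rewrite ger0_norm; have /andP[] := f01 (J Delta w).
  apply: filterS JD0 => w Jw; rewrite /f /= mulrC divfK ?gt_eqF//.
  by rewrite ge_min max_l// lexx.
have minc := @measurable_increment _ _ _ P J Delta.
have incind i j : (i < j)%N -> independent_maps P (inc Delta i) (inc Delta j).
  move=> ij; apply: (adapted_independent minc (increment_independent subJ (ltW Delta0)) _
    (adapted_process (D := [set i]) _) (adapted_process (D := [set j]) _)) => //.
  by apply/seteqP; split => k //= -[-> ije]; rewrite ije ltnn in ij.
have inclaw k B : measurable B -> P (inc Delta k @^-1` B) = P (J Delta @^-1` B).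
  exact: (mesh_increment_law subJ _ (ltW Delta0)).
have Iex : intg P (excess A \o J Delta).
  apply: (@intg_le _ _ _ _ _ (fun w => `|J Delta w|)).
  - by apply: measurableT_comp (mJ _).
  - move=> w; rewrite /= /excess ger0_norm ?le_max ?lexx ?orbT//.
    rewrite ge_max normr_ge0 andbT (le_trans _ (ler_norm _))//.
    by rewrite lerBlDr lerDl ltW.
  - exact: intg_norm.
have h1 := increment_window_slln subJ Delta0 1 mf f01.
have h2 : {ae P, forall w, \forall n \near \oo,
    n%:R^-1 * (\sum_(k < n) excess A (inc Delta k w)) <= 3 * (e / 6)}.
  apply: l1_averages_bounded => //.
  - by move=> k B mB; rewrite !inclaw.
  - by move=> x; rewrite /excess le_max lexx orbT.
  - apply: (@equal_law_intg _ _ _ _ (J Delta) (inc Delta 0)) => //.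
    by move=> B mB; rewrite inclaw.
  - rewrite -(@equal_law_E _ _ _ _ (J Delta) (inc Delta 0))//.
    by move=> B mB; rewrite inclaw.
have eA : 0 < e / (2 * A) by rewrite divr_gt0// mulr_gt0.
apply: filterS3 (subordinator_start subJ) h1 h2 => w J0 h1 h2.
rewrite mul1r in h1.
have {}h1 := cvgr_lt _ h1.
near=> n.
have n0 : 0 < n%:R :> R by rewrite ltr0n; near: n; exact: nbhs_infty_gt.
have h3 : n%:R^-1 * (\sum_(k < n) f (J ((k + 1)%:R * Delta) w - J (k%:R * Delta) w))
    < E (f \o J Delta) + e / (2 * A).
  by near: n; apply: h1; rewrite ltrDl.
have h4 : n%:R^-1 * (\sum_(k < n) excess A (inc Delta k w)) <= 3 * (e / 6).
  by near: n.
have -> : J (n%:R * Delta) w = \sum_(k < n) inc Delta k w.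
  elim: (n) => [|k IH]; first by rewrite big_ord0 mul0r.
  by rewrite big_ord_recr/= -IH subrKC.
rewrite -ler_pdivrMl//; set u := \sum_(k < n) f _ in h3; set v := \sum_(k < n) _ in h4.
apply: (@le_trans _ _ (n%:R^-1 * (A * u + v))).
  rewrite ler_pM2l ?invr_gt0// /u /v mulr_sumr -big_split/=; apply: ler_sum => k _.
  by rewrite addn1; exact: split_le.
have : A * (n%:R^-1 * u) <= A * (E (f \o J Delta) + e / (2 * A)).
  by rewrite ler_pM2l// ltW.
have -> : A * (E (f \o J Delta) + e / (2 * A)) = A * E (f \o J Delta) + e / 2.
  by field; rewrite gt_eqF.
by rewrite mulrDr (mulrCA n%:R^-1) => h; lra.
Unshelve. all: by end_near. Qed.

Lemma net_cvg_ninfty : {ae P, forall w, forall c : R,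
  \forall n \near \oo, net (fun t => J t : Omega -> R) (n%:R * Delta) w <= c}.
Proof.
have e0 : 0 < Delta * (1 - rho) / 2.
  by rewrite divr_gt0// mulr_gt0// subr_gt0 (rate_lt1 subJ EJ1).
apply: filterS subordinator_upper_slln => w /(_ _ e0) h c.
near=> n.
have : J (n%:R * Delta) w <= n%:R * (Delta * rho + Delta * (1 - rho) / 2) by near: n.
have : `|c| / (Delta * (1 - rho) / 2) <= n%:R by near: n; exact: nbhs_infty_ger.
rewrite ler_pdivrMr// /net => h1 h2; rewrite lerBlDr (le_trans h2)//.
have := ler_norm (- c); rewrite normrN => h3; lra.
Unshelve. all: by end_near. Qed.

Lemma net_tail_cvg c :
  E (fun w => (m%:R * Delta + c < J (m%:R * Delta) w)%R%:R) @[m --> \oo] --> 0.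
Proof.
rewrite -[0](E_cst P); apply: (@E_bounded_cvg _ _ _ P _ (fun=> 0) 1) => //.
- by move=> m; exact: measurable_gt_indicator.
- by move=> m w; case: (_ < _); rewrite ?normr1 ?normr0.
- apply: filterS net_cvg_ninfty => w /(_ c) h; apply: cvg_near_cst.
  apply: filterS h => m; rewrite /net lerBlDr addrC => h.
  by rewrite ltNge h.
Qed.

End drift.

(** * Laplace exponent and Laplace transform *)

Section levy_integral.
Context (R : realType) (nu : {measure set (measurableTypeR R) -> \bar R}).
Hypothesis lnu : levy_measure nu.

Definition laplace_exponent (theta : R) : R :=
  \int[nu]_(x in `]0, +oo[) (1 - expR (- theta * x)).

Local Notation D := ([set` `]0%R, +oo[] : set (measurableTypeR R)).

Let mE theta : measurable_fun D (fun x : R => (1 - expR (- theta * x))%:E).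
Proof.
apply/measurable_EFinP; apply: measurable_funS (_ : measurable_fun setT _) => //.
apply: measurable_funB => //; apply: continuous_measurable_fun => x.
apply: continuous_comp; last exact: continuous_expR.
by apply: cvgMr; exact: cvg_id.
Qed.

Let min_integrable : nu.-integrable D (fun x : R => (Num.min 1 x)%:E).
Proof.
apply/integrableP; split.
  by apply/measurable_EFinP; apply: measurable_minr => //; exact: measurable_id.
apply: le_lt_trans lnu.2; apply: ge0_le_integral => //.
- apply: measurableT_comp => //.
  by apply/measurable_EFinP; apply: measurable_minr => //; exact: measurable_id.
- by apply/measurable_EFinP; apply: measurable_minr => //; exact: measurable_id.
- move=> x /=; rewrite in_itv/= andbT => x0.
  by rewrite ger0_norm// le_min ler01 ltW.
Qed.

Lemma one_sub_expR_bounds (theta x : R) : 0 <= theta -> 0 <= x ->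
  0 <= 1 - expR (- theta * x) <= Num.min 1 (theta * x).
Proof.
move=> theta0 x0; rewrite subr_ge0 -expR0 ler_expR mulNr oppr_le0 mulr_ge0//=.
rewrite expR0 le_min gerBl expR_ge0/=.
by have := expR_ge1Dx (- (theta * x)); lra.
Qed.

Let exp_integrable theta : 0 <= theta ->
  nu.-integrable D (fun x : R => (1 - expR (- theta * x))%:E).
Proof.
move=> theta0; apply: (@le_integrable _ _ _ nu D _ _
    (fun x => (Num.max 1 theta)%:E * (Num.min 1 x)%:E)%E) => //.
  move=> x /=; rewrite in_itv/= andbT => x0; rewrite lee_fin.
  have /andP[h0 h1] := one_sub_expR_bounds theta0 (ltW x0).
  rewrite ger0_norm// (le_trans h1)// ger0_norm; last first.
    by rewrite mulr_ge0// ?le_max ?ler01// le_min ler01 ltW.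
  rewrite minr_pMr ?le_max ?ler01// mulr1 le_min !ge_min le_max lexx/=.
  by rewrite (ler_wpM2r (ltW x0)) ?orbT// le_max lexx orbT.
exact: integrableZl.
Qed.

(* The absence of a drift enters here: [E exp (- J h / h)] tends to 1. *)
Lemma laplace_exponent_sublinear (h : nat -> R) : (forall n, 0 < h n <= 1) ->
  h n @[n --> \oo] --> 0 -> h n * laplace_exponent (h n)^-1 @[n --> \oo] --> 0.
Proof.
move=> h01 h0.
pose f n (x : R) := h n * (1 - expR (- (h n)^-1 * x)).
have hE n : h n * laplace_exponent (h n)^-1 = \int[nu]_(x in D) f n x.
  rewrite /f RintegralZl//; apply: exp_integrable.
  by have /andP[/ltW + _] := h01 n; rewrite invr_ge0.
under eq_fun do rewrite hE.
have fb n x : 0 < x -> 0 <= f n x <= Num.min (h n) x.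
  have /andP[hn0 _] := h01 n; move=> x0.
  have hi : 0 <= (h n)^-1 by rewrite invr_ge0 ltW.
  have /andP[a b] := one_sub_expR_bounds hi (ltW x0).
  have -> : Num.min (h n) x = h n * Num.min 1 ((h n)^-1 * x).
    by rewrite minr_pMr ?(ltW hn0)// mulr1 mulrA divff ?gt_eqF// mul1r.
  by rewrite mulr_ge0 ?(ltW hn0)//= ler_pM2l.
have mf n : measurable_fun D (fun x => (f n x)%:E).
  apply/measurable_EFinP; apply: measurable_funM => //.
  by apply/measurable_EFinP; exact: mE.
have [|||] := @dominated_convergence _ _ _ nu D (measurable_itv _)
  (fun n x => (f n x)%:E) (fun=> 0%E) (fun x => (Num.min 1 x)%:E) mf
  (measurable_cst _).
- apply: aeW => x /=; rewrite in_itv/= andbT => x0.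
  apply: cvg_EFin; first exact: nearW.
  apply: (@squeeze_cvgr _ _ _ _ (fun=> 0) h); [|exact: cvg_cst|exact: h0].
  near=> n; have /andP[-> h1] := fb n x x0; rewrite (le_trans h1)//.
  by rewrite ge_min lexx.
- exact: min_integrable.
- apply: aeW => x n /=; rewrite in_itv/= andbT => x0.
  have /andP[a b] := fb n x x0; rewrite lee_fin ger0_norm// (le_trans b)//.
  by rewrite le_min !ge_min lexx orbT; have /andP[_ ->] := h01 n.
move=> _ _; rewrite integral0 => cv.
by apply: (fine_cvg (a := 0)); exact: cv.
Unshelve. all: by end_near. Qed.

End levy_integral.

Definition exp_test (R : realType) (theta x : R) : R := Num.min 1 (expR (- theta * x)).

Lemma exp_testE (R : realType) (theta x : R) : 0 <= theta -> 0 <= x ->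
  exp_test theta x = expR (- theta * x).
Proof.
move=> theta0 x0; rewrite /exp_test min_r// -expR0 ler_expR.
by rewrite mulNr oppr_le0 mulr_ge0.
Qed.

Section laplace.
Context d (Omega : measurableType d) (R : realType) (P : probability Omega R).
Local Notation E := (Rintegral P setT).
Variables (J : R -> {RV P >-> R}) (nu : {measure set (measurableTypeR R) -> \bar R}).
Hypothesis dsJ : driftless_subordinator J nu.

Let subJ : subordinator J. Proof. by case: dsJ. Qed.
Let mJ t : measurable_fun setT (J t). Proof. exact: measurable_funP. Qed.

Variable theta : R.
Hypothesis theta0 : 0 <= theta.
Let te : test_function (exp_test theta) := test_expR theta0.
Let L t := E (exp_test theta \o J t).

Let exp_test_gt0 x : 0 < exp_test theta x.
Proof. by rewrite lt_min ltr01 expR_gt0. Qed.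

Let LD s t : 0 <= s -> 0 <= t -> L (s + t) = L s * L t.
Proof.
move=> s0 t0.
(* The times 0, [s], [s + t], constant afterwards, so that the first two increments are the
   independent pieces of [J (s + t)]. *)
pose u n : R := if n is n'.+1 then if n' is n''.+1 then s + t else s else 0.
have u_mono : {homo u : m n / (m <= n)%N >-> m <= n}.
  move=> [|[|m]] [|[|n]]//=; rewrite ?lerDl// => _; exact: addr_ge0.
pose X i w := J (u i.+1) w - J (u i) w.
have mX i : measurable_fun setT (X i) by exact: measurable_funB.
have indX : mutually_independent P X.
  exact: (subordinator_independent_increments subJ (lexx _) u_mono).
have ind : independent_maps P (X 0%N) (X 1%N).
  apply: (adapted_independent mX indX _ (adapted_process (D := [set 0%N]) _)
     (adapted_process (D := [set 1%N]) _)) => //.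
  by apply/seteqP; split => k //= -[->].
have me := test_measurable te.
have EX i r : (i < 2)%N -> u i.+1 - u i = r -> E (exp_test theta \o X i) = L r.
  move=> i2 <-; apply: (@equal_law_E _ _ _ _ (X i) (J (u i.+1 - u i))) => //.
  move=> B mB; apply: increment_law => //; last exact: u_mono.
  by case: i i2 => [|[|]]//=.
rewrite -(EX 0%N s)//= ?subr0// -(EX 1%N t)//=; last by rewrite addrAC subrr add0r.
rewrite -(@independent_expectation _ _ _ _ _ _ _ _ 1)//; last 2 first.
- by move=> x; exact: test_norm.
- by move=> x; exact: test_norm.
apply: E_ae.
- exact: measurableT_comp me (mJ _).
- by apply: measurable_funM; exact: measurableT_comp me (mX _).
- apply: filterS (regular_path_ae subJ) => w rw.
  have st0 := addr_ge0 s0 t0; have sst : s <= s + t by rewrite lerDl.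
  rewrite /X /= !exp_testE//.
  + by rewrite -expRD rw.1; congr expR; ring.
  + by rewrite subr_ge0 rw.2.
  + by rewrite rw.1 subr0 -rw.1 rw.2.
  + by rewrite -rw.1 rw.2.
Qed.

Let L1 : L 1 = expR (- laplace_exponent nu theta).
Proof.
have [_ _ /(_ _ theta0)] := dsJ; rewrite unlock => h.
apply: EFin_inj; rewrite -h -E_EFin; last first.
  by apply: (@intg_bounded _ _ _ _ _ 1); [exact: measurableT_comp (test_measurable te) (mJ _)|
    move=> w; exact: test_norm].
apply: ae_eq_integral => //.
- by apply/measurable_EFinP; exact: measurableT_comp (test_measurable te) (mJ _).
- apply/measurable_EFinP; apply: measurableT_comp => //.
  exact: measurable_funM.
- apply: filterS (subordinator_ge0 subJ) => w /(_ 1 ler01) J1 _.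
  by rewrite /= exp_testE.
Qed.

Let LX n : L n%:R = L 1 ^+ n.
Proof.
elim: n => [|n IH].
  rewrite expr0 -(E_cst P 1); apply: E_ae => //.
    exact: measurableT_comp (test_measurable te) (mJ _).
  apply: filterS (subordinator_start subJ) => w /= ->.
  by rewrite exp_testE// mulr0 expR0.
by rewrite -natr1 LD// IH exprSr.
Qed.

(** By multiplicativity a zero at [t] would propagate to every later integer, where [L] is a power
    of the positive number [L 1]. *)
Let L_gt0 t : 0 <= t -> 0 < L t.
Proof.
move=> t0; rewrite lt_neqAle eq_sym; apply/andP; split; last first.
  by apply: E_ge0 => w; exact: ltW (exp_test_gt0 _).
have [m tm] : exists m : nat, t <= m%:R.
  by exists (Num.truncn t).+1; rewrite ltW// truncnS_gt.
apply/eqP => Lt.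
have : L m%:R = 0 by rewrite -(subrK t m%:R) addrC LD ?subr_ge0// Lt mul0r.
by rewrite LX L1 => /eqP; rewrite expf_eq0 gt_eqF ?expR_gt0 ?andbF.
Qed.

(** The Levy-Khintchine formula is given at time 1 only; [- ln L] is additive and nonnegative, hence
    linear in time. *)
Lemma subordinator_laplace t : 0 <= t ->
  E (exp_test theta \o J t) = expR (- (t * laplace_exponent nu theta)).
Proof.
move=> t0; rewrite -/(L t).
have := @additive_ge0_linear _ (fun t => - ln (L t)) _ _ t t0.
rewrite L1 expRK opprK => <-.
- by rewrite opprK lnK// posrE L_gt0.
- by move=> s u s0 u0; rewrite LD// lnM ?posrE ?L_gt0// opprD.
- move=> u u0; rewrite oppr_ge0 ln_le0//.
  rewrite -[leRHS](E_cst P 1); apply: E_le => //.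
  + by apply: (@intg_bounded _ _ _ _ _ 1); [exact: measurableT_comp (test_measurable te) (mJ _)|
    move=> w; exact: test_norm].
  + exact: intg_cst.
  + by move=> w; have /andP[] := test_01 te (J u w).
Qed.

End laplace.

Section levy_exponent.
Context d (Omega : measurableType d) (R : realType) (P : probability Omega R).
Variables (J : R -> {RV P >-> R}) (nu : {measure set (measurableTypeR R) -> \bar R}).
Hypothesis dsJ : driftless_subordinator J nu.

Lemma levy_exponentE theta : 0 <= theta ->
  levy_exponent J theta = theta - laplace_exponent nu theta.
Proof.
move=> theta0; rewrite /levy_exponent unlock.
have -> : (\int[P]_w ((expR (- theta * net_input J 1 w))%:E) =
    (expR (theta - laplace_exponent nu theta))%:E)%E; last by rewrite /= expRK.
have [_ _ /(_ _ theta0)] := dsJ; rewrite unlock => h.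
rewrite expRD EFinM -h -ge0_integralZl//.
- by apply: eq_integral => w _; rewrite -EFinM -expRD; congr (expR _)%:E;
    rewrite /net_input; ring.
- apply/measurable_EFinP; apply: measurableT_comp => //.
  by apply: measurable_funM => //; exact: measurable_funP.
Qed.

End levy_exponent.

(** * Tightness and averages of the workload *)

Section lyapunov.
Context (R : realType).
Implicit Types (theta u : R).

(* [x + exp (- theta x) / theta] decreases when a negative [x] is reflected to 0. *)
Let lyapunov theta u : R := u + expR (- theta * u) / theta.

Let lyapunov_reflect theta u : 0 < theta ->
  lyapunov theta (Num.max u 0) <= lyapunov theta u.
Proof.
move=> theta0; have [u0|u0] := leP u 0; last by rewrite lexx.
rewrite /lyapunov mulr0 expR0 add0r mul1r -(ler_pM2r theta0) mulrDl !divfK ?gt_eqF//.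
rewrite mulVf ?gt_eqF//.
by have := expR_ge1Dx (- theta * u); lra.
Qed.

(** Reflection lowers the Lyapunov function, and the rest is an identity for the unreflected step.
    With [m] the mean of [exp_test theta y], the last term is centered and the coefficient before it
    is the damped drift. *)
Lemma lyapunov_step theta x y h m : 0 < theta -> 0 <= x -> 0 <= y ->
  Num.max (x + (y - h)) 0 + exp_test theta (Num.max (x + (y - h)) 0) / theta <=
  x + exp_test theta x / theta + (y - h) +
  (expR (theta * h) * m - 1) / theta * exp_test theta x +
  expR (theta * h) / theta * (exp_test theta x * (exp_test theta y - m)).
Proof.
move=> theta0 x0 y0; have t0 := ltW theta0.
rewrite !exp_testE ?le_max ?lexx ?orbT//.
apply: (le_trans (lyapunov_reflect (x + (y - h)) theta0)).
rewrite /lyapunov; have -> : expR (- theta * (x + (y - h))) =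
    expR (- theta * x) * (expR (- theta * y) * expR (theta * h)).
  by rewrite -!expRD; congr expR; ring.
rewrite le_eqVlt; apply/orP; left; apply/eqP; field.
by rewrite gt_eqF.
Qed.

End lyapunov.

Section tightness.
Context d (Omega : measurableType d) (R : realType) (P : probability Omega R).
Local Notation E := (Rintegral P setT).
Variable J : R -> {RV P >-> R}.
Hypothesis subJ : subordinator J.
Hypothesis EJ1 : ('E_P[J 1%R] < 1)%E.
Local Notation inc := (increment (fun t => J t : Omega -> R)).
Local Notation lind := (lindley (fun t => J t : Omega -> R)).
Local Notation rho := (rate J).
Variable Delta : R.
Hypothesis Delta0 : 0 < Delta.
Local Notation Lam := (lind Delta 0).
Let kappa := Delta * (1 - rho).

Let mJ t : measurable_fun setT (J t). Proof. exact: measurable_funP. Qed.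
Let minc k : measurable_fun setT (inc Delta k). Proof. exact: measurable_increment. Qed.
Let mLam n : measurable_fun setT (Lam n). Proof. exact: measurable_lindley. Qed.

Let kappa0 : 0 < kappa.
Proof. by rewrite mulr_gt0// subr_gt0 (rate_lt1 subJ EJ1). Qed.

Section fixed_theta.
Variable theta : R.
Hypothesis theta0 : 0 < theta.
Local Notation g := (exp_test theta).
Let tg : test_function g := test_expR (ltW theta0).
Let mg := test_measurable tg.
Let m := E (g \o J Delta).
Let c := (expR (theta * Delta) * m - 1) / theta.
Let Z k w := g (Lam k w) * (g (inc Delta k w) - m).

Let mgLam k : measurable_fun setT (g \o Lam k). Proof. exact: measurableT_comp mg (mLam k). Qed.

Let Ig (X : Omega -> R) : measurable_fun setT X -> intg P (g \o X).
Proof.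
move=> mX; apply: (@intg_bounded _ _ _ _ _ 1); first exact: measurableT_comp.
by move=> w; exact: test_norm.
Qed.

Let m01 : 0 <= m <= 1.
Proof.
apply/andP; split; first by apply: E_ge0 => w; have /andP[] := test_01 tg (J Delta w).
rewrite -[leRHS](E_cst P 1); apply: E_le; [exact: Ig|exact: intg_cst|move=> w].
by have /andP[] := test_01 tg (J Delta w).
Qed.

Let gm (x : R) : `|g x - m| <= 1.
Proof.
have /andP[a b] := m01; have /andP[a' b'] := test_01 tg x.
by rewrite ler_norml; apply/andP; split; lra.
Qed.

Let Zb k w : `|Z k w| <= 1.
Proof. by rewrite normrM mulr_ile1// ?test_norm. Qed.

Let mZ k : measurable_fun setT (Z k).
Proof.
apply: measurable_funM; first exact: mgLam.
by apply: measurable_funB => //; exact: measurableT_comp mg (minc k).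
Qed.

(** [Lam j] depends only on increments before [j], so the last factor of [Z j] is centered given
    everything else in the product. *)
Let ZZ i j : (i + 1 <= j)%N -> E (fun w => Z i w * Z j w) = 0.
Proof.
move=> ij; pose A w := Z i w * g (Lam j w).
pose H (z : R * R) : R := z.1 * (g z.2 - m).
have aL n : (n <= j)%N -> adapted (inc Delta) [set k | (k < j)%N] (Lam n).
  move=> nj; apply: adapted_sub (@adapted_lindley _ _ _ _ J Delta 0 n) => k.
  by rewrite /= add0n => kn; exact: leq_trans kn nj.
have ainc k : (k < j)%N -> adapted (inc Delta) [set k | (k < j)%N] (inc Delta k).
  by move=> kj; exact: adapted_process.
have aA : adapted (inc Delta) [set k | (k < j)%N] A.
  apply: measurable_funM; last exact: measurableT_comp mg (aL _ (leqnn j)).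
  rewrite addn1 in ij; apply: measurable_funM.
    exact: measurableT_comp mg (aL _ (ltnW ij)).
  by apply: measurable_funB => //; exact: measurableT_comp mg (ainc _ ij).
have mA : measurable_fun setT A := adapted_measurable minc aA.
have ind : independent_maps P A (inc Delta j).
  apply: (adapted_independent minc (increment_independent subJ (ltW Delta0)) _ aA
    (adapted_process (D := [set j]) _)) => //.
  by apply/seteqP; split => k //= -[+ kj]; rewrite kj ltnn.
have Ab w : `|A w| <= 1 by rewrite normrM mulr_ile1// ?test_norm.
have mH : measurable_fun setT H.
  apply: measurable_funM => //; apply: measurable_funB => //.
  exact: measurableT_comp mg _.
rewrite (_ : (fun w => _) = fun w => H (A w, inc Delta j w)); last first.
  by apply/funext => w; rewrite /H /A /Z /= !mulrA.
rewrite (independent_fubini mA (minc j) ind mH).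
- rewrite -[RHS](E_cst P 0); apply: eq_Rintegral => w _.
  rewrite /H /= E_Z; last by apply: intgB; [exact: Ig|exact: intg_cst].
  rewrite E_B; [|exact: Ig|exact: intg_cst].
  rewrite E_cst (@equal_law_E _ _ _ _ (inc Delta j) (J Delta))//; last first.
    by move=> B mB; rewrite (mesh_increment_law subJ _ (ltW Delta0)).
  by rewrite subrr mulr0.
- apply: (@intg_bounded _ _ _ _ _ 1).
    exact: measurableT_comp mH (measurable_fun_pair mA (minc j)).
  by move=> w; rewrite /H /= normrM mulr_ile1.
- move=> w; apply: (@intg_bounded _ _ _ _ _ 1).
    apply: measurable_funM => //; apply: measurable_funB => //.
    exact: measurableT_comp mg (minc j).
  by move=> w'; rewrite /H /= normrM mulr_ile1.
Qed.

Let drift_sum n w : regular_path (fun t => J t : Omega -> R) w ->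
  Lam n w + g (Lam n w) / theta <= theta^-1 + J (n%:R * Delta) w - n%:R * Delta +
    c * (\sum_(k < n) g (Lam k w)) + expR (theta * Delta) / theta * (\sum_(k < n) Z k w).
Proof.
move=> rw; elim: n => [|n IH].
  rewrite !big_ord0/= mul0r rw.1 exp_testE ?(ltW theta0)// mulr0 expR0; lra.
rewrite !big_ord_recr/= add0n.
apply: (le_trans (lyapunov_step _ m theta0 _ _)).
- exact: lindley_ge0.
- by apply: (increment_ge0 rw); exact: ltW.
have e : n.+1%:R * Delta = n%:R * Delta + Delta by rewrite -natr1 mulrDl mul1r.
rewrite -/c -/(Z n w) /increment; move: e IH.
move: (n.+1%:R * Delta) (n%:R * Delta) (J _ w) (J _ w) => N' N j' j e.
by rewrite e !mulrDr; set x := c * _; set y := c * _; set z := _ * Z _ _; lra.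
Qed.

Let slln_Z := weak_orthogonal_slln mZ Zb ZZ.

(** The Lyapunov function is nonnegative, so its accumulated drift cannot be very negative: the
    damped terms must compensate the loss [kappa] per step. *)
Lemma damped_average_ge : {ae P, forall w, forall e, 0 < e ->
  \forall n \near \oo, kappa - e <= c * (n%:R^-1 * (\sum_(k < n) g (Lam k w)))}.
Proof.
have := subordinator_upper_slln subJ EJ1 Delta0.
apply: filterS3 (regular_path_ae subJ) slln_Z => w rw sZ uJ e e0.
have e3 : 0 < e / 3 by rewrite divr_gt0.
have b0 : 0 < expR (theta * Delta) / theta by rewrite divr_gt0// expR_gt0.
have e3b : 0 < e / 3 / (expR (theta * Delta) / theta) by rewrite divr_gt0.
have hZ := cvgr_lt _ sZ _ e3b; have hJ := uJ _ e3.
near=> n.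
have n0 : 0 < n%:R :> R by rewrite ltr0n; near: n; exact: nbhs_infty_gt.
have h1 : n%:R^-1 * (\sum_(k < n) Z k w) < e / 3 / (expR (theta * Delta) / theta).
  by near: n; exact: hZ.
have h2 : J (n%:R * Delta) w <= n%:R * (Delta * rho + e / 3) by near: n.
have h3 : theta^-1 / (e / 3) <= n%:R by near: n; exact: nbhs_infty_ger.
rewrite ler_pdivrMr// in h3.
have h4 := drift_sum n rw.
have h5 : 0 <= Lam n w + g (Lam n w) / theta.
  rewrite addr_ge0 ?lindley_ge0// divr_ge0 ?(ltW theta0)//.
  by have /andP[] := test_01 tg (Lam n w).
rewrite ltr_pdivlMr// in h1.
set u := \sum_(k < n) g _ in h4 *; set v := \sum_(k < n) _ in h1 h4.
set b := expR _ / _ in h1 h4.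
have h6 : b * v <= n%:R * (e / 3) by rewrite ltW// mulrC -ltr_pdivrMl// mulrA.
rewrite mulrCA ler_pdivlMl// /kappa.
have -> : n%:R * (Delta * (1 - rho) - e) =
  n%:R * Delta - n%:R * (Delta * rho) - 3 * (n%:R * (e / 3)) by field.
rewrite mulrDr in h2; move: h2 h3 h4 h5 h6.
move: (n%:R * (Delta * rho)) (n%:R * Delta) (n%:R * (e / 3)) (b * v) (c * u) (J _ w).
by move=> *; lra.
Unshelve. all: by end_near. Qed.

End fixed_theta.

Let theta (p : nat) : R := p.+1%:R^-1.
Let theta_gt0 p : 0 < theta p. Proof. by rewrite invr_gt0. Qed.

Let cvg_expR_theta (x : R) : expR (theta p * x) @[p --> \oo] --> (1 : R).
Proof.
rewrite -expR0; apply: continuous_cvg; first exact: continuous_expR.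
by rewrite -(mul0r x); apply: cvgMl; exact: cvg_harmonic.
Qed.

Let slope_cvg (x : R) : 0 <= x ->
  (1 - exp_test (theta p) x) / theta p @[p --> \oo] --> x.
Proof.
move=> x0; apply: (@squeeze_cvgr _ _ _ _ (fun p => x * expR (theta p * - x)) (fun=> x)).
- near=> p; rewrite exp_testE ?(ltW (theta_gt0 _))// mulrN -mulNr.
  set y := expR _; have t0 := theta_gt0 p.
  have y0 : 0 < y by rewrite expR_gt0.
  have yE : y * expR (theta p * x) = 1 by rewrite /y -expRD mulNr addNr expR0.
  apply/andP; split.
    by rewrite ler_pdivlMr//; have := expR_ge1Dx (theta p * x);
      rewrite -(ler_pM2l y0) yE; lra.
  by rewrite ler_pdivrMr//; have := expR_ge1Dx (- theta p * x); rewrite -/y; lra.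
- by rewrite -[X in _ --> X]mulr1; apply: cvgMr; exact: cvg_expR_theta.
- exact: cvg_cst.
Unshelve. all: by end_near. Qed.

Let coefficient p := (expR (theta p * Delta) * E (exp_test (theta p) \o J Delta) - 1) / theta p.

(** If the coefficient is barely above [kappa], then [damped_average_ge] forces the average of
    [exp_test] close to 1, which is tightness. Letting [theta] tend to 0 achieves this by dominated
    convergence. *)
Let small_coefficient e : 0 < e -> exists p, coefficient p < kappa + e.
Proof.
move=> e0.
have ID : intg P (J Delta) := subordinator_intg subJ EJ1 (ltW Delta0).
have Ie p : intg P (exp_test (theta p) \o J Delta).
  have te : test_function (exp_test (theta p)) := test_expR (ltW (theta_gt0 p)).
  apply: (@intg_bounded _ _ _ _ _ 1); last by move=> w; exact: test_norm.
  exact: measurableT_comp (test_measurable te) (mJ _).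
have ms : E (fun w => (1 - exp_test (theta p) (J Delta w)) / theta p) @[p --> \oo] --> Delta * rho.
  rewrite -(subordinator_mean subJ EJ1 (ltW Delta0)).
  apply: (@E_dominated _ _ _ P _ _ (fun w => `|J Delta w|)) => //.
  - move=> p; apply: measurable_funM => //; apply: measurable_funB => //.
    exact: intg_measurable (Ie p).
  - exact: intg_norm.
  - apply: filterS (subordinator_ge0 subJ) => w /(_ _ (ltW Delta0)) J0.
    exact: slope_cvg.
  - apply: filterS (subordinator_ge0 subJ) => w /(_ _ (ltW Delta0)) J0 p.
    have t0 := theta_gt0 p; rewrite exp_testE// ?(ltW t0)//.
    have /andP[h1 h2] := one_sub_expR_bounds (ltW t0) J0.
    rewrite (ger0_norm J0) ger0_norm ?divr_ge0 ?(ltW t0)// ler_pdivrMr//.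
    by rewrite (le_trans h2)// ge_min mulrC lexx orbT.
have cv : Delta * expR (theta p * Delta) -
    E (fun w => (1 - exp_test (theta p) (J Delta w)) / theta p) @[p --> \oo] --> kappa.
  have -> : kappa = Delta * 1 - Delta * rho by rewrite /kappa; ring.
  apply: cvgB => //.
  by apply: cvgMr; exact: cvg_expR_theta.
have cv' := cvgr_lt _ cv _ (_ : kappa < kappa + e).
(* With [y = expR (theta * Delta)] the coefficient is [(y - 1) * m / theta - (1 - m) / theta], where
   [m <= 1] and [(y - 1) / theta <= Delta * y]. *)
near \oo => p; exists p; apply: le_lt_trans (_ : _ <= Delta * expR (theta p * Delta) -
    E (fun w => (1 - exp_test (theta p) (J Delta w)) / theta p)) _; last first.
  by near: p; apply: cv'; rewrite ltrDl.
have t0 := theta_gt0 p.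
have -> : E (fun w => (1 - exp_test (theta p) (J Delta w)) / theta p) =
    (1 - E (exp_test (theta p) \o J Delta)) / theta p.
  under eq_Rintegral do rewrite mulrC.
  rewrite E_Z; last by apply: intgB; [exact: intg_cst|exact: Ie].
  by rewrite (E_B (intg_cst _ _) (Ie p)) E_cst mulrC.
set m := E _; have m1 : m <= 1.
  rewrite -[leRHS](E_cst P 1); apply: E_le => //; first exact: intg_cst.
  by move=> w; rewrite ge_min lexx.
set y := expR (theta p * Delta); have y0 : 0 < y by exact: expR_gt0.
have hy : y - 1 <= theta p * Delta * y.
  have := expR_ge1Dx (- (theta p * Delta)); rewrite -(ler_pM2r y0) {2}/y -expRD addNr expR0.
  by move=> h; lra.
have y1 : 1 <= y by rewrite -expR0 ler_expR mulr_ge0 ?ltW.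
have hm : (y - 1) * m <= y - 1 by rewrite ler_piMr// subr_ge0.
rewrite /coefficient -/m -/y ler_pdivrMr// mulrBl divfK ?gt_eqF//.
by rewrite mulrAC [Delta * _]mulrC; lra.
Unshelve. all: by end_near. Qed.

Lemma lindley_tight : {ae P, forall w, forall e, 0 < e -> exists x : R,
  \forall n \near \oo, n%:R^-1 * (\sum_(k < n) ((x < Lam k w)%R%:R : R)) <= e}.
Proof.
apply: ae_forall_gt0 => [e e' w ee' [x h]|e e0].
  by exists x; apply: filterS h => n /le_trans; apply.
(* From [kappa - d' <= (kappa + d') * (1 - B / 2)] follows [kappa * B / 2 <= 2 * d'], that is
   [B <= e]. *)
pose d' := kappa * e / 4.
have d0 : 0 < d' by rewrite divr_gt0// mulr_gt0.
have [p cp] := small_coefficient d0.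
apply: filterS (damped_average_ge (theta_gt0 p)) => w /(_ _ d0) h.
exists p.+1%:R; near=> n.
have n0 : 0 < n%:R :> R by rewrite ltr0n; near: n; exact: nbhs_infty_gt.
have : kappa - d' <= coefficient p * (n%:R^-1 * (\sum_(k < n) exp_test (theta p) (Lam k w))).
  by near: n; exact: h.
set A := n%:R^-1 * _ => hA; set B := n%:R^-1 * _.
have t0 := theta_gt0 p.
(* The level [p.+1] is the inverse of [theta p]: above it the exponential is at most [expR (- 1)],
   hence at most one half. *)
have AB : A <= 1 - B / 2.
  rewrite /A /B lerBrDr -[_ * _ / 2]mulrA -mulrDr ler_pdivrMl// mulr1.
  rewrite mulr_suml -big_split/=.
  have -> : n%:R = \sum_(k < n) (1 : R) by rewrite sumr_const card_ord.
  apply: ler_sum => k _; have [xl|xl] := ltP p.+1%:R (Lam k w); last first.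
    by rewrite mul0r addr0 ge_min lexx.
  rewrite mul1r exp_testE ?lindley_ge0 ?(ltW t0)//.
  have : expR (- theta p * Lam k w) <= expR (- 1).
    by rewrite ler_expR mulNr lerN2 /theta ler_pdivlMl ?mulr1 ?ltW.
  have : expR (-1) * 2 <= 1 :> R.
    apply: (@le_trans _ _ (expR (-1) * expR 1)); last by rewrite -expRD addNr expR0.
    by rewrite ler_pM2l ?expR_gt0//; have := expR_ge1Dx (1 : R).
  lra.
have A0 : 0 <= A.
  rewrite mulr_ge0 ?invr_ge0 ?(ltW n0)//; apply: sumr_ge0 => k _.
  by rewrite le_min ler01 expR_ge0.
have h1 : coefficient p * A <= (kappa + d') * A by rewrite ler_wpM2r// ltW.
have h2 : (kappa + d') * A <= (kappa + d') * (1 - B / 2) by rewrite ler_pM2l// addr_gt0.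
have B0 : 0 <= B.
  by rewrite mulr_ge0 ?invr_ge0 ?(ltW n0)//; apply: sumr_ge0 => k _.
have h3 : kappa * (B / 2) <= kappa * (e / 2).
  have : 0 <= d' * B by rewrite mulr_ge0// ltW.
  by move: h1 h2 hA; rewrite /d' => *; lra.
by move: h3; rewrite ler_pM2l// ler_pM2r// invr_gt0.
Unshelve. all: by end_near. Qed.

End tightness.

Lemma shifted_averages (R : realType) (u : nat -> R) n m : (forall k, 0 <= u k <= 1) ->
  `|\sum_(k < n) u k - \sum_(k < n) u (k + m)%N| <= m%:R.
Proof.
move=> u01; elim: m => [|m IH].
  by under [X in _ - X]eq_bigr do rewrite addn0; rewrite subrr normr0.
have tele : \sum_(k < n) u (k + m)%N - \sum_(k < n) u (k + m.+1)%N = u m - u (n + m)%N.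
  elim: n {IH} => [|n IH]; first by rewrite !big_ord0 add0n !subrr.
  by rewrite !big_ord_recr/= addnS; move: IH; lra.
have h : `|u m - u (n + m)%N| <= 1.
  have /andP[a b] := u01 m; have /andP[a' b'] := u01 (n + m)%N.
  by rewrite ler_norml; apply/andP; split; lra.
have := ler_normD (\sum_(k < n) u k - \sum_(k < n) u (k + m)%N) (u m - u (n + m)%N).
rewrite -tele addrA subrK -natr1; rewrite -tele in h; lra.
Qed.

(** * The workload along the grid *)

Section skeleton.
Context d (Omega : measurableType d) (R : realType) (P : probability Omega R).
Local Notation E := (Rintegral P setT).
Variables J V : R -> {RV P >-> R}.
Hypothesis subJ : subordinator J.
Hypothesis EJ1 : ('E_P[J 1%R] < 1)%E.
Hypothesis wJV : workload J V.
Local Notation lind := (lindley (fun t => J t : Omega -> R)).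
Local Notation win := (window (fun t => J t : Omega -> R)).
Local Notation netJ := (net (fun t => J t : Omega -> R)).
Variable Delta : R.
Hypothesis Delta0 : 0 < Delta.
Local Notation W k := (V (k%:R * Delta)).

Lemma workload_path_ae : {ae P, forall w,
  [/\ regular_path (fun t => J t : Omega -> R) w, 0 <= V 0 w &
   forall t : R, 0 <= t ->
     V t w = netJ t w + Num.max (V 0 w) (- inf [set netJ s w | s in `[0, t]])]}.
Proof.
have [V0 _ pV] := wJV.
by apply: filterS3 (regular_path_ae subJ) V0 pV => w rw V0w pVw.
Qed.

Lemma workload_tight : {ae P, forall w, forall e, 0 < e -> exists x : nat,
  \forall n \near \oo, n%:R^-1 * (\sum_(k < n) ((x%:R < W k w)%R%:R : R)) <= e}.
Proof.
apply: filterS3 workload_path_ae (net_cvg_ninfty subJ EJ1 Delta0)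
  (lindley_tight subJ EJ1 Delta0) => w [rw V0 pV] netN tight e e0.
have e2 : 0 < e / 2 by rewrite divr_gt0.
(* From step [K] on the net input is below [- V 0 w]: the initial workload has been served, and the
   queue started empty bounds [V] up to the grid error [Delta]. *)
have [x hx] := tight _ e2; have [K _ hK] := netN (- V 0 w).
exists (Num.truncn (x + Delta)).+1; near=> n.
have n0 : 0 < n%:R :> R by rewrite ltr0n; near: n; exact: nbhs_infty_gt.
have h1 : n%:R^-1 * (\sum_(k < n) ((x < lind Delta 0 k w)%R%:R : R)) <= e / 2.
  by near: n; exact: hx.
have h2 : K%:R / (e / 2) <= n%:R by near: n; exact: nbhs_infty_ger.
rewrite ler_pdivrMr// in h2; rewrite ler_pdivrMl// in h1.
rewrite ler_pdivrMl//.
apply: (@le_trans _ _ (\sum_(k < n) ((x < lind Delta 0 k w)%R%:R + (k < K)%N%:R))).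
  apply: ler_sum => k _; have [kK|Kk] := ltnP k K.
    by rewrite (le_trans (_ : _ <= 1))// ?lern1 ?leq_b1// lerDr.
  rewrite addr0 ler_nat; have [xV|] := ltP _ (V _ w); last by [].
  rewrite /= lt0b -(ltrD2r Delta).
  apply: (lt_trans (truncnS_gt _)); apply: lt_le_trans xV _.
  have := @workload_le_lindley _ _ _ w rw (fun t => V t) pV Delta k Delta0 => /le_trans; apply.
  rewrite ge_max lexx andbT (@le_trans _ _ 0)//.
    by have := hK k Kk => /=; lra.
  by rewrite addr_ge0 ?lindley_ge0 ?ltW.
rewrite big_split/=.
have h3 : \sum_(k < n) ((k < K)%N%:R : R) <= K%:R.
  rewrite -natr_sum ler_nat; have -> : (\sum_(k < n) (k < K) = minn n K)%N.
    elim: (n) => [|j IH]; first by rewrite big_ord0 min0n.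
    by rewrite big_ord_recr/= IH; lia.
  exact: geq_minr.
by lra.
Unshelve. all: by end_near. Qed.

Variable f : R -> R.
Hypothesis tf : test_function f.
Local Notation s := (stationary_mean J Delta f).

Let tail x m := E (fun w => (m%:R * Delta - x%:R < J (m%:R * Delta) w)%R%:R).

Let tail_average x m : {ae P, forall w, n%:R^-1 *
  (\sum_(k < n) ((m%:R * Delta - x%:R < J ((k + m)%:R * Delta) w - J (k%:R * Delta) w)%R%:R : R))
    @[n --> \oo] --> tail x m}.
Proof.
have mg : measurable_fun setT (fun y : R => (m%:R * Delta - x%:R < y)%R%:R : R).
  exact: measurable_gt_indicator.
have := increment_window_slln subJ Delta0 m mg; apply => y.
by case: (_ < y); rewrite ?lexx ?ler01.
Qed.

Lemma workload_slln : {ae P, forall w,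
  n%:R^-1 * (\sum_(k < n) f (V (Delta * k%:R) w)) @[n --> \oo] --> s}.
Proof.
(* The level [x], and then the horizon [m], will depend on the path [w], so one null set has to
   serve all pairs of naturals. *)
have tails : {ae P, forall w, forall x m, n%:R^-1 *
  (\sum_(k < n) ((m%:R * Delta - x%:R < J ((k + m)%:R * Delta) w - J (k%:R * Delta) w)%R%:R : R))
    @[n --> \oo] --> tail x m}.
  by apply: ae_foralln => x; apply: ae_foralln => m; exact: tail_average.
have windows : {ae P, forall w, forall m,
    n%:R^-1 * (\sum_(k < n) f (win Delta k m w)) @[n --> \oo] --> E (f \o win Delta 0 m)}.
  by apply: ae_foralln => m; exact: window_slln.
have pathsw : {ae P, forall w, [/\ regular_path (fun t => J t : Omega -> R) w, 0 <= V 0 w,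
    (forall t : R, 0 <= t ->
      V t w = netJ t w + Num.max (V 0 w) (- inf [set netJ s w | s in `[0, t]])) &
    (forall m, n%:R^-1 * (\sum_(k < n) f (win Delta k m w)) @[n --> \oo]
      --> E (f \o win Delta 0 m))]}.
  by apply: filterS2 workload_path_ae windows => w [].
apply: filterS3 pathsw workload_tight tails => w [rw V0 pV wins] tight tails_w.
apply/cvgrPdist_le => e e0.
have d0 : 0 < e / 8 by rewrite divr_gt0.
have [x hx] := tight _ d0.
(* The horizon comes after the level: [m] must be long enough for the negative drift to absorb a
   workload [x]. *)
have [m [hm1 hm2 hm3]] : exists m, [/\ E (f \o win Delta 0 m) <= s + e / 8,
    s - e / 8 <= E (f \o win Delta 0 m) & tail x m <= e / 8].
  have cE := window_E_cvg subJ Delta0 tf.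
  have ct := net_tail_cvg subJ EJ1 Delta0 (- x%:R).
  near \oo => m; exists m; split; near: m.
  - by apply: (cvgr_le s cE); rewrite ltrDl.
  - by apply: (cvgr_ge s cE); rewrite ltrBlDr ltrDl.
  - by apply: (cvgr_le 0 ct).
near=> n.
have n0 : 0 < n%:R :> R by rewrite ltr0n; near: n; exact: nbhs_infty_gt.
have ni0 : 0 < n%:R^-1 :> R by rewrite invr_gt0.
have h1 : n%:R^-1 * (\sum_(k < n) ((x%:R < W k w)%R%:R : R)) <= e / 8.
  by near: n; exact: hx.
have h2 : n%:R^-1 * (\sum_(k < n) f (win Delta k m w)) <= E (f \o win Delta 0 m) + e / 8.
  by near: n; apply: (cvgr_le _ (wins m)); rewrite ltrDl.
have h3 : E (f \o win Delta 0 m) - e / 8 <= n%:R^-1 * (\sum_(k < n) f (win Delta k m w)).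
  by near: n; apply: (cvgr_ge _ (wins m)); rewrite ltrBlDr ltrDl.
have h4 : n%:R^-1 * (\sum_(k < n)
    ((m%:R * Delta - x%:R < J ((k + m)%:R * Delta) w - J (k%:R * Delta) w)%R%:R : R))
    <= tail x m + e / 8.
  by near: n; apply: (cvgr_le _ (tails_w x m)); rewrite ltrDl.
have h5 : m%:R / (e / 8) <= n%:R by near: n; exact: nbhs_infty_ger.
have {}h5 : n%:R^-1 * m%:R <= e / 8.
  by rewrite ler_pdivrMl// -ler_pdivrMr.
have Wmin k : win Delta k m w <= W (k + m)%N w.
  by rewrite (@workload_window_step _ _ _ w rw (fun t => V t) pV Delta k m Delta0) le_max lexx orbT.
have h6 : n%:R^-1 * (\sum_(k < n) f (W (k + m)%N w)) <=
    n%:R^-1 * (\sum_(k < n) f (win Delta k m w)).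
  rewrite ler_pM2l//; apply: ler_sum => k _; exact: (test_nonincreasing tf).
have h7 : n%:R^-1 * (\sum_(k < n) f (win Delta k m w)) <=
    n%:R^-1 * (\sum_(k < n) f (W (k + m)%N w)) +
    (n%:R^-1 * (\sum_(k < n) ((x%:R < W k w)%R%:R : R)) +
     n%:R^-1 * (\sum_(k < n)
      ((m%:R * Delta - x%:R < J ((k + m)%:R * Delta) w - J (k%:R * Delta) w)%R%:R : R))).
  rewrite -!mulrDr ler_pM2l// -!big_split/=; apply: ler_sum => k _.
  have /andP[f0 f1] := test_01 tf (win Delta k m w).
  have /andP[f0' f1'] := test_01 tf (W (k + m)%N w).
  have [xV|Vx] := ltP x%:R (W k w).
    by rewrite (le_trans f1)// addrC -addrA lerDl addr_ge0.
  have [xJ|Jx] := ltP (m%:R * Delta - x%:R) _.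
    by rewrite add0r (le_trans f1)// lerDr.
  rewrite !addr0 (@workload_window_step _ _ _ w rw (fun t => V t) pV Delta k m Delta0) max_r//.
  apply: (@le_trans _ _ 0); last by apply: (window_ge0 rw); exact: ltW.
  by move: Jx Vx; rewrite /net natrD; lra.
have h8 : `|n%:R^-1 * (\sum_(k < n) f (W k w)) - n%:R^-1 * (\sum_(k < n) f (W (k + m)%N w))| <= e / 8.
  rewrite -mulrBr normrM gtr0_norm// (le_trans _ h5)// ler_pM2l//.
  by apply: (@shifted_averages _ (fun k => f (W k w))) => k; exact: test_01.
rewrite (_ : \sum_(k < n) f (V (Delta * k%:R) w) = \sum_(k < n) f (W k w)); last first.
  by apply: eq_bigr => k _; rewrite mulrC.
move: h8; rewrite !ler_norml => /andP[h8 h9].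
by apply/andP; split; lra.
Unshelve. all: by end_near. Qed.

End skeleton.

(** * Identification of the limit *)

Section one_step.
Context (R : realType).

Lemma expR_second_order (x : R) : x <= 2^-1 -> 1 + x <= expR x <= 1 + x + 2 * x ^+ 2.
Proof.
move=> x2; rewrite expR_ge1Dx/=.
have h : expR x * (1 - x) <= 1.
  rewrite [leRHS](_ : _ = expR x * expR (- x)); last by rewrite -expRD subrr expR0.
  by rewrite ler_pM2l ?expR_gt0// expR_ge1Dx.
have x1 : 0 < 1 - x by lra.
rewrite -(ler_pM2r x1) (le_trans h)// -subr_ge0.
have -> : (1 + x + 2 * x ^+ 2) * (1 - x) - 1 = x ^+ 2 * (1 - 2 * x) by ring.
by rewrite mulr_ge0 ?sqr_ge0//; lra.
Qed.

(* The idle time of a grid cell that starts with an empty queue. *)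
Definition idle (h y : R) : R := Num.max (h - Num.max y 0) 0.

Lemma measurable_idle h : measurable_fun setT (idle h).
Proof.
apply: measurable_maxr => //; apply: measurable_funB => //.
by apply: measurable_maxr => //; exact: measurable_id.
Qed.

Lemma idle_bounds h y : 0 <= h -> 0 <= idle h y <= h.
Proof.
move=> h0; rewrite le_max lexx orbT/= ge_max h0 andbT gerBl.
by rewrite le_max lexx orbT.
Qed.

(** For [z = y / h >= 0] this is [min 1 z <= 2 * (1 - expR (- z))]. It reduces the mean idle time to
    the Laplace transform of [J h] at [h^-1]. *)
Lemma idle_ge h y : 0 < h -> h - 2 * h * (1 - exp_test h^-1 y) <= idle h y.
Proof.
move=> h0; have hi : 0 < h^-1 by rewrite invr_gt0.
have [y0|y0] := leP y 0.
  rewrite /idle (max_r y0) subr0 le_max; apply/orP; left.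
  by rewrite gerBl mulr_ge0 ?mulr_ge0 ?(ltW h0)// subr_ge0 ge_min lexx.
rewrite /idle (max_l (ltW y0)) exp_testE ?(ltW hi) ?(ltW y0)//.
set z := h^-1 * y; have yE : y = h * z by rewrite /z mulrA divff ?gt_eqF// mul1r.
have z0 : 0 < z by rewrite mulr_gt0.
rewrite mulNr -/z; set e := expR _; have e0 : 0 < e := expR_gt0 _.
have ez : e * (1 + z) <= 1.
  rewrite [leRHS](_ : _ = e * expR z); last by rewrite /e -expRD addNr expR0.
  by rewrite ler_pM2l// expR_ge1Dx.
rewrite le_max; have [z1|z1] := leP z 1.
  apply/orP; left; rewrite yE -subr_ge0.
  have -> : h - h * z - (h - 2 * h * (1 - e)) = h * (2 - 2 * e - z) by ring.
  rewrite mulr_ge0 ?(ltW h0)//.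
  have : z * (1 - z) >= 0 by rewrite mulr_ge0 ?(ltW z0)// subr_ge0.
  nra.
apply/orP; right; rewrite -subr_ge0.
have -> : 0 - (h - 2 * h * (1 - e)) = h * (1 - 2 * e) by ring.
rewrite mulr_ge0 ?(ltW h0)//; nra.
Qed.

(** With [u = x + y - h] the middle term is [expR (- alpha * u) - expR (- alpha * max u 0)]. It
    vanishes unless [u < 0], which forces [x <= h]; then it is at least [- alpha * u] and at most
    its value at [u = - h]. *)
Lemma one_step_bounds (alpha h x y : R) : 0 < alpha -> 0 < h -> 0 <= x -> 0 <= y ->
  alpha * ((x <= 0)%R%:R * idle h y) <=
    expR (alpha * h) * (exp_test alpha x * exp_test alpha y) -
      exp_test alpha (Num.max (x + (y - h)) 0)
    <= (expR (alpha * h) - 1) * (x <= h)%R%:R.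
Proof.
move=> a0 h0 x0 y0; have a0' := ltW a0.
rewrite (exp_testE a0' x0) (exp_testE a0' y0) exp_testE ?le_max ?lexx ?orbT//.
rewrite -!expRD; set u := x + (y - h).
have -> : alpha * h + (- alpha * x + - alpha * y) = - alpha * u by rewrite /u; ring.
have eh : 0 <= expR (alpha * h) - 1 by rewrite subr_ge0 -expR0 ler_expR mulr_ge0// ltW.
rewrite /idle (max_l y0); have [u0|u0] := leP 0 u.
  rewrite subrr mulr_ge0// andbT; have [x00|] := leP x 0; last by rewrite mul0r mulr0.
  rewrite mul1r max_r ?mulr0//; move: u0; rewrite /u; lra.
rewrite mulr0 expR0; have xh : x <= h by move: u0; rewrite /u; lra.
rewrite xh mulr1; apply/andP; split.
  have := expR_ge1Dx (- alpha * u); have [x00|_] := leP x 0.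
    have xE : x = 0 by apply/eqP; rewrite eq_le x00.
    rewrite mul1r max_l; last by move: u0; rewrite /u xE; lra.
    by rewrite /u xE; lra.
  have : alpha * u <= 0 by rewrite pmulr_rle0// ltW.
  by rewrite mul0r mulr0; lra.
rewrite lerB// ler_expR mulNr -mulrN ler_pM2l// /u; lra.
Qed.

End one_step.

Section identification.
Context d (Omega : measurableType d) (R : realType) (P : probability Omega R).
Local Notation E := (Rintegral P setT).
Variables (J : R -> {RV P >-> R}) (nu : {measure set (measurableTypeR R) -> \bar R}).
Hypothesis dsJ : driftless_subordinator J nu.
Local Notation inc := (increment (fun t => J t : Omega -> R)).
Local Notation lind := (lindley (fun t => J t : Omega -> R)).
Local Notation wing := (window_grid (fun t => J t : Omega -> R)).
Local Notation psi := (laplace_exponent nu).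

Let subJ : subordinator J. Proof. by case: dsJ. Qed.
Let lnu : levy_measure nu. Proof. by case: dsJ. Qed.
Let mJ t : measurable_fun setT (J t). Proof. exact: measurable_funP. Qed.

Let Itest (f : R -> R) (X : Omega -> R) : test_function f -> measurable_fun setT X ->
  intg P (f \o X).
Proof.
move=> tf mX; apply: (@intg_bounded _ _ _ _ _ 1).
  exact: measurableT_comp (test_measurable tf) mX.
by move=> w; exact: test_norm.
Qed.

Let idle_intg h X : 0 < h -> measurable_fun setT X -> intg P (idle h \o X).
Proof.
move=> h0 mX; apply: (@intg_bounded _ _ _ _ _ h).
  exact: measurableT_comp (measurable_idle h) mX.
by move=> w; have /andP[a b] := idle_bounds (X w) (ltW h0); rewrite ger0_norm.
Qed.

Let idle_mean_ge h : 0 < h -> h * (1 - 2 * (h * psi h^-1)) <= E (idle h \o J h).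
Proof.
move=> h0; have hi : 0 <= h^-1 by rewrite invr_ge0 ltW.
have te : test_function (exp_test h^-1) := test_expR hi.
have Ie := Itest te (mJ h).
have -> : h * (1 - 2 * (h * psi h^-1)) = h - 2 * h * (1 - (1 - h * psi h^-1)) by ring.
apply: (@le_trans _ _ (E (fun w => h - 2 * h * (1 - exp_test h^-1 (J h w))))).
  rewrite E_B; [|exact: intg_cst|apply: intgZ; apply: intgB; [exact: intg_cst|exact: Ie]].
  rewrite E_Z; last by apply: intgB; [exact: intg_cst|exact: Ie].
  rewrite (E_B (intg_cst _ _) Ie) !E_cst lerD2l lerN2 ler_pM2l ?mulr_gt0//.
  rewrite lerD2l lerN2 (subordinator_laplace dsJ hi (ltW h0)).
  by have := expR_ge1Dx (- (h * psi h^-1)).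
apply: E_le.
- apply: intgB; [exact: intg_cst|apply: intgZ; apply: intgB; [exact: intg_cst|exact: Ie]].
- exact: idle_intg.
- by move=> w; exact: idle_ge.
Qed.

Variables (alpha : R).
Hypothesis alpha0 : 0 < alpha.
Let te : test_function (exp_test alpha) := test_expR (ltW alpha0).
Let phi := alpha - psi alpha.

Section step.
Variable h : R.
Hypothesis h0 : 0 < h.
Let h0' := ltW h0.
Local Notation Lam := (lind h 0).
Let x n := E (exp_test alpha \o Lam n).
Let mLam n : measurable_fun setT (Lam n). Proof. exact: measurable_lindley. Qed.
Let minc k : measurable_fun setT (inc h k). Proof. exact: measurable_increment. Qed.

Let ind n : independent_maps P (Lam n) (inc h n).
Proof.
apply: (adapted_independent minc (increment_independent subJ h0') _
  (@adapted_lindley _ _ _ _ J h 0 n) (adapted_process (D := [set n]) _)) => //.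
by apply/seteqP; split => k //= -[+ kn]; rewrite kn add0n ltnn.
Qed.

Let inc_law n B : measurable B -> P (inc h n @^-1` B) = P (J h @^-1` B).
Proof. exact: (mesh_increment_law subJ n h0'). Qed.

(** In equilibrium [x n] and [x n.+1] would coincide. The inequality is kept for finite [n] instead,
    and [gap_small] removes the difference afterwards. *)
Lemma one_step_mean n :
  alpha * (E ((fun y => (y <= 0)%R%:R) \o Lam n) * (h * (1 - 2 * (h * psi h^-1)))) <=
    expR (h * phi) * x n - x n.+1
    <= (expR (alpha * h) - 1) * E ((fun y => (y <= h)%R%:R) \o Lam n).
Proof.
have ti y := test_indicator (y : R); have ti0 := ti 0; have tih := ti h.
have Ix k : intg P (exp_test alpha \o Lam k) by exact: Itest.
pose M w := expR (alpha * h) * (exp_test alpha (Lam n w) * exp_test alpha (inc h n w)) -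
  exp_test alpha (Lam n.+1 w).
have Iprod : intg P (fun w => exp_test alpha (Lam n w) * exp_test alpha (inc h n w)).
  apply: (@intg_bounded _ _ _ _ _ 1).
    apply: measurable_funM; first exact: measurableT_comp (test_measurable te) (mLam n).
    exact: measurableT_comp (test_measurable te) (minc n).
  by move=> w; rewrite normrM mulr_ile1// test_norm.
have IM : intg P M by apply: intgB; [exact: intgZ|exact: Ix].
have EM : E M = expR (h * phi) * x n - x n.+1.
  rewrite /M (E_B (intgZ _ Iprod) (Ix n.+1)) (E_Z _ Iprod); congr (_ - _).
  rewrite (@independent_expectation _ _ _ _ _ _ _ _ 1 (mLam n) (minc n) (ind n)
    (test_measurable te) (test_measurable te)); [|exact: (fun z => test_norm z te)..].
  rewrite (equal_law_E (minc n) (mJ h) (inc_law n) (test_measurable te)).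
  rewrite (subordinator_laplace dsJ (ltW alpha0) h0') -/(x n).
  have -> : expR (h * phi) = expR (alpha * h) * expR (- (h * psi alpha)).
    by rewrite -expRD /phi; congr expR; ring.
  by ring.
have Ii : intg P (fun w => (Lam n w <= 0)%R%:R * idle h (inc h n w)).
  apply: (@intg_bounded _ _ _ _ _ h).
    apply: measurable_funM; first exact: measurableT_comp (test_measurable ti0) (mLam n).
    exact: measurableT_comp (measurable_idle h) (minc n).
  move=> w; have /andP[a b] := idle_bounds (inc h n w) h0'.
  by rewrite normrM (ger0_norm a); case: (_ <= 0); rewrite ?normr1 ?normr0 ?mul1r ?mul0r.
have step : {ae P, forall w,
    alpha * ((Lam n w <= 0)%R%:R * idle h (inc h n w)) <= M w <=
    (expR (alpha * h) - 1) * (Lam n w <= h)%R%:R}.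
  apply: filterS (regular_path_ae subJ) => w rw.
  have := one_step_bounds alpha0 h0 (lindley_ge0 _ h 0 n w) (increment_ge0 rw n h0').
  by rewrite /M /=.
rewrite -EM; apply/andP; split.
  apply: (@le_trans _ _ (E (fun w => alpha * ((Lam n w <= 0)%R%:R * idle h (inc h n w))))).
    rewrite (E_Z _ Ii) ler_pM2l//.
    rewrite (@independent_expectation _ _ _ _ _ _ (fun y => (y <= 0)%R%:R) (idle h)
      (Num.max 1 h) (mLam n) (minc n) (ind n) (test_measurable ti0) (measurable_idle h)).
    + rewrite (equal_law_E (minc n) (mJ h) (inc_law n) (measurable_idle h)).
      rewrite ler_wpM2l ?idle_mean_ge//; apply: E_ge0 => w /=; exact: ler0n.
    + by move=> y; rewrite le_max (test_norm _ ti0).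
    + move=> y; have /andP[a b] := idle_bounds y h0'.
      by rewrite le_max (ger0_norm a) b orbT.
  apply: E_ae_le => //; first exact: intgZ.
  by apply: filterS step => w /andP[].
rewrite -E_Z; last exact: (Itest tih).
apply: E_ae_le => //; first by apply: intgZ; exact: (Itest tih).
by apply: filterS step => w /andP[].
Qed.

End step.

Variable Delta : R.
Hypothesis Delta0 : 0 < Delta.
Local Notation s := (stationary_mean J Delta).
Local Notation below y := (fun z : R => (z <= y)%R%:R : R).
Local Notation mean f q n := (E (f \o lind (mesh Delta q) 0 n)).

Let mesh_gt0 q : 0 < mesh Delta q. Proof. by rewrite divr_gt0// exprn_gt0. Qed.

Let near_stationary (f : R -> R) e : test_function f -> 0 < e ->
  \forall q \near \oo, \forall n \near \oo, s f <= mean f q n < s f + e.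
Proof.
move=> tf e0; have [q0 [m0 h]] := grid_near_stationary subJ Delta0 tf e0.
near=> q; have qq0 : (q0 <= q)%N by near: q; exact: nbhs_infty_ge.
near=> n; have nN : (m0 * 2 ^ q <= n)%N by near: n; exact: nbhs_infty_ge.
apply/andP; split.
  apply: le_trans (stationary_mean_le subJ Delta0 tf q n) _.
  rewrite /window_grid mul0n; apply: lindley_E_nonincreasing => //; first exact: ltW.
  by rewrite leq_pmulr// expn_gt0.
have /andP[_] := h q m0 qq0 (leqnn _); rewrite /window_grid mul0n; apply: le_lt_trans.
by apply: lindley_E_nonincreasing => //; exact: ltW.
Unshelve. all: by end_near. Qed.

(** A bounded monotone sequence has vanishing steps. The mesh is fixed while [n] grows, so the step
    can even be made small relative to the mesh width. *)
Let gap_small q e : 0 < e ->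
  \forall n \near \oo, mean (exp_test alpha) q n - mean (exp_test alpha) q n.+1 <= e.
Proof.
move=> e0; pose x n := mean (exp_test alpha) q n.
have x_ninc : nonincreasing_seq x.
  by move=> n m nm; apply: lindley_E_nonincreasing => //; exact: ltW.
have cx : cvgn x.
  apply: nonincreasing_is_cvgn => //; exists 0 => _ [n _ <-].
  by apply: E_ge0 => w; have /andP[] := test_01 te (lind (mesh Delta q) 0 n w).
have : x n - x n.+1 @[n --> \oo] --> limn x - limn x.
  by apply: cvgB => //; rewrite (cvg_shiftS x).
by rewrite subrr => /cvgr_le; apply.
Qed.

Let small_mesh e : 0 < e -> \forall q \near \oo, mesh Delta q <= e.
Proof. by move=> e0; exact: (cvgr_le 0 (@mesh_cvg0 _ Delta)). Qed.

Let small_drift e : 0 < e ->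
  \forall q \near \oo, mesh Delta q * psi (mesh Delta q)^-1 <= e.
Proof.
move=> e0; have [K _ hK] := small_mesh ltr01.
have h01 n : 0 < mesh Delta (n + K)%N <= 1 by rewrite mesh_gt0 hK//= leq_addl.
have cK : mesh Delta (n + K)%N @[n --> \oo] --> 0.
  by rewrite (cvg_shiftn K (mesh Delta)); exact: mesh_cvg0.
have := laplace_exponent_sublinear lnu h01 cK.
rewrite (cvg_shiftn K (fun n => mesh Delta n * psi (mesh Delta n)^-1)) => c0.
exact: (cvgr_le 0 c0).
Qed.

Let stationary_bounds e y : 0 < e -> 0 < y ->
  alpha * s (below 0) <= phi * s (exp_test alpha) + e * (`|phi| + alpha + 2) /\
  phi * s (exp_test alpha) <= alpha * s (below y) + e * (`|phi| + alpha + 2).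
Proof.
move=> e0 y0; have ti z := test_indicator (z : R).
have a0 := ltW alpha0.
have e2 : 0 < e / 2 by rewrite divr_gt0.
(* A mesh [h <= K^-1] ensures, for [c] equal to [phi] or [alpha], that [h * c <= 1 / 2] and that the
   second-order remainder [2 * (h * c) ^ 2] is at most [h * e]. *)
pose K := 2 * (`|phi| + alpha) + 2 * (phi ^+ 2 + alpha ^+ 2) / e + 1.
have K0 : 0 < K.
  by rewrite ltr_wpDl// addr_ge0 ?mulr_ge0 ?addr_ge0 ?sqr_ge0 ?invr_ge0// ltW.
have Ki : 0 < K^-1 by rewrite invr_gt0.
have near_q f : test_function f ->
    \forall q \near \oo, \forall n \near \oo, s f <= mean f q n < s f + e.
  by move=> tf; exact: near_stationary.
(* The mesh is fixed first, and the horizon [n] is taken large for that mesh. All errors must be of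
   order [h * e], since the final inequality is divided by [h]. *)
near \oo => q.
have hy : mesh Delta q <= y by near: q; exact: small_mesh.
have hK : mesh Delta q <= K^-1 by near: q; exact: small_mesh.
have hd : mesh Delta q * psi (mesh Delta q)^-1 <= e / 2 by near: q; exact: small_drift.
have n1 : \forall n \near \oo,
    s (exp_test alpha) <= mean (exp_test alpha) q n < s (exp_test alpha) + e.
  by near: q; exact: near_q te.
have n2 : \forall n \near \oo, s (below 0) <= mean (below 0) q n < s (below 0) + e.
  by near: q; exact: near_q (ti 0).
have n3 : \forall n \near \oo, s (below y) <= mean (below y) q n < s (below y) + e.
  by near: q; exact: near_q (ti y).
pose h := mesh Delta q; have h0 : 0 < h := mesh_gt0 q.
have n4 : \forall n \near \oo,
    mean (exp_test alpha) q n - mean (exp_test alpha) q n.+1 <= h * e.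
  by apply: gap_small; exact: mulr_gt0.
near \oo => n.
have /andP[x1 x2] : s (exp_test alpha) <= mean (exp_test alpha) q n < s (exp_test alpha) + e.
  by near: n.
have /andP[p1 _] : s (below 0) <= mean (below 0) q n < s (below 0) + e.
  by near: n.
have /andP[_ y2] : s (below y) <= mean (below y) q n < s (below y) + e.
  by near: n.
have g2 : mean (exp_test alpha) q n - mean (exp_test alpha) q n.+1 <= h * e.
  by near: n.
have g1 : 0 <= mean (exp_test alpha) q n - mean (exp_test alpha) q n.+1.
  by rewrite subr_ge0; apply: lindley_E_nonincreasing => //; exact: ltW.
have /andP[] := one_step_mean h0 n; rewrite -/h.
have mh : mean (below h) q n <= mean (below y) q n.
  apply: E_le => [||w]; [exact: Itest (measurable_lindley _ _ _ _)..|].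
  by rewrite /= ler_nat; case: (leP _ h) => // zh; rewrite (le_trans zh).
have test_mean f : test_function f -> 0 <= mean f q n <= 1.
  move=> tf; have f01 := test_01 tf; apply/andP; split.
    by apply: E_ge0 => w; have /andP[] := f01 (lind (mesh Delta q) 0 n w).
  rewrite -[leRHS](E_cst P 1); apply: E_le; [exact: Itest (measurable_lindley _ _ _ _)|
    exact: intg_cst|move=> w].
  by have /andP[] := f01 (lind (mesh Delta q) 0 n w).
have /andP[X0 X1] := test_mean _ te; have /andP[P0 P1] := test_mean _ (ti 0).
have /andP[U0 U1] := test_mean _ (ti y); have /andP[V0 _] := test_mean _ (ti h).
rewrite -/h in X0 X1 P0 P1 U0 U1 V0 x1 x2 p1 y2 g1 g2 mh *.
move: X0 X1 P0 P1 U0 U1 V0 x1 x2 p1 y2 g1 g2 mh.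
move: (E (exp_test alpha \o lind h 0 n)) (E (exp_test alpha \o lind h 0 n.+1)) => X X'.
move: (E (below 0 \o _)) (E (below y \o _)) (E (below h \o _)) => p u r.
move: (s (exp_test alpha)) (s (below 0)) (s (below y)) => se s0 sy.
move=> X0 X1 P0 P1 U0 U1 V0 x1 x2 p1 y2 g1 g2 mh lower upper.
rewrite -/h in hd; have hK1 : h * K <= 1 by rewrite -ler_pdivlMr// mul1r.
have order2 c : 2 * `|c| <= K -> 2 * c ^+ 2 / e <= K ->
    h * c <= expR (h * c) - 1 <= h * c + h * e.
  move=> c1 c2; have hc : h * c <= 2^-1.
    have : h * (2 * `|c|) <= 1 by apply: le_trans hK1; rewrite ler_pM2l.
    have : h * c <= h * `|c| by rewrite ler_pM2l// ler_norm.
    lra.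
  have /andP[l1 l2] := expR_second_order hc.
  have l3 : 2 * (h * c) ^+ 2 <= h * e.
    have : h * (2 * c ^+ 2 / e) <= 1 by apply: le_trans hK1; rewrite ler_pM2l.
    rewrite mulrA ler_pdivrMr// mul1r => l4.
    by rewrite (_ : 2 * _ = h * (h * (2 * c ^+ 2))) ?ler_pM2l//; ring.
  by apply/andP; split; lra.
have phi0 := normr_ge0 phi.
have sq c : 0 <= 2 * c ^+ 2 / e.
  by apply: divr_ge0; [apply: mulr_ge0 => //; exact: sqr_ge0|exact: ltW].
have KE : K = 2 * `|phi| + 2 * alpha + 2 * phi ^+ 2 / e + 2 * alpha ^+ 2 / e + 1.
  by rewrite /K; ring.
have /andP[f1 f2] : h * phi <= expR (h * phi) - 1 <= h * phi + h * e.
  by apply: order2; have := sq phi; have := sq alpha; rewrite KE; lra.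
have /andP[_ f3] : h * alpha <= expR (h * alpha) - 1 <= h * alpha + h * e.
  by apply: order2; have := sq phi; have := sq alpha; rewrite ?(gtr0_norm alpha0) KE; lra.
have phiX : `|phi * X - phi * se| <= `|phi| * e.
  by rewrite -mulrBr normrM ler_wpM2l// ger0_norm ?subr_ge0//; lra.
move: phiX; rewrite ler_norml => /andP[phiX1 phiX2].
split.
- have q1 : (expR (h * phi) - 1) * X <= (h * phi + h * e) * X by rewrite ler_wpM2r.
  have q2 : h * e * X <= h * e by rewrite ler_piMr// mulr_ge0// ltW.
  have q3 : alpha * (h * (s0 - e)) <= alpha * (p * (h * (1 - 2 * (h * psi h^-1)))).
    rewrite ler_pM2l// mulrCA ler_pM2l//.
    have : p * (1 - e) <= p * (1 - 2 * (h * psi h^-1)) by rewrite ler_wpM2l//; lra.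
    have : p * e <= e by rewrite ler_piMl// ltW.
    lra.
  have q4 : h * (alpha * (s0 - e)) <= h * (phi * X + 2 * e).
    by move: q1 q2 q3 lower; lra.
  move: q4; rewrite ler_pM2l//; lra.
- have q1 : h * phi * X <= (expR (h * phi) - 1) * X by rewrite ler_wpM2r.
  have q2 : (expR (alpha * h) - 1) * r <= (h * alpha + h * e) * r.
    by rewrite ler_wpM2r// [alpha * h]mulrC.
  have q3 : h * e * r <= h * e by rewrite ler_piMr ?(le_trans mh)// mulr_ge0// ltW.
  have q4 : h * (phi * X) <= h * (alpha * r + e) by move: q1 q2 q3 upper; lra.
  move: q4; rewrite ler_pM2l// => q4.
  have q5 : alpha * r <= alpha * (sy + e) by rewrite ler_pM2l//; lra.
  lra.
Unshelve. all: by end_near. Qed.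

Let le_of_vanishing (a b C : R) : 0 < C -> (forall e, 0 < e -> a <= b + e * C) -> a <= b.
Proof.
move=> C0 h; apply/ler_addgt0Pr => e e0.
by have := h (e / C); rewrite divfK ?gt_eqF//; apply; rewrite divr_gt0.
Qed.

(** [s] is an infimum of mesh means, each right-continuous in the threshold: a mesh and horizon
    nearly optimal at threshold 0 stay nearly optimal at a small [y]. *)
Let below_continuity e : 0 < e -> exists2 y, 0 < y & s (below y) <= s (below 0) + e.
Proof.
move=> e0; have ti z := test_indicator (z : R).
have e2 : 0 < e / 2 by rewrite divr_gt0.
have [q [m qm]] := stationary_mean_approx subJ Delta0 (ti 0) e2.
pose y (j : nat) : R := j.+1%:R^-1.
have cv : E (below (y j) \o wing Delta q 0 m) @[j --> \oo] --> E (below 0 \o wing Delta q 0 m).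
  apply: (@E_bounded_cvg _ _ _ P _ _ 1).
  - move=> j; exact: measurableT_comp (test_measurable (ti _)) (measurable_window_grid _ _ _ _ _).
  - exact: measurableT_comp (test_measurable (ti _)) (measurable_window_grid _ _ _ _ _).
  - by move=> j w; exact: test_norm (ti _).
  - apply: aeW => w /=; set z := wing Delta q 0 m w; apply: cvg_near_cst.
    have z0 : 0 <= z by exact: window_grid_ge0.
    have [zp|zn] := ltP 0 z.
      have : \forall j \near \oo, y j < z by exact: (cvgr_lt 0 cvg_harmonic).
      by apply: filterS => j jz; rewrite (lt_geF jz).
    by apply: nearW => j; rewrite (le_trans zn) ?invr_ge0.
have cv' : \forall j \near \oo, E (below (y j) \o wing Delta q 0 m) <=
    E (below 0 \o wing Delta q 0 m) + e / 2.
  by apply: (cvgr_le _ cv); rewrite ltrDl.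
near \oo => j; exists (y j); first by rewrite invr_gt0.
apply: le_trans (stationary_mean_le subJ Delta0 (ti (y j)) q m) _.
have : E (below (y j) \o wing Delta q 0 m) <= E (below 0 \o wing Delta q 0 m) + e / 2.
  by near: j; exact: cv'.
lra.
Unshelve. all: by end_near. Qed.

Lemma stationary_identity : phi * s (exp_test alpha) = alpha * s (below 0).
Proof.
have C0 : 0 < `|phi| + alpha + 2 by rewrite ltr_wpDl// addr_ge0// ltW.
apply/eqP; rewrite eq_le; apply/andP; split.
  apply: (@le_of_vanishing _ _ alpha) => // e e0.
  have [y y0 hy] := below_continuity e0.
  apply: (@le_of_vanishing _ _ _ C0) => e' e'0.
  have [_ h] := stationary_bounds e'0 y0; apply: (le_trans h).
  by rewrite lerD2r [e * _]mulrC -mulrDr ler_pM2l.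
by apply: (@le_of_vanishing _ _ _ C0) => e e0; have [] := stationary_bounds e0 ltr01.
Qed.

End identification.

Section estimator_limit.
Context d (Omega : measurableType d) (R : realType) (P : probability Omega R).
Variables J V : R -> {RV P >-> R}.
Hypothesis subJ : subordinator J.
Hypothesis EJ1 : ('E_P[J 1%R] < 1)%E.
Hypothesis wJV : workload J V.
Variables Delta alpha : R.
Hypotheses (Delta0 : 0 < Delta) (alpha0 : 0 < alpha).
Local Notation s := (stationary_mean J Delta).

(** By tightness the workload stays below some [x] on at least half of the grid in the long run,
    which keeps the averages above [expR (- alpha * x) / 2]. *)
Lemma stationary_exp_gt0 : 0 < s (exp_test alpha).
Proof.
have te : test_function (exp_test alpha) := test_expR (ltW alpha0).
have : {ae P, forall w, 0 < s (exp_test alpha)}.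
  apply: filterS2 (workload_slln subJ EJ1 wJV Delta0 te)
    (workload_tight subJ EJ1 wJV Delta0) => w slln tight.
  have h2 : 0 < 2^-1 :> R by rewrite invr_gt0.
  have [x hx] := tight _ h2.
  pose c := expR (- alpha * x%:R); have c0 : 0 < c := expR_gt0 _.
  rewrite ltNge; apply/negP => s0.
  have small : \forall n \near \oo,
      n%:R^-1 * (\sum_(k < n) exp_test alpha (V (Delta * k%:R) w)) < c * 2^-1.
    by apply: (cvgr_lt _ slln); rewrite (le_lt_trans s0)// mulr_gt0.
  near \oo => n.
  have n0 : 0 < n%:R :> R by rewrite ltr0n; near: n; exact: nbhs_infty_gt.
  have h3 : n%:R^-1 * (\sum_(k < n) exp_test alpha (V (Delta * k%:R) w)) < c * 2^-1.
    by near: n; exact: small.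
  have h4 : n%:R^-1 * (\sum_(k < n) ((x%:R < V (k%:R * Delta) w)%R%:R : R)) <= 2^-1.
    by near: n; exact: hx.
  have h5 : \sum_(k < n) (c * (1 - (x%:R < V (k%:R * Delta) w)%R%:R)) <=
      \sum_(k < n) exp_test alpha (V (Delta * k%:R) w).
    apply: ler_sum => k _; rewrite [Delta * _]mulrC.
    have [_|Vx] := ltP x%:R _; first by rewrite subrr mulr0 le_min ler01 expR_ge0.
    rewrite subr0 mulr1 le_min -{1}expR0 !ler_expR !mulNr lerN2 ler_pM2l// Vx andbT.
    by rewrite oppr_le0 mulr_ge0// ltW.
  rewrite -mulr_sumr sumrB sumr_const card_ord in h5.
  rewrite ler_pdivrMl// in h4; rewrite ltr_pdivrMl// in h3.
  have : c * (n%:R - n%:R * 2^-1) <= c * (n%:R - \sum_(k < n) ((x%:R < V (k%:R * Delta) w)%R%:R : R)).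
    by rewrite ler_pM2l// lerB.
  by move: h3 h5; lra.
(* The statement does not depend on [w]: were it false, the whole space would be negligible. *)
move=> h; apply: contrapT => ns.
have : P.-negligible [set: Omega] by apply: negligibleS h => w _ /=; exact: ns.
rewrite negligibleP//= probability_setT => /eqP.
by rewrite onee_eq0.
Unshelve. all: by end_near. Qed.

Variables (T : nat -> {RV P >-> R}) (xi : R) (nu : {measure set (measurableTypeR R) -> \bar R}).
Hypotheses (xi0 : 0 < xi) (sampling : poisson_sampling xi V T).
Hypothesis dsJ : driftless_subordinator J nu.

Lemma sampled_workload_ge0 : {ae P, forall w i, 0 <= sampled_workload V Delta T i w}.
Proof.
have [law_T _ _] := sampling.
apply: filterS2 (sampling_time_ge0 law_T) (workload_path_ae subJ wJV) => w S0 [rw V0 pV] i.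
apply: (@workload_ge0 _ _ _ w rw (fun t => V t) pV).
rewrite mulr_ge0 ?(ltW Delta0)// ler0z /round_nearest floor_ge0.
by rewrite addr_ge0 ?divr_ge0// ltW.
Qed.

Lemma estimator_cvg : {ae P, forall w,
  estimator V xi Delta T n alpha w @[n --> \oo] --> alpha - laplace_exponent nu alpha}.
Proof.
have te : test_function (exp_test alpha) := test_expR (ltW alpha0).
have ti := test_indicator (0 : R).
have s_gt0 := stationary_exp_gt0.
have denominators := sampled_cesaro xi0 Delta0 sampling (test_measurable te) (test_01 te)
  (workload_slln subJ EJ1 wJV Delta0 te).
have idles := sampled_cesaro xi0 Delta0 sampling (test_measurable ti) (test_01 ti)
  (workload_slln subJ EJ1 wJV Delta0 ti).
apply: filterS3 sampled_workload_ge0 denominators idles => w V0 cden cidle.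
have V_exp i : exp_test alpha (sampled_workload V Delta T i w) =
    expR (- alpha * sampled_workload V Delta T i w).
  by rewrite exp_testE// ltW.
have expE n : \sum_(1 <= i < n.+1) expR (- alpha * sampled_workload V Delta T i w) =
    \sum_(i < n) exp_test alpha (sampled_workload V Delta T i.+1 w).
  by rewrite big_add1 big_mkord; apply: eq_bigr => i _; rewrite V_exp.
have zeroE n : \sum_(1 <= i < n.+1) ((sampled_workload V Delta T i w == 0)%R%:R : R) =
    \sum_(i < n) (sampled_workload V Delta T i.+1 w <= 0)%R%:R.
  by rewrite big_add1 big_mkord; apply: eq_bigr => i _; rewrite eq_le V0 andbT.
rewrite /estimator; under eq_fun do rewrite /= expE zeroE.
have -> : alpha - laplace_exponent nu alpha =
    (0 + alpha * s (fun y => (y <= 0)%R%:R)) / s (exp_test alpha).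
  by rewrite add0r -(stationary_identity dsJ alpha0 Delta0) mulfK ?gt_eqF.
apply: cvgM; last first.
  by apply: cvgV => //; rewrite gt_eqF.
apply: cvgD; last exact: cvgMr.
apply/norm_cvg0P.
apply: (@squeeze_cvgr _ _ _ _ (fun=> 0) (fun n => n%:R^-1 * xi)).
- apply: nearW => n; rewrite normr_ge0/= normrM ger0_norm ?mulr_ge0 ?invr_ge0 ?(ltW xi0)//.
  rewrite ler_piMr ?mulr_ge0 ?invr_ge0 ?(ltW xi0)// -!V_exp.
  have /andP[a b] := test_01 te (sampled_workload V Delta T n w).
  have /andP[a' b'] := test_01 te (sampled_workload V Delta T 0 w).
  by rewrite ler_norml; apply/andP; split; lra.
- exact: cvg_cst.
- rewrite -(mul0r xi); apply: cvgMl.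
  rewrite -(cvg_shiftS (fun n => n%:R^-1 : R)); exact: cvg_harmonic.
Qed.

End estimator_limit.

Theorem theorem4p1 (d : measure_display) (Omega : measurableType d)
    (R : realType) (P : probability Omega R)
    (J V : R -> {RV P >-> R}) (T : nat -> {RV P >-> R})
    (nu : {measure set (measurableTypeR R) -> \bar R})
    (xi Delta alpha : R) :
  driftless_subordinator J nu ->
  ('E_P[J 1%R] < 1)%E ->
  workload J V ->
  0 < xi ->
  poisson_sampling xi V T ->
  0 < Delta ->
  0 <= alpha ->
  {ae P, forall w,
    estimator V xi Delta T n alpha w @[n --> \oo] --> levy_exponent J alpha}.
Proof.
move=> dsJ EJ1 wJV xi0 sampling Delta0; have [subJ _ _] := dsJ.
rewrite le_eqVlt => /predU1P[<-|alpha0]; last first.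
  rewrite (levy_exponentE dsJ (ltW alpha0)).
  exact: (estimator_cvg subJ EJ1 wJV Delta0 alpha0 xi0 sampling dsJ).
(* At [alpha = 0] the numerator of the estimator vanishes identically, and so does the exponent. *)
apply: aeW => w; rewrite (levy_exponentE dsJ (lexx 0)).
have -> : laplace_exponent nu 0 = 0.
  rewrite /laplace_exponent /Rintegral integral0_eq// => x _.
  by rewrite oppr0 mul0r expR0 subrr.
rewrite subrr; apply: cvg_near_cst; apply: nearW => n.
by rewrite /estimator oppr0 !mul0r subrr mulr0 addr0 mul0r.
Qed.
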